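(* For every Orlicz function $\Psi$ which does not satisfy the condition $\Delta_2$, there exists an analytic self-map $\phi\colon \mathbb{D}\to\mathbb{D}$ such that the composition operator $C_\phi$ is compact on $H^2$ but not compact on $H^\Psi$.
   Context: $\mathbb{D}$ is the open unit disk of $\mathbb{C}$, $\mathbb{T}=\partial\mathbb{D}$, and $m$ is normalized Lebesgue measure on $\mathbb{T}$. $H^p$ denotes the classical Hardy space on $\mathbb{D}$. For an analytic self-map $\phi\colon\mathbb{D}\to\mathbb{D}$, $C_\phi$ is the composition operator $f\mapsto f\circ\phi$. An Orlicz function is a non-decreasing convex function $\Psi\colon[0,\infty]\to[0,\infty]$ with $\Psi(0)=0$, $\Psi(\infty)=\infty$, which is moreover assumed to be continuous at $0$, strictly convex on $[0,\infty)$ (hence finite and increasing there), and such that $\Psi(x)/x\to\infty$ as $x\to\infty$. $L^\Psi(\mathbb{T})$ is the space of (classes of) measurable $f\colon\mathbb{T}\to\mathbb{C}$ for which there is $C>0$ with $\int_{\mathbb{T}}\Psi(|f|/C)\,dm<+\infty$; the Luxemburg norm $\|f\|_\Psi$ is the infimum of the constants $C>0$ such that this integral is $\le 1$. The Hardy-Orlicz space $H^\Psi$ is the space of all $f\in H^1$ whose boundary function $f^*$ lies in $L^\Psi(\mathbb{T})$, normed by $\|f^*\|_\Psi$. Every composition operator is bounded on every $H^p$ and on every $H^\Psi$. $\Psi$ satisfies condition $\Delta_2$ if there is a constant $C>0$ such that $\Psi(2x)\le C\,\Psi(x)$ for all $x$ large enough. *)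

(* Defs.v *)
From HB Require Import structures.
From mathcomp Require Import all_boot all_order all_algebra.
From mathcomp Require Import complex.
From mathcomp Require Import all_classical all_reals all_analysis.

Set Implicit Arguments.
Unset Strict Implicit.
Unset Printing Implicit Defensive.

Import Order.TTheory GRing.Theory Num.Theory.
Import numFieldNormedType.Exports.

Local Open Scope classical_set_scope.
Local Open Scope ring_scope.

(* [`|z|] lives in [R[i]]; the modulus as an element of [R] is [normc z].   *)
Notation modulus := (@ComplexField.Normc.normc _).

Section HardyOrlicz.
Variable R : realType.
Local Notation C := R[i].

Definition disk : set C := [set z | modulus z < 1].

(* Functions on the disk are total functions on [C] whose values outside    *)
(* the disk are irrelevant.                                                 *)
Definition holomorphic_on_disk (f : C -> C) : Prop :=
  forall z, disk z -> derivable (f : C^o -> C^o) z 1.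

Definition analytic_self_map (phi : C -> C) : Prop :=
  holomorphic_on_disk phi /\ forall z, disk z -> disk (phi z).

(* The unit circle is parametrized by [t |-> e^(it)], [0 <= t <= 2 pi], and *)
(* the normalized Lebesgue measure is carried by the parameter.             *)
Definition circ (t : R) : C := (cos t +i* sin t)%C.

Lemma two_pi_gt0 : 0 < 2 * pi :> R.
Proof. by rewrite mulr_gt0 ?ltr0n ?pi_gt0. Qed.

Definition circle_measure : {measure set (measurableTypeR R) -> \bar R} :=
  uniform_prob two_pi_gt0.

Definition Hp_norm (p : R) (f : C -> C) : \bar R :=
  ereal_sup [set ('N[circle_measure]_(p%:E)
                   [(fun t : R => (modulus (f (r%:C%C * circ t)))%:E)])%E
            | r in `[0, 1[ ].

Definition Hp (p : R) : set (C -> C) :=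
  [set f | holomorphic_on_disk f /\ (Hp_norm p f < +oo)%E].

(* Radial limits; for [f] in [H^1] they exist almost everywhere on the      *)
(* circle, and [lim] takes a default value at the remaining points.         *)
Definition boundary (f : C -> C) (zeta : C) : C :=
  lim ((f (r%:C%C * zeta) : C^o) @[r --> (1 : R)^'-]).

Record orlicz (Psi : \bar R -> \bar R) : Prop := Orlicz {
  orlicz_ge0 : forall x, (0 <= x)%E -> (0 <= Psi x)%E ;
  orlicz_nondecreasing :
    forall x y, (0 <= x)%E -> (x <= y)%E -> (Psi x <= Psi y)%E ;
  orlicz_convex : forall (x y : \bar R) (t : R), (0 <= x)%E -> (0 <= y)%E ->
    0 <= t <= 1 ->
    (Psi (t%:E * x + (1 - t)%:E * y) <=
     t%:E * Psi x + (1 - t)%:E * Psi y)%E ;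
  orlicz_0 : Psi 0%E = 0%E ;
  orlicz_oo : Psi +oo%E = +oo%E ;
  orlicz_continuous0 : Psi x%:E @[x --> (0 : R)^'+] --> Psi 0%E ;
  orlicz_strictly_convex : forall x y t : R, 0 <= x -> 0 <= y -> x != y ->
    0 < t < 1 ->
    (Psi (t * x + (1 - t) * y)%:E <
     t%:E * Psi x%:E + (1 - t)%:E * Psi y%:E)%E ;
  orlicz_superlinear :
    (Psi x%:E * (x^-1)%:E)%E @[x --> +oo%R] --> +oo%E
}.

Definition Delta2 (Psi : \bar R -> \bar R) : Prop :=
  exists2 K : R, 0 < K &
    \forall x \near +oo%R, (Psi (2 * x)%:E <= K%:E * Psi x%:E)%E.

Section Orlicz_spaces.
Variable Psi : \bar R -> \bar R.

Definition modular (K : R) (g : C -> C) : \bar R :=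
  (\int[circle_measure]_t Psi (modulus (g (circ t)) / K)%:E)%E.

Definition measurable_on_circle (g : C -> C) : Prop :=
  measurable_fun setT (fun t : R => complex.Re (g (circ t))) /\
  measurable_fun setT (fun t : R => complex.Im (g (circ t))).

Definition LPsi : set (C -> C) :=
  [set g | measurable_on_circle g /\
           exists2 K : R, 0 < K & (modular K g < +oo)%E].

Definition luxemburg (g : C -> C) : \bar R :=
  ereal_inf [set K%:E | K in [set K : R | 0 < K /\ (modular K g <= 1)%E]].

Definition HPsi : set (C -> C) := Hp 1 `&` (LPsi \o boundary).

Definition HPsi_norm (f : C -> C) : \bar R := luxemburg (boundary f).

End Orlicz_spaces.

Definition composition_operator (phi f : C -> C) : C -> C := f \o phi.

(* The operator [T] is compact on the space [X] normed by [N]: images of    *)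
(* bounded sequences have subsequences converging in [X].                   *)
Definition compact_operator (X : set (C -> C)) (N : (C -> C) -> \bar R)
    (T : (C -> C) -> (C -> C)) : Prop :=
  forall f : nat -> C -> C,
    (forall n, X (f n)) ->
    (exists M : R, forall n, (N (f n) <= M%:E)%E) ->
    exists s : nat -> nat, {homo s : m n / (m < n)%N} /\
    exists2 g, X g & N (T (f (s n)) - g) @[n --> \oo] --> 0%E.

End HardyOrlicz.

(* Main.v *)
(** The symbol is phi(z) = W((1+z)/(1-z)), where
    W(x) = e^(-x) (e^(-x) - 1 - e^(-2bx)) / 3 and b in (0,1] is a Liouville
    number. On the closed disk without the point 1, phi is continuous and
    |phi| < 1: equality would force x = iy with y = pi q, q an odd integer and
    b q an integer. For suitable odd q, however, b q is so close to an integer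
    that phi is within h of 1 on an arc of length comparable to h, where the
    scale h = h_q > 0 can be prescribed before b is chosen.

    Compactness on H^2. If h is bounded in H^2 then |h|^2 <= Re G with G
    holomorphic of controlled growth. The Poisson formula for Re (G o phi) at
    the point 1 - d, where |phi| <= 1/2, shows that |h o phi|^2 has mass O(d)
    on the arc of radius d around 1. Off this arc |phi| is bounded away from 1,
    and locally uniform convergence on the disk is enough.

    Failure on H^Psi. Since Delta_2 fails, there are arbitrarily large x_q for
    which Psi(2 x_q) / Psi(x_q) is as large as we like. With h = 1 / Psi(x_q),
    the functions x_q (h / (1+h-w))^2 lie in the unit ball. The image of each
    of them is at least x_q / 4 on an arc of length comparable to h, on which
    later images are uniformly small. If these images had a limit, then on
    half of the arc one of the two differences to it would be at least
    x_q / 16, and its modular would be of the order of h Psi(2 x_q). The limit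
    is only in H^1, so this needs the radial limits of H^1 functions: they are
    obtained from those of H^2 functions, because f = (1 + G + f) - (1 + G)
    where |f| <= Re G, and the fourth root of a function with positive real
    part is in H^2. *)

Require Import Defs.
From mathcomp Require Import all_boot all_order all_algebra.
From mathcomp Require Import complex ring lra zify.
From mathcomp Require Import all_classical all_reals all_analysis measurable_realfun.

Set Implicit Arguments.
Unset Strict Implicit.
Unset Printing Implicit Defensive.

Import Order.TTheory GRing.Theory Num.Theory.
Import numFieldNormedType.Exports.
Import ComplexField.

Local Open Scope classical_set_scope.
Local Open Scope ring_scope.


(** * Complex differentiability *)

(** Two demands on the symbol pull in opposite directions. If arcs of length at least c h were sent
    within h of 1 for scales h tending to 0 and one fixed c > 0, compactness on H^2 would fail as
    well. The comparability of arc and scale is therefore not uniform: the ratio is [touch_rate q],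
    which decays like q^-2. The lack of Delta_2 pays for this loss, because x_q can be taken with
    Psi(2 x_q) / Psi(x_q) > 4 pi / [touch_rate q]. This fixes the order of the choices: the angle,
    the rate and x_q depend on q alone, and b is built last, approximated to within 1 / (16
    Psi(x_q)) at the denominators q which its own construction visits. The arcs accumulate at 1, and
    there the H^2 estimate needs one fact only: phi stays in a smaller disk along the radius ending
    at 1. The factor e^(-x) of W provides it, and the Poisson kernel then does the work of a
    Carleson measure criterion. *)

Section modulus.
Variable R : realType.
Local Notation C := R[i].
Implicit Types z w : C.

Lemma modulusE z : modulus z ^+ 2 = complex.Re z ^+ 2 + complex.Im z ^+ 2.
Proof.
case: z => a b /=; rewrite sqr_sqrtr //; by rewrite addr_ge0 ?sqr_ge0.
Qed.

Lemma modulus_ge0 z : 0 <= modulus z.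
Proof. by case: z => a b /=; exact: sqrtr_ge0. Qed.

Lemma modulus0 : modulus (0 : C) = 0. Proof. exact: Normc.normc0. Qed.
Lemma modulus1 : modulus (1 : C) = 1. Proof. exact: Normc.normc1. Qed.

Lemma modulusM z w : modulus (z * w) = modulus z * modulus w.
Proof. exact: Normc.normcM. Qed.

Lemma modulusV z : modulus z^-1 = (modulus z)^-1.
Proof. exact: Normc.normcV. Qed.

Lemma modulusD z w : modulus (z + w) <= modulus z + modulus w.
Proof. exact: le_normcD. Qed.

Lemma modulusN z : modulus (- z) = modulus z.
Proof. exact: normcN. Qed.

Lemma modulusB z w : modulus (z - w) <= modulus z + modulus w.
Proof. by rewrite -(modulusN w) modulusD. Qed.

Lemma modulusC z w : modulus (z - w) = modulus (w - z).
Proof. by rewrite -modulusN opprB. Qed.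

Lemma modulus_lowerB z w : modulus z - modulus w <= modulus (z - w).
Proof. by rewrite lerBlDr -{1}(subrK w z) modulusD. Qed.

Lemma modulus_lowerD z w : modulus z - modulus w <= modulus (z + w).
Proof. by rewrite -(modulusN w) -{2}(opprK w) modulus_lowerB. Qed.

Lemma modulusX z n : modulus (z ^+ n) = modulus z ^+ n.
Proof. by elim: n => [|n IH]; rewrite ?expr0 ?modulus1 // !exprS modulusM IH. Qed.

Lemma modulus_eq0 z : (modulus z == 0) = (z == 0).
Proof.
by apply/eqP/eqP => [/Normc.eq0_normc//|->]; exact: modulus0.
Qed.

Lemma modulus_gt0 z : (0 < modulus z) = (z != 0).
Proof. by rewrite lt_def modulus_ge0 andbT modulus_eq0. Qed.

Lemma modulus_real (x : R) : modulus (x%:C%C) = `|x|.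
Proof. by rewrite /= expr0n /= addr0 sqrtr_sqr. Qed.

Lemma modulus_ge0_real (x : R) : 0 <= x -> modulus (x%:C%C) = x.
Proof. by move=> x0; rewrite modulus_real ger0_norm. Qed.

Lemma modulusJ z : modulus (z^*)%C = modulus z.
Proof. by case: z => a b /=; rewrite sqrrN. Qed.

Lemma Re_le_modulus z : `|complex.Re z| <= modulus z.
Proof.
rewrite -(@ler_pXn2r _ 2) ?nnegrE ?modulus_ge0 // real_normK ?num_real//.
by rewrite modulusE lerDl sqr_ge0.
Qed.

Lemma Im_le_modulus z : `|complex.Im z| <= modulus z.
Proof.
rewrite -(@ler_pXn2r _ 2) ?nnegrE ?modulus_ge0 // real_normK ?num_real//.
by rewrite modulusE lerDr sqr_ge0.
Qed.

Lemma modulus_le z : modulus z <= `|complex.Re z| + `|complex.Im z|.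
Proof.
rewrite -(@ler_pXn2r _ 2) ?nnegrE ?modulus_ge0 ?addr_ge0// modulusE.
rewrite sqrrD !real_normK ?num_real// -addrA lerD2l lerDr.
by rewrite mulrn_wge0// mulr_ge0.
Qed.

Lemma creD z w : complex.Re (z + w) = complex.Re z + complex.Re w.
Proof. by case: z; case: w. Qed.
Lemma cimD z w : complex.Im (z + w) = complex.Im z + complex.Im w.
Proof. by case: z; case: w. Qed.
Lemma creN z : complex.Re (- z) = - complex.Re z.
Proof. by case: z. Qed.
Lemma cimN z : complex.Im (- z) = - complex.Im z.
Proof. by case: z. Qed.
Lemma creM z w : complex.Re (z * w) =
  complex.Re z * complex.Re w - complex.Im z * complex.Im w.
Proof. by case: z; case: w. Qed.
Lemma cimM z w : complex.Im (z * w) =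
  complex.Re z * complex.Im w + complex.Im z * complex.Re w.
Proof. by case: z; case: w. Qed.
Lemma creJ z : complex.Re (z^*)%C = complex.Re z. Proof. by case: z. Qed.
Lemma cimJ z : complex.Im (z^*)%C = - complex.Im z. Proof. by case: z. Qed.

Lemma complexP z w : complex.Re z = complex.Re w ->
  complex.Im z = complex.Im w -> z = w.
Proof. by case: z => a b; case: w => c d /= -> ->. Qed.

Lemma mulcJ z : z * (z^*)%C = (modulus z ^+ 2)%:C%C.
Proof.
rewrite modulusE; case: z => a b; apply: complexP => /=; ring.
Qed.

End modulus.

Arguments ComplexField.Normc.normc : simpl never.

Section derivative.
Variable R : realType.
Local Notation C := R[i].
Implicit Types (f g : C -> C) (z w l h : C).

(** The remainder form is free of division and keeps every inequality in [R], whereas the norm of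
    [C^o] takes its values in [R[i]]; [derivable_cder] makes the translation once. *)
Definition has_der f z l := forall e : R, 0 < e -> exists2 d : R, 0 < d &
  forall h, modulus h < d ->
    modulus (f (z + h) - f z - l * h) <= e * modulus h.

Definition cder f z := exists l, has_der f z l.

Definition ccont f z := forall e : R, 0 < e -> exists2 d : R, 0 < d &
  forall w, modulus (w - z) < d -> modulus (f w - f z) < e.

Lemma cder_ccont f z : cder f z -> ccont f z.
Proof.
move=> [l fl] e e0; have [d d0 fd] := fl 1 ltr01.
pose M := modulus l + 1.
have M0 : 0 < M by rewrite ltr_pwDr ?modulus_ge0.
exists (Num.min d (e / (M *+ 2))).
  by rewrite lt_min d0 divr_gt0// mulrn_wgt0.
move=> w; rewrite lt_min => /andP[wd we].
have := fd _ wd; rewrite (addrC z) subrK mul1r => {}fd.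
have H : modulus (f w - f z) <= M * modulus (w - z).
  rewrite -[f w - f z](subrK (l * (w - z))).
  apply: le_trans (modulusD _ _) _; rewrite modulusM /M mulrDl mul1r addrC.
  by rewrite lerD2l.
apply: le_lt_trans H _; rewrite mulrC -ltr_pdivlMr//.
apply: lt_le_trans we _; rewrite ler_pM2l// lef_pV2 ?posrE// ?mulrn_wgt0//.
by rewrite mulr2n lerDl ltW.
Qed.

Lemma eq_has_der f g z l (d0 : R) : 0 < d0 ->
  (forall w, modulus (w - z) < d0 -> f w = g w) ->
  has_der f z l -> has_der g z l.
Proof.
move=> d00 fg fl e e0; have [d d_gt0 fd] := fl e e0.
exists (Num.min d d0); first by rewrite lt_min d_gt0.
move=> h; rewrite lt_min => /andP[hd hd0].
rewrite -!fg; [exact: fd| |]; first by rewrite subrr modulus0.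
by rewrite addrAC subrr add0r.
Qed.

Lemma has_der_cst c z : has_der (fun=> c) z 0.
Proof.
by move=> e e0; exists 1 => // h _; rewrite subrr mul0r subr0 modulus0 mulr_ge0 ?modulus_ge0// ltW.
Qed.

Lemma has_der_id z : has_der id z 1.
Proof.
move=> e e0; exists 1 => // h _.
rewrite (_ : _ - _ = 0) ?modulus0 ?mulr_ge0 ?modulus_ge0// ?ltW//=; ring.
Qed.

Lemma has_derD f g z l m : has_der f z l -> has_der g z m ->
  has_der (fun w => f w + g w) z (l + m).
Proof.
move=> fl gm e e0.
have [d1 d10 H1] := fl _ (divr_gt0 e0 (ltr0Sn _ 1)).
have [d2 d20 H2] := gm _ (divr_gt0 e0 (ltr0Sn _ 1)).
exists (Num.min d1 d2); first by rewrite lt_min d10.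
move=> h; rewrite lt_min => /andP[/H1 {}H1 /H2 {}H2].
have -> : f (z + h) + g (z + h) - (f z + g z) - (l + m) * h =
  (f (z + h) - f z - l * h) + (g (z + h) - g z - m * h) by ring.
apply: le_trans (modulusD _ _) _.
have -> : e * modulus h = e / 2 * modulus h + e / 2 * modulus h by field.
exact: lerD.
Qed.

Lemma has_derM f g z l m : has_der f z l -> has_der g z m ->
  has_der (fun w => f w * g w) z (l * g z + f z * m).
Proof.
move=> fl gm e e0.
pose A := modulus (f z) + 1; pose B := modulus (g z) + modulus l + 1.
have A0 : 0 < A by rewrite /A ltr_pwDr ?modulus_ge0.
have B0 : 0 < B by rewrite /B ltr_pwDr ?addr_ge0 ?modulus_ge0.
have cg : ccont g z by apply: cder_ccont; exists m.
have e20 : 0 < e / 4 by rewrite divr_gt0.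
have [d1 d10 H1] := fl _ (divr_gt0 e20 B0).
have [d2 d20 H2] := gm _ (divr_gt0 e20 A0).
have [d3 d30 H3] := cg _ (divr_gt0 e20 B0).
have [d4 d40 H4] := cg _ ltr01.
exists (Num.min (Num.min d1 d2) (Num.min d3 d4)); first by rewrite !lt_min d10 d20 d30.
move=> h; rewrite !lt_min => /andP[/andP[/H1 {}H1 /H2 {}H2] /andP[h3 h4]].
have zh : z + h - z = h by rewrite addrAC subrr add0r.
have := H3 (z + h); rewrite zh => /(_ h3) {}H3.
have := H4 (z + h); rewrite zh => /(_ h4) {}H4.
have -> : f (z + h) * g (z + h) - f z * g z - (l * g z + f z * m) * h =
  (f (z + h) - f z - l * h) * g (z + h) + f z * (g (z + h) - g z - m * h)
  + l * h * (g (z + h) - g z) by ring.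
apply: le_trans (modulusD _ _) _.
apply: le_trans (lerD (modulusD _ _) (lexx _)) _.
rewrite !modulusM.
have gB : modulus (g (z + h)) <= B.
  rewrite -[g (z + h)](subrK (g z)); apply: le_trans (modulusD _ _) _.
  rewrite /B; have := modulus_ge0 l; lra.
have h0 := modulus_ge0 h.
have T1 : modulus (f (z + h) - f z - l * h) * modulus (g (z + h)) <= e / 4 * modulus h.
  apply: le_trans (ler_pM (modulus_ge0 _) (modulus_ge0 _) H1 gB) _.
  by rewrite mulrAC divfK ?gt_eqF.
have T2 : modulus (f z) * modulus (g (z + h) - g z - m * h) <= e / 4 * modulus h.
  have fA : modulus (f z) <= A by rewrite /A lerDl.
  apply: le_trans (ler_pM (modulus_ge0 _) (modulus_ge0 _) fA H2) _.
  by rewrite mulrA mulrCA divff ?gt_eqF// mulr1.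
have T3 : modulus l * modulus h * modulus (g (z + h) - g z) <= e / 4 * modulus h.
  have lB : modulus l <= B by rewrite /B; have := modulus_ge0 (g z); lra.
  rewrite mulrAC ler_wpM2r//.
  apply: le_trans (ler_pM (modulus_ge0 _) (modulus_ge0 _) lB (ltW H3)) _.
  by rewrite mulrCA divff ?gt_eqF// mulr1.
have : 0 <= e * modulus h by rewrite mulr_ge0// ltW.
lra.
Qed.

Lemma has_der_comp f g z l m : has_der f z l -> has_der g (f z) m ->
  has_der (fun w => g (f w)) z (m * l).
Proof.
move=> fl gm e e0.
pose L := modulus l + 1.
have L0 : 0 < L by rewrite /L ltr_pwDr ?modulus_ge0.
have M0 : 0 < modulus m + 1 by rewrite ltr_pwDr ?modulus_ge0.
have e20 : 0 < e / 2 by rewrite divr_gt0.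
have [d1 d10 H1] := gm _ (divr_gt0 e20 L0).
have [d2 d20 H2] := fl _ (divr_gt0 e20 M0).
have [d3 d30 H3] := fl _ ltr01.
exists (Num.min (d1 / L) (Num.min d2 d3)); first by rewrite !lt_min d20 d30 divr_gt0.
move=> h; rewrite !lt_min => /andP[h1 /andP[/H2 {}H2 /H3 {}H3]].
set k := f (z + h) - f z.
have kh : modulus k <= L * modulus h.
  rewrite -[k](subrK (l * h)).
  apply: le_trans (modulusD _ _) _; rewrite modulusM /L mulrDl addrC lerD2l.
  exact: H3.
have kd : modulus k < d1.
  by apply: le_lt_trans kh _; rewrite mulrC -ltr_pdivlMr.
have := H1 _ kd; rewrite {1}/k (addrC (f z)) subrK => {}H1.
have -> : g (f (z + h)) - g (f z) - m * l * h =
  (g (f (z + h)) - g (f z) - m * k) + m * (k - l * h) by ring.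
apply: le_trans (modulusD _ _) _; rewrite modulusM.
have T1 : modulus (g (f (z + h)) - g (f z) - m * k) <= e / 2 * modulus h.
  apply: le_trans H1 _.
  have := ler_wpM2l (ltW (divr_gt0 e20 L0)) kh.
  by rewrite mulrA divfK ?gt_eqF.
have T2 : modulus m * modulus (k - l * h) <= e / 2 * modulus h.
  have mM : modulus m <= modulus m + 1 by rewrite lerDl.
  apply: le_trans (ler_pM (modulus_ge0 _) (modulus_ge0 _) mM H2) _.
  by rewrite mulrA mulrCA divff ?gt_eqF// mulr1.
have : 0 <= e * modulus h by rewrite mulr_ge0 ?modulus_ge0// ltW.
lra.
Qed.

Lemma has_derV z : z != 0 -> has_der (fun w => w^-1) z (- (z ^- 2)).
Proof.
move=> z0 e e0.
have m0 : 0 < modulus z by rewrite modulus_gt0.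
exists (Num.min (modulus z / 2) (e * modulus z ^+ 3 / 2)).
  by rewrite lt_min !divr_gt0// mulr_gt0// exprn_gt0.
move=> h; rewrite lt_min => /andP[h1 h2].
have zh2 : modulus z / 2 <= modulus (z + h).
  by have := modulus_lowerD z h; lra.
have zh0 : z + h != 0 by rewrite -modulus_gt0; lra.
have -> : (z + h)^-1 - z^-1 - - z ^- 2 * h = h ^+ 2 * (z + h)^-1 * z ^- 2.
  by field; apply/andP.
rewrite !modulusM !modulusV !modulusX expr2 -!mulrA mulrC ler_wpM2r ?modulus_ge0//.
have : (modulus (z + h))^-1 <= 2 / modulus z.
  rewrite -[leRHS]invrK lef_pV2 ?posrE ?invf_div//; lra.
move=> H.
have zz : 0 < modulus z ^- 2 by rewrite invr_gt0 exprn_gt0.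
apply: (@le_trans _ _ (modulus h * (2 / modulus z * modulus z ^- 2))).
  by rewrite ler_wpM2l ?modulus_ge0// ler_wpM2r// ltW.
have -> : 2 / modulus z * modulus z ^- 2 = 2 / modulus z ^+ 3.
  by field; rewrite gt_eqF.
rewrite mulrA ler_pdivrMr ?exprn_gt0//; lra.
Qed.

Lemma cder_cst c z : cder (fun=> c) z. Proof. by exists 0; exact: has_der_cst. Qed.
Lemma cder_id z : cder id z. Proof. by exists 1; exact: has_der_id. Qed.
Lemma cderD f g z : cder f z -> cder g z -> cder (fun w => f w + g w) z.
Proof. by move=> [l fl] [m gm]; exists (l + m); exact: has_derD. Qed.
Lemma cderM f g z : cder f z -> cder g z -> cder (fun w => f w * g w) z.
Proof. by move=> [l fl] [m gm]; eexists; exact: (has_derM fl gm). Qed.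
Lemma cderN f z : cder f z -> cder (fun w => - f w) z.
Proof.
move=> fz; suff : cder (fun w => -1 * f w) z.
  by congr cder; apply/funext => w; rewrite mulN1r.
by apply: cderM => //; exact: cder_cst.
Qed.
Lemma cderB f g z : cder f z -> cder g z -> cder (fun w => f w - g w) z.
Proof. by move=> fz gz; apply: cderD => //; exact: cderN. Qed.
Lemma cder_comp f g z : cder f z -> cder g (f z) -> cder (fun w => g (f w)) z.
Proof. by move=> [l fl] [m gm]; eexists; exact: has_der_comp fl gm. Qed.
Lemma cderV f z : f z != 0 -> cder f z -> cder (fun w => (f w)^-1) z.
Proof.
by move=> f0 fz; apply: (cder_comp (g := fun w => w^-1)) => //; eexists; exact: has_derV.
Qed.
Lemma cderX f n z : cder f z -> cder (fun w => f w ^+ n) z.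
Proof.
move=> fz; elim: n => [|n IH].
  by rewrite (_ : (fun w => _) = fun=> 1) ?funeqE//; exact: cder_cst.
rewrite (_ : (fun w => _) = fun w => f w * f w ^+ n).
  exact: cderM.
by apply/funext => w; rewrite exprS.
Qed.
Lemma eq_cder f g z (d0 : R) : 0 < d0 ->
  (forall w, modulus (w - z) < d0 -> f w = g w) -> cder f z -> cder g z.
Proof. by move=> d00 fg [l fl]; exists l; exact: (eq_has_der d00 fg fl). Qed.

(** Schwarz reflection. It makes z |-> conj(k(conj(q / z))) holomorphic in the proof of
    [sqmean_cross]. *)
Lemma cder_conj f z : cder f (z^*)%C -> cder (fun w => (f (w^*)%C)^*%C) z.
Proof.
move=> [l fl]; exists (l^*)%C => e e0; have [d d0 H] := fl e e0.
exists d => // h hd; have := H (h^*)%C; rewrite modulusJ => /(_ hd).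
rewrite -[X in X <= _]modulusJ; congr (modulus _ <= _).
by rewrite !rmorphB rmorphM /= conjcK rmorphD.
Qed.

Lemma derivable_cder f z : derivable (f : C^o -> C^o) z 1 <-> cder f z.
Proof.
split.
- move=> /cvg_ex[/= l fl]; exists l => e e0.
  move/cvgrPdist_le : fl => /(_ (e%:C)%C); rewrite ltcR => /(_ e0).
  (* A strict inequality in [R[i]] includes the equality of the imaginary parts, so the radius is a
     real number. *)
  move=> /nbhs_ballP[[d di] /=]; rewrite ltcE /= => /andP[/eqP di0 d0] H.
  exists d => // h hd.
  have [->|h0] := eqVneq h 0.
    by rewrite addr0 subrr mulr0 subr0 modulus0 mulr0.
  have := H h; rewrite /ball /= sub0r normrN.
  have -> : `|h| = (modulus h)%:C%C by [].
  rewrite ltcE /= di0 eqxx /= => /(_ hd h0).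
  rewrite -[X in X <= _]/((modulus _)%:C%C) lecR => {}H.
  rewrite [h *: _]mulr1 [h^-1 *: _]/(h^-1 * _) in H.
  rewrite -modulusN.
  have -> : - (f (z + h) - f z - l * h) = (l - h^-1 * (f (h + z) - f z)) * h.
    by rewrite (addrC z); field.
  by rewrite modulusM ler_wpM2r// modulus_ge0.
- move=> [l fl]; apply/cvg_ex; exists l; apply/cvgrPdist_le => /= -[e ei].
  rewrite ltcE /= => /andP[/eqP ei0 e0].
  have [d d0 H] := fl e e0.
  apply/nbhs_ballP; exists (d%:C)%C; first by rewrite /= ltcR.
  move=> h; rewrite /ball /= sub0r normrN.
  have -> : `|h| = (modulus h)%:C%C by [].
  rewrite ltcR => hd h0.
  have := H h hd.
  rewrite -[`|_|]/((modulus _)%:C%C) lecE /= ei0 eqxx /=.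
  rewrite [h *: _]mulr1 [h^-1 *: _]/(h^-1 * _).
  rewrite -modulusN.
  have -> : - (f (z + h) - f z - l * h) = (l - h^-1 * (f (h + z) - f z)) * h.
    by rewrite (addrC z); field.
  by rewrite modulusM ler_pM2r// modulus_gt0.
Qed.

End derivative.


(** * Path integrals and Goursat's lemma *)

Section integral.
Variable R : realType.
Local Notation C := R[i].
Local Notation mu := (@lebesgue_measure R).
Implicit Types (a b c : R) (u v : R -> R) (f g : R -> C).

(** There is no orientation: for b < a the segment is empty and the integral is 0, hence the order
    hypotheses of [rint_split] and [rint_cst]. *)
Definition rint a b u : R := \int[mu]_(x in `[a, b]) u x.

Definition rcont a b u := forall t, a <= t <= b -> {for t, continuous u}.

Lemma rcont_within a b u : rcont a b u -> {within `[a, b], continuous u}.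
Proof.
move=> H; apply: continuous_in_subspaceT => t; rewrite inE /= in_itv /= => tab.
exact: H.
Qed.

Lemma rcont_integrable a b u : rcont a b u -> mu.-integrable `[a, b] (EFin \o u).
Proof.
move=> H; apply: continuous_compact_integrable; first exact: segment_compact.
exact: rcont_within.
Qed.

Lemma rintD a b u v : rcont a b u -> rcont a b v ->
  rint a b (fun x => u x + v x) = rint a b u + rint a b v.
Proof. by move=> cu cv; apply: RintegralD => //; exact: rcont_integrable. Qed.

Lemma rintB a b u v : rcont a b u -> rcont a b v ->
  rint a b (fun x => u x - v x) = rint a b u - rint a b v.
Proof. by move=> cu cv; apply: RintegralB => //; exact: rcont_integrable. Qed.

Lemma rintZ a b u k : rcont a b u -> rint a b (fun x => k * u x) = k * rint a b u.
Proof. by move=> cu; apply: RintegralZl => //; exact: rcont_integrable. Qed.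

Lemma eq_rint a b u v : (forall t, a <= t <= b -> u t = v t) -> rint a b u = rint a b v.
Proof. by move=> uv; apply: eq_Rintegral => t; rewrite inE /= in_itv /= => /uv. Qed.

Lemma rint_le a b u v : rcont a b u -> rcont a b v ->
  (forall t, a <= t <= b -> u t <= v t) -> rint a b u <= rint a b v.
Proof.
move=> cu cv uv; apply: le_Rintegral; [by []|exact: rcont_integrable|exact: rcont_integrable|].
by move=> t; rewrite /= in_itv /= => /uv.
Qed.

Lemma rint_ge0 a b u : (forall t, a <= t <= b -> 0 <= u t) -> 0 <= rint a b u.
Proof. by move=> u0; apply: Rintegral_ge0 => t; rewrite /= in_itv /= => /u0. Qed.

Lemma rint_cst a b k : a <= b -> rint a b (fun=> k) = k * (b - a).
Proof.
move=> ab; rewrite /rint Rintegral_cst//= lebesgue_measure_itv /= lte_fin.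
by move: ab; rewrite le_eqVlt => /predU1P[->|->//]; rewrite ltxx subrr.
Qed.

Lemma rint_split a b c u : a <= c -> c <= b -> rcont a b u ->
  rint a b u = rint a c u + rint c b u.
Proof.
move=> ac cb cu; have iu := rcont_integrable cu.
have := @Rintegral_itvB _ u (BLeft a) (BRight b) c iu.
rewrite !bnd_simp => /(_ ac cb) /eqP; rewrite subr_eq addrC {1}/rint => /eqP ->; congr (_ + _).
by rewrite Rintegral_itv_obnd_cbnd//; apply: (integrableS _ _ _ iu) => //;
  apply: subset_itv; rewrite bnd_simp.
Qed.

Definition pcontat f t := forall e : R, 0 < e -> exists2 d : R, 0 < d &
  forall s, `|s - t| < d -> modulus (f s - f t) < e.

Definition pcont a b f := forall t, a <= t <= b -> pcontat f t.

Lemma rcontatP u t : {for t, continuous u} <-> (forall e : R, 0 < e ->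
  exists2 d : R, 0 < d & forall s, `|s - t| < d -> `|u s - u t| < e).
Proof.
split=> [H e e0|H].
  move/cvgrPdist_lt : H => /(_ _ e0) /nbhs_ballP[d /= d0 H].
  exists d => // s sd; rewrite distrC; apply: H.
  by rewrite /ball /= distrC.
apply/cvgrPdist_lt => e e0; have [d d0 {}H] := H e e0.
apply/nbhs_ballP; exists d => // s; rewrite /ball /= distrC => /H.
by rewrite distrC.
Qed.

Lemma pcontat_Re f t : pcontat f t -> {for t, continuous (fun s => complex.Re (f s))}.
Proof.
move=> ft; apply/rcontatP => e /ft[d d0 H]; exists d => // s /H; apply: le_lt_trans.
by rewrite -creN -creD Re_le_modulus.
Qed.

Lemma pcontat_Im f t : pcontat f t -> {for t, continuous (fun s => complex.Im (f s))}.
Proof.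
move=> ft; apply/rcontatP => e /ft[d d0 H]; exists d => // s /H; apply: le_lt_trans.
by rewrite -cimN -cimD Im_le_modulus.
Qed.

Lemma pcontat_modulus f t : pcontat f t -> {for t, continuous (fun s => modulus (f s))}.
Proof.
move=> ft; apply/rcontatP => e /ft[d d0 H]; exists d => // s /H; apply: le_lt_trans.
rewrite ler_norml modulus_lowerB andbT lerNl opprB modulusC.
exact: modulus_lowerB.
Qed.

Lemma pcontatE f t : {for t, continuous (fun s => complex.Re (f s))} ->
  {for t, continuous (fun s => complex.Im (f s))} -> pcontat f t.
Proof.
move=> /rcontatP fr /rcontatP fi e e0; have e20 : 0 < e / 2 by rewrite divr_gt0.
have [d1 d10 H1] := fr _ e20; have [d2 d20 H2] := fi _ e20.
exists (Num.min d1 d2); first by rewrite lt_min d10.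
move=> s; rewrite lt_min => /andP[/H1 {}H1 /H2 {}H2].
apply: le_lt_trans (modulus_le _) _; rewrite creD cimD creN cimN.
by rewrite [ltRHS](splitr e); apply: ltrD.
Qed.

Lemma pcontat_cst k t : pcontat (fun=> k) t.
Proof. by move=> e e0; exists 1 => // s _; rewrite subrr modulus0. Qed.

Lemma pcontatD f g t : pcontat f t -> pcontat g t -> pcontat (fun s => f s + g s) t.
Proof.
move=> ft gt e e0; have e20 : 0 < e / 2 by rewrite divr_gt0.
have [d1 d10 H1] := ft _ e20; have [d2 d20 H2] := gt _ e20.
exists (Num.min d1 d2); first by rewrite lt_min d10.
move=> s; rewrite lt_min => /andP[/H1 {}H1 /H2 {}H2].
rewrite opprD addrACA; apply: le_lt_trans (modulusD _ _) _.
by rewrite [ltRHS](splitr e); apply: ltrD.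
Qed.

Lemma pcontatM f g t : pcontat f t -> pcontat g t -> pcontat (fun s => f s * g s) t.
Proof.
move=> ft gt; apply: pcontatE.
- have -> : (fun s => complex.Re (f s * g s)) =
      fun s => complex.Re (f s) * complex.Re (g s) - complex.Im (f s) * complex.Im (g s).
    by apply/funext => s; rewrite creM.
  apply: continuousB; apply: continuousM; by [exact: pcontat_Re|exact: pcontat_Im].
- have -> : (fun s => complex.Im (f s * g s)) =
      fun s => complex.Re (f s) * complex.Im (g s) + complex.Im (f s) * complex.Re (g s).
    by apply/funext => s; rewrite cimM.
  apply: continuousD; apply: continuousM; by [exact: pcontat_Re|exact: pcontat_Im].
Qed.

Lemma pcontatJ f t : pcontat f t -> pcontat (fun s => (f s)^*%C) t.
Proof.
by move=> ft e e0; have [d d0 H] := ft _ e0; exists d => // s /H;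
  rewrite -rmorphB modulusJ.
Qed.

Lemma pcontat_real u t : {for t, continuous u} -> pcontat (fun s => (u s)%:C%C) t.
Proof. by move=> cu; apply: pcontatE => //=; exact: cst_continuous. Qed.

Lemma pcontat_comp (F : C -> C) f t : pcontat f t -> ccont F (f t) -> pcontat (fun s => F (f s)) t.
Proof.
move=> ft Ft e e0; have [d d0 H] := Ft _ e0; have [d' d'0 H'] := ft _ d0.
by exists d' => // s /H' /H.
Qed.

Lemma pcontD a b f g : pcont a b f -> pcont a b g -> pcont a b (fun s => f s + g s).
Proof. by move=> cf cg t tab; apply: pcontatD; [exact: cf|exact: cg]. Qed.
Lemma pcontM a b f g : pcont a b f -> pcont a b g -> pcont a b (fun s => f s * g s).
Proof. by move=> cf cg t tab; apply: pcontatM; [exact: cf|exact: cg]. Qed.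
Lemma pcont_cst a b k : pcont a b (fun=> k).
Proof. by move=> t tab; exact: pcontat_cst. Qed.
Lemma pcontZ a b k f : pcont a b f -> pcont a b (fun s => k * f s).
Proof. by move=> cf; apply: pcontM => //; exact: pcont_cst. Qed.
Lemma pcontN a b f : pcont a b f -> pcont a b (fun s => - f s).
Proof. by move=> cf; under eq_fun do rewrite -mulN1r; exact: pcontZ. Qed.
Lemma pcontB a b f g : pcont a b f -> pcont a b g -> pcont a b (fun s => f s - g s).
Proof. by move=> cf cg; apply: pcontD => //; exact: pcontN. Qed.
Lemma pcontJ a b f : pcont a b f -> pcont a b (fun s => (f s)^*%C).
Proof. by move=> cf t tab; apply: pcontatJ; exact: cf. Qed.
Lemma pcont_Re a b f : pcont a b f -> rcont a b (fun s => complex.Re (f s)).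
Proof. by move=> cf t tab; apply: pcontat_Re; exact: cf. Qed.
Lemma pcont_Im a b f : pcont a b f -> rcont a b (fun s => complex.Im (f s)).
Proof. by move=> cf t tab; apply: pcontat_Im; exact: cf. Qed.
Lemma pcont_modulus a b f : pcont a b f -> rcont a b (fun s => modulus (f s)).
Proof. by move=> cf t tab; apply: pcontat_modulus; exact: cf. Qed.
Lemma pcont_real a b u : rcont a b u -> pcont a b (fun s => (u s)%:C%C).
Proof. by move=> cu t tab; apply: pcontat_real; exact: cu. Qed.

Definition cint a b f : C :=
  (rint a b (fun t => complex.Re (f t)) +i* rint a b (fun t => complex.Im (f t)))%C.

Lemma eq_cint a b f g : (forall t, a <= t <= b -> f t = g t) -> cint a b f = cint a b g.
Proof.
by move=> fg; rewrite /cint; congr (_ +i* _)%C; apply: eq_rint => t /fg ->.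
Qed.

Lemma cintD a b f g : pcont a b f -> pcont a b g ->
  cint a b (fun t => f t + g t) = cint a b f + cint a b g.
Proof.
move=> cf cg; apply: complexP.
  rewrite creD -rintD; by [apply: eq_rint => t _; rewrite creD|exact: pcont_Re].
rewrite cimD -rintD; by [apply: eq_rint => t _; rewrite cimD|exact: pcont_Im].
Qed.

Lemma cintZ a b k f : pcont a b f -> cint a b (fun t => k * f t) = k * cint a b f.
Proof.
move=> cf; have cR := pcont_Re cf; have cI := pcont_Im cf.
have cZ u l : rcont a b u -> rcont a b (fun t => l * u t).
  by move=> cu t tab; apply: continuousM; [exact: cst_continuous|exact: cu].
apply: complexP.
  rewrite creM /= -!rintZ// -rintB; [|exact: cZ..].
  by apply: eq_rint => t _; rewrite creM.
rewrite cimM /= -!rintZ// -rintD; [|exact: cZ..].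
by apply: eq_rint => t _; rewrite cimM.
Qed.

Lemma cintN a b f : pcont a b f -> cint a b (fun t => - f t) = - cint a b f.
Proof. by move=> cf; rewrite -mulN1r -cintZ//; apply: eq_cint => t _; rewrite mulN1r. Qed.

Lemma cintB a b f g : pcont a b f -> pcont a b g ->
  cint a b (fun t => f t - g t) = cint a b f - cint a b g.
Proof. by move=> cf cg; rewrite cintD ?cintN//; exact: pcontN. Qed.

Lemma cint_cst a b k : a <= b -> cint a b (fun=> k) = k * (b - a)%:C%C.
Proof.
move=> ab; apply: complexP.
  by rewrite creM /= rint_cst// mulr0 subr0.
by rewrite cimM /= rint_cst// mulr0 add0r.
Qed.

Lemma cintJ a b f : pcont a b f -> cint a b (fun t => (f t)^*%C) = (cint a b f)^*%C.
Proof.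
move=> cf; apply: complexP => /=; first by apply: eq_rint => t _; rewrite creJ.
rewrite -mulN1r -rintZ; last exact: pcont_Im.
by apply: eq_rint => t _; rewrite cimJ mulN1r.
Qed.

Lemma cint_split a b c f : a <= c -> c <= b -> pcont a b f ->
  cint a b f = cint a c f + cint c b f.
Proof.
move=> ac cb cf; apply: complexP.
  by rewrite creD; apply: rint_split => //; exact: pcont_Re.
by rewrite cimD; apply: rint_split => //; exact: pcont_Im.
Qed.

(* rotating the value of the integral onto the positive axis *)
Lemma modulus_cint a b f : pcont a b f ->
  modulus (cint a b f) <= rint a b (fun t => modulus (f t)).
Proof.
move=> cf; have [->|I0] := eqVneq (cint a b f) 0.
  by rewrite modulus0; apply: rint_ge0 => t _; exact: modulus_ge0.
set I := cint a b f; have mI : 0 < modulus I by rewrite modulus_gt0.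
pose w : C := (I^*)%C / (modulus I)%:C%C.
have mw : modulus w = 1.
  by rewrite modulusM modulusV modulusJ modulus_ge0_real ?modulus_ge0// divff// gt_eqF.
have wI : w * I = (modulus I)%:C%C.
  rewrite /w mulrAC (mulrC _ I) mulcJ rmorphXn /= expr2 mulfK//.
  by rewrite -modulus_gt0 modulus_ge0_real ?modulus_ge0.
have -> : modulus I = rint a b (fun t => complex.Re (w * f t)).
  by have := congr1 (@complex.Re _) wI; rewrite /I -cintZ.
apply: rint_le; [exact/pcont_Re/pcontZ|exact: pcont_modulus|].
move=> t _; apply: le_trans (ler_norm _) _; apply: le_trans (Re_le_modulus _) _.
by rewrite modulusM mw mul1r.
Qed.

Lemma cint_bound a b f (M : R) : a <= b -> pcont a b f ->
  (forall t, a <= t <= b -> modulus (f t) <= M) -> modulus (cint a b f) <= M * (b - a).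
Proof.
move=> ab cf fM; apply: le_trans (modulus_cint cf) _.
rewrite -rint_cst//; apply: rint_le => //; first exact: pcont_modulus.
by move=> t _; exact: cst_continuous.
Qed.

End integral.

Arguments rint : simpl never.
Arguments cint : simpl never.


Section goursat.
Variable R : realType.
Local Notation C := R[i].
Implicit Types (a b c d w h x y : R) (F : C -> C) (z : C).

Lemma exp2_unbounded (x : R) : exists n, x < 2 ^+ n.
Proof.
have [n xn] : exists n : nat, x < n%:R by exists (Num.trunc `|x|).+1; apply: le_lt_trans (ler_norm x) _; exact: truncnS_gt.
exists n; apply: lt_trans xn _; rewrite -natrX ltr_nat; exact: ltn_expl.
Qed.

Lemma pcontat_horiz d x : pcontat (fun s => (s +i* d)%C) x.
Proof. by apply: pcontatE => /=; [exact: id|exact: cst_continuous]. Qed.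

Lemma pcontat_vert b y : pcontat (fun s => (b +i* s)%C) y.
Proof. by apply: pcontatE => /=; [exact: cst_continuous|exact: id]. Qed.

(** The contour integral of F(z) dz along the boundary of [a, b] x [c, d], counterclockwise; the
    factor ['i] comes from dz = i dy on the vertical sides. *)
Definition bdint F a b c d : C :=
  cint a b (fun x => F (x +i* c)%C) - cint a b (fun x => F (x +i* d)%C)
  + 'i%C * (cint c d (fun y => F (b +i* y)%C) - cint c d (fun y => F (a +i* y)%C)).

Definition rect_cont F a b c d := forall x y, a <= x <= b -> c <= y <= d -> ccont F (x +i* y)%C.

Lemma rect_cont_sub F a b c d a' b' c' d' : a <= a' -> b' <= b -> c <= c' -> d' <= d ->
  rect_cont F a b c d -> rect_cont F a' b' c' d'.
Proof. by move=> ? ? ? ? H x y /andP[? ?] /andP[? ?]; apply: H; apply/andP; split; lra. Qed.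

Lemma pcont_horiz F a b c d y : c <= y <= d -> rect_cont F a b c d ->
  pcont a b (fun x => F (x +i* y)%C).
Proof.
by move=> cyd H x xab; apply: (pcontat_comp (pcontat_horiz y x)); exact: H.
Qed.

Lemma pcont_vert F a b c d x : a <= x <= b -> rect_cont F a b c d ->
  pcont c d (fun y => F (x +i* y)%C).
Proof.
by move=> cyd H y yab; apply: (pcontat_comp (pcontat_vert x y)); exact: H.
Qed.

Lemma bdint_splitx F a m b c d : a <= m -> m <= b -> c <= d -> rect_cont F a b c d ->
  bdint F a b c d = bdint F a m c d + bdint F m b c d.
Proof.
move=> am mb cd H; rewrite /bdint.
rewrite (cint_split am mb (pcont_horiz _ H)) ?lexx//.
rewrite (cint_split (f := fun x => F (x +i* d)%C) am mb (pcont_horiz _ H)) ?lexx ?andbT//.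
ring.
Qed.

Lemma bdint_splity F a b c m d : c <= m -> m <= d -> a <= b -> rect_cont F a b c d ->
  bdint F a b c d = bdint F a b c m + bdint F a b m d.
Proof.
move=> cm md ab H; rewrite /bdint.
rewrite (cint_split (f := fun x => F (b +i* x)%C) cm md (pcont_vert _ H)) ?lexx ?andbT//.
rewrite (cint_split (f := fun x => F (a +i* x)%C) cm md (pcont_vert _ H)) ?lexx ?andbT//.
ring.
Qed.

(** The values on opposite sides differ by a constant, q times the width or q times i times the
    height, and the two contributions cancel. *)
Lemma bdint_affine (p q : C) a b c d : a <= b -> c <= d ->
  bdint (fun z => p + q * z) a b c d = 0.
Proof.
move=> ab cd.
have cf : rect_cont (fun z => p + q * z) a b c d.
  move=> x y _ _; apply: cder_ccont; apply: cderD; first exact: cder_cst.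
  by apply: cderM; [exact: cder_cst|exact: cder_id].
rewrite /bdint -!cintB.
- rewrite (@eq_cint _ a b _ (fun=> q * 'i%C * (c - d)%:C%C)); last first.
    by move=> t _; move: p q {cf} => [p1 p2] [q1 q2]; apply: complexP => /=; ring.
  rewrite (@eq_cint _ c d _ (fun=> q * (b - a)%:C%C)); last first.
    by move=> t _; move: p q {cf} => [p1 p2] [q1 q2]; apply: complexP => /=; ring.
  by rewrite !cint_cst//; move: q {cf} => [q1 q2]; apply: complexP => /=; ring.
- by apply: (pcont_vert _ cf); rewrite lexx ab.
- by apply: (pcont_vert _ cf); rewrite lexx ab.
- by apply: (pcont_horiz _ cf); rewrite lexx cd.
- by apply: (pcont_horiz _ cf); rewrite lexx cd.
Qed.

(** The affine tangent map integrates to 0. What remains is at most e S on a boundary of length 2 S,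
    where S is the half perimeter and bounds the distance to [z0]. *)
Lemma bdint_approx F a b c d z0 l (e : R) : a <= b -> c <= d -> 0 <= e ->
  rect_cont F a b c d ->
  a <= complex.Re z0 <= b -> c <= complex.Im z0 <= d ->
  (forall x y, a <= x <= b -> c <= y <= d ->
    let z := (x +i* y)%C in modulus (F z - F z0 - l * (z - z0)) <= e * modulus (z - z0)) ->
  modulus (bdint F a b c d) <= 2 * e * ((b - a) + (d - c)) ^+ 2.
Proof.
move=> ab cd e0 cF xz yz H.
pose L z := (F z0 - l * z0) + l * z.
pose D z := F z - L z.
have cL : rect_cont L a b c d.
  move=> x y _ _; apply: cder_ccont; apply: cderD; first exact: cder_cst.
  by apply: cderM; [exact: cder_cst|exact: cder_id].
have cD : rect_cont D a b c d.
  move=> x y xab yab e' e'0.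
  have [d1 d10 H1] := cF _ _ xab yab _ (divr_gt0 e'0 (ltr0Sn _ 1)).
  have [d2 d20 H2] := cL _ _ xab yab _ (divr_gt0 e'0 (ltr0Sn _ 1)).
  exists (Num.min d1 d2); first by rewrite lt_min d10.
  move=> w; rewrite lt_min => /andP[/H1 {}H1 /H2 {}H2].
  have -> : D w - D (x +i* y)%C = (F w - F (x +i* y)%C) - (L w - L (x +i* y)%C) by rewrite /D; ring.
  apply: le_lt_trans (modulusB _ _) _; lra.
set S := (b - a) + (d - c).
have Db x y : a <= x <= b -> c <= y <= d -> modulus (D (x +i* y)%C) <= e * S.
  move=> xab yab; have /= := H _ _ xab yab.
  have -> : F (x +i* y)%C - F z0 - l * ((x +i* y)%C - z0) = D (x +i* y)%C by rewrite /D /L; ring.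
  move=> /le_trans; apply; rewrite ler_wpM2l//.
  apply: le_trans (modulus_le _) _; rewrite creD cimD creN cimN /=.
  rewrite /S lerD// ler_norml; move: xab yab xz yz => /andP[? ?] /andP[? ?] /andP[? ?] /andP[? ?];
    apply/andP; split; lra.
have -> : bdint F a b c d = bdint D a b c d.
  have : bdint L a b c d = 0 by exact: bdint_affine.
  rewrite /bdint /D !cintB; do ?[apply: pcont_horiz; [|eassumption]; by rewrite lexx ?ab ?cd];
    do ?[apply: pcont_vert; [|eassumption]; by rewrite lexx ?ab ?cd].
  by move=> L0; rewrite -[LHS]subr0 -L0; ring.
have SE : (e * S) * (b - a) + (e * S) * (b - a) + ((e * S) * (d - c) + (e * S) * (d - c)) = 2 * e * S ^+ 2.
  by rewrite /S; ring.
rewrite -SE; apply: le_trans (modulusD _ _) _; rewrite modulusM.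
have -> : modulus ('i%C : C) = 1 by rewrite /Normc.normc expr0n /= add0r expr1n sqrtr1.
rewrite mul1r; apply: lerD; apply: le_trans (modulusB _ _) _; apply: lerD; apply: cint_bound => //;
  do ?[apply: pcont_horiz; [|eassumption]; by rewrite lexx ?ab ?cd];
  do ?[apply: pcont_vert; [|eassumption]; by rewrite lexx ?ab ?cd]; move=> t tab; apply: Db => //; by rewrite lexx ?ab ?cd.
Qed.

Lemma le4_sum (X p q r s : R) : X <= p + q + (r + s) ->
  ((X <= 4 * p) || (X <= 4 * q)) || ((X <= 4 * r) || (X <= 4 * s)).
Proof.
by move=> H; apply/negPn/negP; rewrite !negb_or -!ltNge => /andP[/andP[? ?] /andP[? ?]]; lra.
Qed.

Lemma nested_itv (u : nat -> R) w : (forall n, u n <= u n.+1) ->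
  (forall n, u n.+1 + w / 2 ^+ n.+1 <= u n + w / 2 ^+ n) -> 0 <= w ->
  exists x, forall n, u n <= x <= u n + w / 2 ^+ n.
Proof.
move=> u_nd u_ni w0.
have w2 n : 0 <= w / 2 ^+ n by rewrite divr_ge0// exprn_ge0.
have nd m n : (m <= n)%N -> u m <= u n.
  by move=> /subnKC <-; elim: (n - m)%N => [|k IH]; rewrite ?addn0// addnS (le_trans IH).
have ni m n : (m <= n)%N -> u n + w / 2 ^+ n <= u m + w / 2 ^+ m.
  by move=> /subnKC <-; elim: (n - m)%N => [|k IH]; rewrite ?addn0// addnS (le_trans _ IH).
have mn m n : u m <= u n + w / 2 ^+ n.
  case: (leqP m n) => [/nd H|/ltnW /ni H].
    by rewrite (le_trans H)// lerDl.
  by apply: le_trans H; rewrite lerDl.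
have S : has_sup (range u).
  by split; [exists (u 0%N); exists 0%N|exists (u 0%N + w / 2 ^+ 0) => _ [n _ <-]].
exists (sup (range u)) => n; apply/andP; split.
  by apply: ub_le_sup; [case: S|exists n].
by apply: ge_sup; [case: S|move=> _ [m _ <-]].
Qed.

Lemma dist_le_itv (l d x y : R) : l <= x <= l + d -> l <= y <= l + d -> `|x - y| <= d.
Proof. by move=> /andP[? ?] /andP[? ?]; rewrite ler_norml; apply/andP; split; lra. Qed.

(** Bisection: some quarter keeps at least a fourth of the boundary integral. At the common point of
    the nested rectangles, differentiability bounds the n-th integral by a small multiple of the
    squared half perimeter, that is of 4^-n, and the powers of 4 cancel. *)
Lemma goursat F a b c d : a <= b -> c <= d ->
  (forall x y, a <= x <= b -> c <= y <= d -> cder F (x +i* y)%C) ->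
  bdint F a b c d = 0.
Proof.
move=> ab cd dF.
have cF : rect_cont F a b c d by move=> x y ? ?; apply: cder_ccont; exact: dF.
set w := b - a; set h := d - c.
have w0 : 0 <= w by rewrite subr_ge0.
have h0 : 0 <= h by rewrite subr_ge0.
pose wn n := w / 2 ^+ n; pose hn n := h / 2 ^+ n.
have wnS n : wn n = wn n.+1 + wn n.+1.
  by rewrite /wn exprS; field; rewrite expf_neq0.
have hnS n : hn n = hn n.+1 + hn n.+1.
  by rewrite /hn exprS; field; rewrite expf_neq0.
have wn0 n : 0 <= wn n by rewrite divr_ge0// exprn_ge0.
have hn0 n : 0 <= hn n by rewrite divr_ge0// exprn_ge0.
pose B n (p : R * R) := modulus (bdint F p.1 (p.1 + wn n) p.2 (p.2 + hn n)).
pose good n (p : R * R) := [/\ a <= p.1, p.1 + wn n <= b, c <= p.2 & p.2 + hn n <= d].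
pose next n (p q : R * R) := [/\ p.1 <= q.1, q.1 + wn n.+1 <= p.1 + wn n,
  p.2 <= q.2, q.2 + hn n.+1 <= p.2 + hn n & B n p <= 4 * B n.+1 q].
have ex_next n p : good n p -> exists q, next n p q.
  case: p => x y [/= ax xb cy yd].
  have cF' : rect_cont F x (x + wn n) y (y + hn n) by exact: rect_cont_sub cF.
  set w' := wn n.+1; set h' := hn n.+1.
  have w'0 : 0 <= w' := wn0 _; have h'0 : 0 <= h' := hn0 _.
  have wE : wn n = w' + w' := wnS n; have hE : hn n = h' + h' := hnS n.
  have e1 : x + w' + w' = x + wn n by rewrite wE addrA.
  have e2 : y + h' + h' = y + hn n by rewrite hE addrA.
  have E : bdint F x (x + wn n) y (y + hn n) =
    (bdint F x (x + w') y (y + h') + bdint F x (x + w') (y + h') (y + h' + h')) +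
    (bdint F (x + w') (x + w' + w') y (y + h') + bdint F (x + w') (x + w' + w') (y + h') (y + h' + h')).
    rewrite (@bdint_splitx F x (x + w')) ?lerDl ?hn0 ?wE ?lerD2l ?lerDl//; last by rewrite -wE.
    rewrite -wE e1 e2; congr (_ + _); apply: bdint_splity; rewrite ?lerDl// -?e1 -?e2 ?lerDl//;
    by apply: rect_cont_sub cF'; lra.
  pose q1 := (x, y); pose q2 := (x, y + h'); pose q3 := (x + w', y); pose q4 := (x + w', y + h').
  have BE : B n (x, y) <= B n.+1 q1 + B n.+1 q2 + (B n.+1 q3 + B n.+1 q4).
    have -> : B n (x, y) = modulus (bdint F x (x + wn n) y (y + hn n)) by [].
    rewrite E; apply: le_trans (modulusD _ _) _; apply: lerD; exact: modulusD.
  have /orP[/orP[|]|/orP[|]] : ((B n (x, y) <= 4 * B n.+1 q1) || (B n (x, y) <= 4 * B n.+1 q2)) ||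
     ((B n (x, y) <= 4 * B n.+1 q3) || (B n (x, y) <= 4 * B n.+1 q4)).
    exact: le4_sum BE.
  - by move=> H; exists q1; split; rewrite /= ?wE ?hE -/w' -/h' ?addrA ?lerDl//.
  - by move=> H; exists q2; split; rewrite /= ?wE ?hE -/w' -/h' ?addrA ?lerDl//.
  - by move=> H; exists q3; split; rewrite /= ?wE ?hE -/w' -/h' ?addrA ?lerDl//.
  - by move=> H; exists q4; split; rewrite /= ?wE ?hE -/w' -/h' ?addrA ?lerDl//.
(* [xget] falls back on the previous corner when no quarter qualifies; [ex_next] excludes this as
   long as the rectangle lies in the initial one. *)
pose fix s n := if n is m.+1 then xget (s m) [set q | next m (s m) q] else (a, c).
have gs n : good n (s n) /\ next n (s n) (s n.+1).
  elim: n => [|n [gn nn]].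
    have g0 : good 0%N (s 0%N) by split; rewrite /= ?/wn ?/hn ?expr0 ?divr1; rewrite /w /h; lra.
    split; first exact: g0.
    exact: (xgetPex (s 0%N) (ex_next _ _ g0)).
  have gn1 : good n.+1 (s n.+1).
    by move: gn nn => [? ? ? ?] [? ? ? ? ?]; split; lra.
  split; first exact: gn1.
  exact: (xgetPex (s n.+1) (ex_next _ _ gn1)).
have [x0 Hx0] : exists x, forall n, (s n).1 <= x <= (s n).1 + w / 2 ^+ n.
  by apply: nested_itv => // n; have [_ []] := gs n.
have [y0 Hy0] : exists x, forall n, (s n).2 <= x <= (s n).2 + h / 2 ^+ n.
  by apply: nested_itv => // n; have [_ []] := gs n.
have Bn n : B 0%N (a, c) <= 4 ^+ n * B n (s n).
  elim: n => [|n IH]; first by rewrite expr0 mul1r.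
  apply: le_trans IH _; rewrite exprSr -mulrA ler_wpM2l ?exprn_ge0//.
  by have [_ []] := gs n.
have x0ab : a <= x0 <= b.
  by have := Hx0 0%N; rewrite expr0 divr1 /= /w => /andP[? ?]; apply/andP; split; lra.
have y0cd : c <= y0 <= d.
  by have := Hy0 0%N; rewrite expr0 divr1 /= /h => /andP[? ?]; apply/andP; split; lra.
have [l dl] := dF _ _ x0ab y0cd.
apply/eqP; rewrite -modulus_eq0 eq_le modulus_ge0 andbT.
have <- : B 0%N (a, c) = modulus (bdint F a b c d).
  transitivity (modulus (bdint F a (a + wn 0%N) c (c + hn 0%N))); first by [].
  have -> : a + wn 0%N = b by rewrite /wn expr0 divr1 /w addrC subrK.
  by have -> : c + hn 0%N = d by rewrite /hn expr0 divr1 /h addrC subrK.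
apply/ler_addgt0Pl => e e0; rewrite addr0.
pose S := w + h; have S0 : 0 <= S by rewrite addr_ge0.
(* The factor 2 is that of [bdint_approx]; the summand 1 covers the degenerate case S = 0. *)
pose e' := e / (2 * (S ^+ 2 + 1)).
have S1 : 0 < 2 * (S ^+ 2 + 1) by rewrite mulr_gt0// ltr_pwDr// sqr_ge0.
have e'0 : 0 < e' by rewrite divr_gt0.
have [dl0 dl00 Hd] := dl _ e'0.
have [n Hn] := exp2_unbounded (S / dl0).
have En : 0 < 2 ^+ n :> R by rewrite exprn_gt0.
have Sn : wn n + hn n < dl0.
  by rewrite /wn /hn -mulrDl ltr_pdivrMr// mulrC -ltr_pdivrMr.
apply: le_trans (Bn n) _.
have [[/= g1 g2 g3 g4] _] := gs n.
have := @bdint_approx F (s n).1 ((s n).1 + wn n) (s n).2 ((s n).2 + hn n) (x0 +i* y0)%C l e'.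
rewrite !lerDl => /(_ (wn0 n) (hn0 n) (ltW e'0)) H.
have {}H : B n (s n) <= 2 * e' * (wn n + hn n) ^+ 2.
  apply: le_trans (H _ _ _ _) _.
  - exact: rect_cont_sub cF.
  - exact: Hx0.
  - exact: Hy0.
  - move=> x y xs ys /=; set z := (x +i* y)%C.
    have := Hd (z - (x0 +i* y0)%C); rewrite (addrC (x0 +i* y0)%C) subrK => -> //.
    apply: le_lt_trans Sn; apply: le_trans (modulus_le _) _; rewrite creD cimD creN cimN /=.
    by apply: lerD; [exact: (dist_le_itv xs (Hx0 n))|exact: (dist_le_itv ys (Hy0 n))].
  - by rewrite !(addrC (s n).1) !(addrC (s n).2) !addrK.
apply: (@le_trans _ _ (4 ^+ n * (2 * e' * (wn n + hn n) ^+ 2))).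
  by rewrite ler_wpM2l ?exprn_ge0.
have -> : 4 ^+ n * (2 * e' * (wn n + hn n) ^+ 2) = 2 * e' * S ^+ 2.
  rewrite /wn /hn -mulrDl exprMn exprVn -exprM mulnC exprM.
  have -> : (2 : R) ^+ 2 = 4 by ring.
  have : (4 : R) ^+ n != 0 by rewrite expf_neq0.
  by rewrite /S => H4; field.
rewrite /e'; have -> : 2 * (e / (2 * (S ^+ 2 + 1))) * S ^+ 2 = e * (S ^+ 2 / (S ^+ 2 + 1)).
  by field; have := sqr_ge0 S; lra.
rewrite -[leRHS]mulr1 ler_pM2l// ler_pdivrMr ?mul1r ?lerDl//.
by rewrite ltr_pwDr// sqr_ge0.
Qed.

End goursat.


(** * Ultralimits and compactness *)

Section ultralimit.
Variable R : realType.
Local Notation C := R[i].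

(** Along such an ultrafilter every bounded sequence converges, so pointwise limits of a family of
    functions exist at all points at once, without diagonal extraction; being free, it sees only the
    tail of a sequence. *)
Lemma free_ultrafilter : exists U : set_system nat, UltraFilter U /\ (\oo : set_system nat) `<=` U.
Proof. by have [U [UU FU]] := ultraFilterLemma eventually_filter; exists U. Qed.

Variables (U : set_system nat) (UU : UltraFilter U) (U_free : (\oo : set_system nat) `<=` U).

Lemma ulim_real (u : nat -> R) (B : R) : (forall n, `|u n| <= B) ->
  exists l, forall e, 0 < e -> U [set n | `|u n - l| < e].
Proof.
move=> uB.
have cB : compact `[- B, B] by exact: segment_compact.
have [|l [_ ul]] := cB (u @ U) _.
  by apply: (@filterS _ U _ setT) => [n _|]; [rewrite /= in_itv /= -ler_norml|exact: filterT].
exists l => e e0.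
have [//|H] := in_ultra_setVsetC [set n | `|u n - l| < e] UU.
have [|x [/= H1 H2]] := ul (~` ball l e) (ball l e) _ (nbhsx_ballx _ _ e0).
  by apply: (@filterS _ U _ _ _ _ H) => n; rewrite /ball /= distrC.
by [].
Qed.

Lemma ulim_complex (u : nat -> C) (B : R) : (forall n, modulus (u n) <= B) ->
  exists l, forall e, 0 < e -> U [set n | modulus (u n - l) < e].
Proof.
move=> uB.
have [a Ha] : exists a, forall e, 0 < e -> U [set n | `|complex.Re (u n) - a| < e].
  by apply: (@ulim_real _ B) => n; apply: le_trans (Re_le_modulus _) _.
have [b Hb] : exists a, forall e, 0 < e -> U [set n | `|complex.Im (u n) - a| < e].
  by apply: (@ulim_real _ B) => n; apply: le_trans (Im_le_modulus _) _.
exists (a +i* b)%C => e e0.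
have e20 : 0 < e / 2 by rewrite divr_gt0.
apply: filterS2 (Ha _ e20) (Hb _ e20) => n /= H1 H2.
apply: le_lt_trans (modulus_le _) _; rewrite creD cimD creN cimN /=.
by rewrite [ltRHS](splitr e); apply: ltrD.
Qed.

Lemma ultra_ex (P : set nat) : U P -> exists n, P n.
Proof. by move=> UP; apply: (@filter_ex _ U). Qed.

Lemma ultra_ge N : U [set n | (N <= n)%N].
Proof. by apply: U_free; exists N. Qed.

End ultralimit.

Section compactness.
Variable R : realType.
Local Notation C := R[i].

Lemma archi_lt (e : R) : 0 < e -> exists N : nat, forall n : nat, (N <= n)%N -> n.+1%:R^-1 < e.
Proof.
move=> e0; exists (Num.trunc e^-1) => n Nn.
rewrite -[ltRHS]invrK ltf_pV2 ?posrE ?invr_gt0//.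
by apply: lt_le_trans (truncnS_gt _) _; rewrite ler_nat ltnS.
Qed.

(** If no threshold served all of [K], there would be failures at the scales 1 / (n + 1); a limit of
    the failing points lies in [K], and the threshold valid near it is contradicted. *)
Lemma compact_unif (K : set C) (B : R) (Q : C -> R -> Prop) :
  (forall z, K z -> modulus z <= B) ->
  (forall z, (forall e, 0 < e -> exists2 w, K w & modulus (w - z) < e) -> K z) ->
  (forall z, K z -> exists2 d : R, 0 < d & forall w, K w -> modulus (w - z) < d ->
     forall h, 0 < h < d -> Q w h) ->
  exists2 d : R, 0 < d & forall w, K w -> forall h, 0 < h < d -> Q w h.
Proof.
move=> KB Kclosed Kloc; apply: contrapT => /forall2NP nK.
have {}nK n : exists wh : C * R, [/\ K wh.1, 0 < wh.2 < n.+1%:R^-1 & ~ Q wh.1 wh.2].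
  have [|] := nK n.+1%:R^-1; first by rewrite invr_gt0.
  move=> /existsNP[w /not_implyP[Kw /existsNP[h /not_implyP[hn nQ]]]].
  by exists (w, h).
have /choice[u Hu] := nK.
have [U [UU Uf]] := free_ultrafilter.
have [z Hz] : exists l, forall e, 0 < e -> U [set n | modulus ((u n).1 - l) < e].
  by apply: (@ulim_complex _ U UU (fun n => (u n).1) B) => n; apply: KB; have [] := Hu n.
have Kz : K z.
  apply: Kclosed => e e0; have [n /= Hn] := ultra_ex UU (Hz _ e0).
  by exists (u n).1 => //; have [] := Hu n.
have [d d0 Hd] := Kloc _ Kz.
have [N HN] := archi_lt d0.
have [n [/= n1 n2]] := ultra_ex UU (filterI (Hz _ d0) (ultra_ge Uf N)).
have [Kn /andP[h0 hn] nQ] := Hu n.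
by apply: nQ; apply: (Hd _ Kn n1); rewrite h0 /= (lt_trans hn)// HN.
Qed.

End compactness.

(** * The complex exponential and the unit circle *)

Section cexp.
Variable R : realType.
Local Notation C := R[i].
Implicit Types (t x y : R) (z w : C).

Lemma is_derive_approx (f : R -> R) x (l : R) : is_derive x 1 f l ->
  forall e, 0 < e -> exists2 d : R, 0 < d & forall h, `|h| < d ->
    `|f (x + h) - f x - l * h| <= e * `|h|.
Proof.
move=> [df Df] e e0; have /cvg_ex[/= m fm] := df.
have lm : m = l by rewrite -Df; apply/esym/cvg_lim.
subst m; move/cvgrPdist_le : fm => /(_ _ e0) /nbhs_ballP[d d0 H].
exists d => // h hd; have [->|h0] := eqVneq h 0.
  by rewrite addr0 subrr mulr0 subrr normr0 mulr0.
have := H h; rewrite /ball /= sub0r normrN => /(_ hd h0).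
rewrite [h *: _]mulr1 [h^-1 *: _]/(h^-1 * _) (addrC h) => {}H.
have -> : f (x + h) - f x - l * h = - ((l - h^-1 * (f (x + h) - f x)) * h) by field.
rewrite normrN.
by rewrite normrM ler_wpM2r.
Qed.

Definition cexp z : C := (expR (complex.Re z))%:C%C * circ (complex.Im z).

Lemma modulus_circ t : modulus (circ t) = 1.
Proof. by rewrite /circ /Normc.normc cos2Dsin2 sqrtr1. Qed.

Lemma circ_neq0 t : circ t != 0 :> C.
Proof. by rewrite -modulus_gt0 modulus_circ. Qed.

Lemma circD s t : circ (s + t) = circ s * circ t :> C.
Proof. by rewrite /circ; apply: complexP => /=; rewrite ?cosD ?sinD//; ring. Qed.

Lemma circ0 : circ 0 = 1 :> C.
Proof. by rewrite /circ cos0 sin0. Qed.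

Lemma circ_conj t : (circ t)^*%C * circ t = 1 :> C.
Proof. by rewrite mulrC mulcJ modulus_circ expr1n. Qed.

Lemma circV t : (circ t : C)^-1 = (circ t)^*%C.
Proof. by apply: (mulIf (circ_neq0 t)); rewrite mulVf ?circ_neq0// circ_conj. Qed.

Lemma circN t : circ (- t) = (circ t)^*%C :> C.
Proof. by rewrite /circ cosN sinN. Qed.

Lemma circ2pi : circ (2 * pi) = 1 :> C.
Proof. by rewrite /circ mulr_natl cos2pi sin2pi. Qed.

Lemma circD2pi t : circ (t + 2 * pi) = circ t :> C.
Proof. by rewrite circD circ2pi mulr1. Qed.

Lemma modulus_polar (r : R) t : 0 <= r -> modulus (r%:C%C * circ t) = r.
Proof. by move=> r0; rewrite modulusM modulus_circ mulr1 modulus_ge0_real. Qed.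

Lemma pcontat_circ t : pcontat (@circ R) t.
Proof. by apply: pcontatE => /=; [exact: continuous_cos|exact: continuous_sin]. Qed.

Lemma pcontat_polar (r : R) t : pcontat (fun s => r%:C%C * circ s) t.
Proof. by apply: pcontatM; [exact: pcontat_cst|exact: pcontat_circ]. Qed.

Lemma cexpD z w : cexp (z + w) = cexp z * cexp w.
Proof. by rewrite /cexp creD cimD expRD circD rmorphM /=; ring. Qed.

Lemma cexp0 : cexp 0 = 1.
Proof. by rewrite /cexp /= expR0 circ0 mulr1. Qed.

Lemma modulus_cexp z : modulus (cexp z) = expR (complex.Re z).
Proof. by rewrite modulus_polar// expR_ge0. Qed.

(** First order expansions of exp, cos and sin at 0; the one mixed term, (e^x - 1) y, is of second
    order. *)
Lemma has_der_cexp0 : has_der cexp 0 1.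
Proof.
move=> e e0.
(* The error terms below add up to at most 7 [e1] |h|, and [e1] <= 1 gives |e^x - 1| <= 2 |x|. *)
have [e1 [e10 e1e e11]] : exists e1, [/\ 0 < e1, e1 <= e / 8 & e1 <= 1].
  by exists (Num.min (e / 8) 1); rewrite lt_min ltr01 divr_gt0// !ge_min !lexx orbT.
have [d1 d10 H1] := is_derive_approx (is_derive_expR 0) e10.
have [d2 d20 H2] := is_derive_approx (is_derive_cos 0) e10.
have [d3 d30 H3] := is_derive_approx (is_derive_sin 0) e10.
exists (Num.min e1 (Num.min d1 (Num.min d2 d3)) / 2).
  by rewrite divr_gt0// !lt_min e10 d10 d20.
move=> h; rewrite ltr_pdivlMr// !lt_min => /andP[h4 /andP[h1 /andP[h2 h3]]].
rewrite add0r cexp0 mul1r /cexp.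
have Rh := Re_le_modulus h; have Ih := Im_le_modulus h.
move: Rh Ih h1 h2 h3 h4; set m := modulus h; move=> Rh Ih h1 h2 h3 h4.
have m0 : 0 <= m by exact: modulus_ge0.
apply: le_trans (modulus_le _) _.
move: h @m Rh Ih h1 h2 h3 h4 m0 => [x y] m /= Rh Ih h1 h2 h3 h4 m0.
rewrite !mul0r !subr0.
have := H1 x; rewrite add0r expR0 mul1r => {}H1.
have := H2 y; rewrite add0r cos0 sin0 oppr0 mul0r subr0 => {}H2.
have := H3 y; rewrite add0r sin0 cos0 mul1r subr0 => {}H3.
have {}H1 : `|expR x - 1 - x| <= e1 * `|x| by apply: H1; lra.
have {}H2 : `|cos y - 1| <= e1 * `|y| by apply: H2; lra.
have {}H3 : `|sin y - y| <= e1 * `|y| by apply: H3; lra.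
have x0 := normr_ge0 x; have y0 := normr_ge0 y.
have Ex : `|expR x - 1| <= 2 * `|x|.
  rewrite -[expR x - 1](subrK x); apply: le_trans (ler_normD _ _) _.
  have : e1 * `|x| <= 1 * `|x| by rewrite ler_wpM2r.
  lra.
have Ex2 : `|expR x| <= 2.
  rewrite -[expR x](subrK 1); apply: le_trans (ler_normD _ _) _; rewrite normr1; lra.
have E1 : `|expR x * (cos y - 1)| <= 2 * (e1 * `|y|).
  by rewrite normrM; apply: ler_pM.
have E2 : `|expR x * (sin y - y)| <= 2 * (e1 * `|y|).
  by rewrite normrM; apply: ler_pM.
have E3 : `|(expR x - 1) * y| <= 2 * e1 * m.
  rewrite normrM; apply: ler_pM => //; lra.
have -> : expR x * cos y - 1 - x = expR x * (cos y - 1) + (expR x - 1 - x) by ring.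
have -> : expR x * sin y + 0 - y = expR x * (sin y - y) + (expR x - 1) * y by ring.
have T1 := ler_normD (expR x * (cos y - 1)) (expR x - 1 - x).
have T2 := ler_normD (expR x * (sin y - y)) ((expR x - 1) * y).
have M1 : e1 * `|y| <= e / 8 * m by apply: ler_pM => //; exact: ltW.
have M2 : e1 * `|x| <= e / 8 * m by apply: ler_pM => //; exact: ltW.
have em0 : 0 <= e * m by rewrite mulr_ge0// ltW.
have M3 : e1 * m <= e / 8 * m by apply: ler_pM => //; exact: ltW.
lra.
Qed.

(** The functional equation e^w = e^z e^(w - z) transports the derivative from 0 to z. *)
Lemma has_der_cexp z : has_der cexp z (cexp z).
Proof.
suff : has_der (fun w => cexp z * cexp (w - z)) z (0 * cexp (z - z) + cexp z * (1 * (1 + 0))).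
  rewrite mul0r add0r mul1r addr0 mulr1.
  by apply: (eq_has_der ltr01) => w _; rewrite -cexpD addrC subrK.
apply: has_derM; first exact: has_der_cst.
apply: (has_der_comp (f := fun w => w - z) (g := cexp)).
  by apply: has_derD; [exact: has_der_id|exact: has_der_cst].
by rewrite subrr; exact: has_der_cexp0.
Qed.

Lemma cder_cexp z : cder cexp z.
Proof. by exists (cexp z); exact: has_der_cexp. Qed.

End cexp.

Arguments circ : simpl never.


(** * Circle means, Cauchy and Poisson formulas *)

Section circle_mean.
Variable R : realType.
Local Notation C := R[i].
Implicit Types (t r : R) (x z w : C) (f : C -> C) (u : R -> R).

Lemma conjM z w : (z * w)^*%C = z^*%C * w^*%C. Proof. exact: rmorphM. Qed.
Lemma conjB z w : (z - w)^*%C = z^*%C - w^*%C. Proof. exact: rmorphB. Qed.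
Lemma conj_cauchy z w : ((1 - z * w)^-1)^*%C = (1 - z^*%C * w^*%C)^-1.
Proof. by rewrite conjc_inv conjB conjM conjc1. Qed.

Lemma pi2_gt0 : 0 < 2 * pi :> R. Proof. exact: two_pi_gt0. Qed.
Lemma pi2_ge0 : 0 <= 2 * pi :> R. Proof. exact/ltW/two_pi_gt0. Qed.

Definition ravg u : R := (2 * pi)^-1 * rint 0 (2 * pi) u.
Definition cavg (h : R -> C) : C := ((2 * pi)^-1)%:C%C * cint 0 (2 * pi) h.

Local Notation rc := (rcont 0 (2 * pi)).
Local Notation pc := (pcont 0 (2 * pi)).

Lemma ravg_cst k : ravg (fun=> k) = k.
Proof. by rewrite /ravg rint_cst ?pi2_ge0// subr0 mulrCA mulVf ?mulr1// gt_eqF ?pi2_gt0. Qed.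

Lemma eq_ravg u v : (forall t, u t = v t) -> ravg u = ravg v.
Proof. by move=> uv; rewrite /ravg; congr (_ * _); apply: eq_rint => t _. Qed.

Lemma ravgD u v : rc u -> rc v -> ravg (fun t => u t + v t) = ravg u + ravg v.
Proof. by move=> cu cv; rewrite /ravg rintD// mulrDr. Qed.

Lemma ravgB u v : rc u -> rc v -> ravg (fun t => u t - v t) = ravg u - ravg v.
Proof. by move=> cu cv; rewrite /ravg rintB// mulrBr. Qed.

Lemma ravgZ k u : rc u -> ravg (fun t => k * u t) = k * ravg u.
Proof. by move=> cu; rewrite /ravg rintZ// mulrCA. Qed.

Lemma ravg_le u v : rc u -> rc v -> (forall t, 0 <= t <= 2 * pi -> u t <= v t) -> ravg u <= ravg v.
Proof.
move=> cu cv uv; rewrite /ravg ler_wpM2l ?invr_ge0 ?pi2_ge0//.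
exact: rint_le.
Qed.

Lemma ravg_ge0 u : (forall t, 0 <= u t) -> 0 <= ravg u.
Proof.
by move=> u0; rewrite mulr_ge0 ?invr_ge0 ?pi2_ge0//; apply: rint_ge0 => t _.
Qed.

Lemma eq_cavg (g h : R -> C) : (forall t, g t = h t) -> cavg g = cavg h.
Proof. by move=> gh; rewrite /cavg; congr (_ * _); apply: eq_cint => t _. Qed.

Lemma cavgD g h : pc g -> pc h -> cavg (fun t => g t + h t) = cavg g + cavg h.
Proof. by move=> cg ch; rewrite /cavg cintD// mulrDr. Qed.

Lemma cavgB g h : pc g -> pc h -> cavg (fun t => g t - h t) = cavg g - cavg h.
Proof. by move=> cg ch; rewrite /cavg cintB// mulrBr. Qed.

Lemma cavgZ k h : pc h -> cavg (fun t => k * h t) = k * cavg h.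
Proof. by move=> ch; rewrite /cavg cintZ// mulrCA. Qed.

Lemma cavg_cst k : cavg (fun=> k) = k.
Proof.
rewrite /cavg cint_cst ?pi2_ge0// subr0 mulrCA -rmorphM /= mulVf ?mulr1//.
by rewrite gt_eqF ?pi2_gt0.
Qed.

Lemma cavgJ h : pc h -> cavg (fun t => (h t)^*%C) = (cavg h)^*%C.
Proof. by move=> ch; rewrite /cavg cintJ// conjM conjc_real. Qed.

Lemma modulus_cavg h : pc h -> modulus (cavg h) <= ravg (fun t => modulus (h t)).
Proof.
move=> ch; rewrite /cavg /ravg modulusM modulus_ge0_real ?invr_ge0 ?pi2_ge0//.
by rewrite ler_pM2l ?invr_gt0 ?pi2_gt0//; exact: modulus_cint.
Qed.

Lemma Re_cavg h : complex.Re (cavg h) = ravg (fun t => complex.Re (h t)).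
Proof. by rewrite /cavg creM /= mul0r subr0. Qed.

Lemma cavg_bound h (M : R) : pc h -> (forall t, modulus (h t) <= M) -> modulus (cavg h) <= M.
Proof.
move=> ch hM; apply: le_trans (modulus_cavg ch) _; rewrite -(ravg_cst M).
by apply: ravg_le => //; [exact: pcont_modulus|move=> t _; exact: cst_continuous].
Qed.

Definition cmean f r := cavg (fun t => f (r%:C%C * circ t)).

Lemma pcont_circle f r : 0 <= r -> (forall z, modulus z = r -> ccont f z) ->
  forall a b, pcont a b (fun t => f (r%:C%C * circ t)).
Proof.
move=> r0 cf a b t _; apply: pcontat_comp; first exact: pcontat_polar.
by apply: cf; rewrite modulus_polar.
Qed.

(* Goursat's lemma for [f \o cexp] on the rectangle of logarithms of the ring. *)
Lemma cmean_ring f a b : 0 < a -> a <= b ->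
  (forall z, a <= modulus z <= b -> cder f z) -> cmean f a = cmean f b.
Proof.
move=> a0 ab df; have b0 : 0 < b by exact: lt_le_trans ab.
have lab : ln a <= ln b by rewrite ler_ln.
pose F w := f (cexp w).
have dF (x y : R) : ln a <= x <= ln b -> 0 <= y <= 2 * pi -> cder F (x +i* y)%C.
  move=> xab _; apply: (cder_comp (g := f)); first exact: cder_cexp.
  by apply: df; rewrite modulus_cexp /= -[a]lnK ?posrE// -[b]lnK ?posrE// !ler_expR.
have := goursat lab (ltW pi2_gt0) dF; rewrite /bdint.
have -> : cint (ln a) (ln b) (fun t => F (t +i* 0)%C) = cint (ln a) (ln b) (fun t => F (t +i* (2 * pi))%C).
  by apply: eq_cint => t _; rewrite /F /cexp /= circ2pi circ0.
rewrite subrr add0r => /eqP; rewrite mulf_eq0 subr_eq0 => /orP[|/eqP E].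
  by rewrite eq_complex /= oner_eq0 andbF.
rewrite /cmean /cavg; congr (_ * _).
transitivity (cint 0 (2 * pi) (fun y => F (ln a +i* y)%C)).
  by apply: eq_cint => t _; rewrite /F /cexp /= lnK.
by rewrite -E; apply: eq_cint => t _; rewrite /F /cexp /= lnK.
Qed.

(** By [cmean_ring] the circle may be shrunk, and on small circles continuity at 0 settles the
    value. The case of an exceptional point at the centre is what [mean_value_exceptional] takes
    from here. *)
Lemma mean_value_punctured f r : 0 < r -> ccont f 0 ->
  (forall z, z != 0 -> modulus z <= r -> cder f z) -> cmean f r = f 0.
Proof.
move=> r0 f0 df; apply/eqP; rewrite -subr_eq0 -modulus_eq0 eq_le modulus_ge0 andbT.
apply/ler_addgt0Pl => e e0; rewrite addr0.
have [d d0 Hd] := f0 e e0.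
pose s := Num.min (d / 2) r.
have s0 : 0 < s by rewrite lt_min r0 divr_gt0.
have sd : s < d.
  by apply: (@le_lt_trans _ _ (d / 2)); rewrite ?ge_min ?lexx// ltr_pdivrMr// mulr2n mulrDr mulr1 ltrDl.
have sr : s <= r by rewrite ge_min lexx orbT.
have df' z : s <= modulus z <= r -> cder f z.
  by move=> /andP[sz zr]; apply: df => //; rewrite -modulus_gt0 (lt_le_trans s0).
rewrite -(cmean_ring s0 sr df').
have cs : pc (fun t => f (s%:C%C * circ t)).
  apply: pcont_circle; first exact: ltW.
  by move=> z zs; apply: cder_ccont; apply: df'; rewrite zs lexx.
rewrite /cmean -(cavg_cst (f 0)) -cavgB//; last exact: pcont_cst.
apply: cavg_bound => [|t]; first by apply: pcontB => //; exact: pcont_cst.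
by apply/ltW/Hd; rewrite subr0 modulus_polar// ltW.
Qed.

Lemma mean_value f r : 0 < r -> (forall z, modulus z <= r -> cder f z) -> cmean f r = f 0.
Proof.
move=> r0 df; apply: mean_value_punctured => // [|z _]; last exact: df.
by apply/cder_ccont/df; rewrite modulus0 ltW.
Qed.

(** Continuity uniform in the angle, needed to pass across the circle which carries an exceptional
    point. *)
Lemma ccont_circle_unif f s e : 0 <= s -> 0 < e -> (forall z, modulus z = s -> ccont f z) ->
  exists2 d : R, 0 < d & forall t s', `|s' - s| < d ->
    modulus (f (s'%:C%C * circ t) - f (s%:C%C * circ t)) < e.
Proof.
move=> s0 e0 cf.
have [|||d d0 Hd] := @compact_unif _ [set z : C | modulus z = s] s
  (fun w d => forall w', modulus (w' - w) < d -> modulus (f w' - f w) < e).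
- by move=> z ->.
- move=> z Hz; apply/eqP; rewrite eq_sym -subr_eq0 -normr_eq0 eq_le normr_ge0 andbT.
  apply/ler_addgt0Pl => e' e'0; rewrite addr0; have [w <- wz] := Hz _ e'0.
  apply: le_trans (ltW wz); rewrite ler_norml modulus_lowerB andbT lerNl opprB modulusC.
  exact: modulus_lowerB.
- move=> z zs; have [d d0 H] := cf _ zs _ (divr_gt0 e0 (ltr0Sn _ 1)).
  exists (d / 2); first by rewrite divr_gt0.
  move=> w ws wz h /andP[h0 hd] w' ww'.
  have H1 : modulus (f w' - f z) < e / 2.
    apply: H; rewrite -[w' - z](subrKA w); apply: le_lt_trans (modulusD _ _) _.
    by rewrite [ltRHS](splitr d); apply: ltrD => //; apply: lt_trans hd.
  have H2 : modulus (f w - f z) < e / 2.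
    by apply: H; apply: lt_trans wz _; rewrite gtr_pMr// invf_lt1// ltr1n.
  rewrite -[f w' - f w](subrKA (f z)); apply: le_lt_trans (modulusD _ _) _.
  by rewrite (modulusC (f z)) [ltRHS](splitr e); apply: ltrD.
exists (d / 2); first by rewrite divr_gt0.
move=> t s' ss'; apply: (Hd (s%:C%C * circ t) _ (d / 2)).
- exact: modulus_polar.
- by rewrite divr_gt0//= gtr_pMr// invf_lt1// ltr1n.
- by rewrite -mulrBl modulusM modulus_circ mulr1 -rmorphB modulus_real.
Qed.

(* the exceptional point lies on one circle only, and the means depend
   continuously on the radius *)
Lemma mean_value_exceptional f r z0 : 0 < r -> modulus z0 < r -> ccont f z0 ->
  (forall z, z != z0 -> modulus z <= r -> cder f z) -> cmean f r = f 0.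
Proof.
move=> r0 z0r cf df.
have [z00|z0_neq0] := eqVneq z0 0; first by subst z0; exact: mean_value_punctured.
have s0 : 0 < modulus z0 by rewrite modulus_gt0.
set s := modulus z0 in s0 z0r.
have cf' z : modulus z <= r -> ccont f z.
  by move=> zr; have [->//|zz] := eqVneq z z0; apply/cder_ccont/df.
apply/eqP; rewrite -subr_eq0 -modulus_eq0 eq_le modulus_ge0 andbT.
apply/ler_addgt0Pl => e e0; rewrite addr0.
have [d d0 Hd] : exists2 d : R, 0 < d & forall t s', `|s' - s| < d ->
    modulus (f (s'%:C%C * circ t) - f (s%:C%C * circ t)) < e / 2.
  apply: ccont_circle_unif; rewrite ?divr_gt0// ?ltW// => z zs.
  by apply: cf'; rewrite zs ltW.
pose d' := Num.min (d / 2) (Num.min (s / 2) (r - s)).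
have d'0 : 0 < d' by rewrite !lt_min !divr_gt0//= subr_gt0.
have d'd : d' < d.
  by apply: (@le_lt_trans _ _ (d / 2)); rewrite ?ge_min ?lexx// gtr_pMr// invf_lt1// ltr1n.
have d's : d' <= s / 2 by rewrite !ge_min lexx orbT.
have d'r : d' <= r - s by rewrite !ge_min lexx !orbT.
pose a := s - d'; pose b := s + d'.
have a0 : 0 < a by rewrite /a; lra.
have br : b <= r by rewrite /b; lra.
have -> : cmean f r = cmean f b.
  apply/esym; apply: cmean_ring => //; first by rewrite /b; lra.
  move=> z /andP[bz zr]; apply: df => //; apply/eqP => zz0.
  by move: bz; rewrite zz0 -/s /b; lra.
have <- : cmean f a = f 0.
  apply: mean_value_punctured => // [|z z0' za].
    by apply: cf'; rewrite modulus0 ltW.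
  apply: df; last by rewrite /a in za; lra.
  by apply/eqP => zz0; move: za; rewrite zz0 -/s /a; lra.
have pcc q : 0 <= q -> q <= r -> pc (fun t => f (q%:C%C * circ t)).
  by move=> q0 qr; apply: pcont_circle => // z zq; apply: cf'; rewrite zq.
rewrite /cmean -cavgB; [|apply: pcc; rewrite /a /b; lra..].
apply: cavg_bound => [|t].
  by apply: pcontB; apply: pcc; rewrite /a /b; lra.
rewrite -[f _ - f _](subrKA (f (s%:C%C * circ t))); apply: le_trans (modulusD _ _) _.
rewrite [leRHS](splitr e); apply: lerD; apply: ltW.
  by apply: Hd; rewrite /b addrAC subrr add0r gtr0_norm.
by rewrite modulusC; apply: Hd; rewrite /a addrAC subrr add0r normrN gtr0_norm.
Qed.

Lemma circ_denom_neq0 z t : modulus z < 1 -> 1 - z * (circ t)^*%C != 0.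
Proof.
move=> z1; rewrite subr_eq0; apply/eqP => /(congr1 (@ComplexField.Normc.normc _)).
by rewrite modulus1 modulusM modulusJ modulus_circ mulr1 => H; move: z1; rewrite -H ltxx.
Qed.

Lemma geom_neq0 z w : modulus z < 1 -> modulus w <= 1 -> 1 - z * w != 0.
Proof.
move=> z1 w1; rewrite subr_eq0; apply/eqP => /(congr1 (@ComplexField.Normc.normc _)).
rewrite modulus1 modulusM => H.
have : modulus z * modulus w <= modulus z * 1 by rewrite ler_wpM2l ?modulus_ge0.
by rewrite -H mulr1 leNgt z1.
Qed.

Lemma cder_geom z w : modulus z < 1 -> modulus w <= 1 -> cder (fun x => (1 - z * x)^-1) w.
Proof.
move=> z1 w1; apply: cderV; first exact: geom_neq0.
apply: cderB; first exact: cder_cst.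
by apply: cderM; [exact: cder_cst|exact: cder_id].
Qed.

Lemma pcont_cauchy_kernel z (a b : R) : modulus z < 1 -> pcont a b (fun t => (1 - z * (circ t)^*%C)^-1).
Proof.
move=> z1 t _.
apply: (pcontat_comp (F := fun x => (1 - z * x)^-1)); first exact/pcontatJ/pcontat_circ.
by apply: cder_ccont; apply: cder_geom => //; rewrite modulusJ modulus_circ.
Qed.

(** Conjugation turns the integrand into 1 / (1 - conj(z) w) on |w| = 1, holomorphic on the closed
    disk with value 1 at 0. *)
Lemma cavg_cauchy_kernel z : modulus z < 1 -> cavg (fun t => (1 - z * (circ t)^*%C)^-1) = 1.
Proof.
move=> z1; have z1' : modulus (z^*)%C < 1 by rewrite modulusJ.
have -> : (fun t => (1 - z * (circ t)^*%C)^-1) = (fun t => ((1 - (z^*)%C * circ t)^-1)^*%C).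
  by apply/funext => t; rewrite conj_cauchy conjcK.
have E : cmean (fun w => (1 - (z^*)%C * w)^-1) 1 = (1 - (z^*)%C * 0)^-1.
  by apply: mean_value => // w w1; exact: cder_geom.
rewrite mulr0 subr0 invr1 in E.
rewrite cavgJ.
  rewrite -[RHS](rmorph1 (@conjc R)); congr (_^*%C); rewrite -[RHS]E /cmean.
  by apply: eq_cavg => t; rewrite mul1r.
move=> t _; apply: (pcontat_comp (F := fun w => (1 - z^*%C * w)^-1)); first exact: pcontat_circ.
by apply/cder_ccont/cder_geom; rewrite ?modulus_circ.
Qed.

(** The mean value property is applied to w times the difference quotient of [f] at r z. This
    function vanishes at 0, and its mean is the difference of the two sides. At r z itself only its
    continuity is at hand, whence [mean_value_exceptional]. *)
Lemma cauchy_formula f r z : 0 < r -> modulus z < 1 -> (forall w, modulus w <= r -> cder f w) ->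
  cavg (fun t => f (r%:C%C * circ t) * (1 - z * (circ t)^*%C)^-1) = f (r%:C%C * z).
Proof.
move=> r0 z1 df; set z0 := r%:C%C * z.
have rn0 : r%:C%C != 0 :> C by rewrite -modulus_gt0 modulus_ge0_real// ltW.
have z0r : modulus z0 < r.
  by rewrite modulusM modulus_ge0_real ?ltW// gtr_pMr.
have [l fl] := df _ (ltW z0r).
pose q w := if w == z0 then l else (f w - f z0) / (w - z0).
pose Q w := w * q w.
have dq w : w != z0 -> modulus w <= r -> cder q w.
  move=> wz wr; have d0 : 0 < modulus (w - z0) by rewrite modulus_gt0 subr_eq0.
  apply: (@eq_cder _ (fun x => (f x - f z0) / (x - z0)) _ _ _ d0).
    move=> x xw; rewrite /q; case: eqP => // xz.
    by move: xw; rewrite xz modulusC ltxx.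
  apply: cderM; first by apply: cderB; [exact: df|exact: cder_cst].
  apply: cderV; first by rewrite subr_eq0.
  by apply: cderB; [exact: cder_id|exact: cder_cst].
have cq : ccont q z0.
  move=> e e0; have [d d0 Hd] := fl _ (divr_gt0 e0 (ltr0Sn _ 1)).
  exists d => // w wd; rewrite /q eqxx; case: eqP => [_|/eqP wz].
    by rewrite subrr modulus0.
  have w0 : w - z0 != 0 by rewrite subr_eq0.
  have -> : (f w - f z0) / (w - z0) - l = (f w - f z0 - l * (w - z0)) / (w - z0) by field.
  rewrite modulusM modulusV ltr_pdivrMr ?modulus_gt0//.
  have := Hd _ wd; rewrite (addrC z0) subrK => /le_lt_trans; apply.
  by rewrite ltr_pM2r ?modulus_gt0// gtr_pMr// invf_lt1// ltr1n.
have MQ : cmean Q r = 0.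
  rewrite (@mean_value_exceptional Q r z0) ?/Q ?mul0r// => [|w wz wr].
    move=> e e0; pose M := modulus z0 + modulus l + 2.
    have M0 : 0 < M by rewrite /M; have := modulus_ge0 z0; have := modulus_ge0 l; lra.
    have [d d0 Hd] := cq _ (divr_gt0 e0 (mulr_gt0 (ltr0Sn _ 1) M0)).
    exists (Num.min (Num.min d 1) (e / (2 * M))).
      by rewrite !lt_min d0 ltr01 divr_gt0// mulr_gt0.
    move=> w; rewrite !lt_min => /andP[/andP[wd w1] we].
    have -> : w * q w - z0 * q z0 = w * (q w - q z0) + (w - z0) * q z0 by ring.
    apply: le_lt_trans (modulusD _ _) _; rewrite !modulusM [ltRHS](splitr e).
    have wM : modulus w <= M.
      rewrite -[w](subrK z0); apply: le_trans (modulusD _ _) _.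
      by rewrite /M; have := modulus_ge0 l; lra.
    have qM : modulus (q z0) < M.
      by rewrite /M /q eqxx; have := modulus_ge0 z0; lra.
    have E2 : e / (2 * M) * M = e / 2 by field; rewrite gt_eqF.
    apply: ler_ltD.
      rewrite -E2 mulrC; apply: ler_pM; rewrite ?modulus_ge0//.
      exact/ltW/Hd.
    rewrite -E2; apply: ltr_pM; by rewrite ?modulus_ge0.
  apply: cderM; first exact: cder_id.
  exact: dq.
have cf t : pcontat (fun t => f (r%:C%C * circ t)) t.
  apply: pcontat_comp; first exact: pcontat_polar.
  by apply: cder_ccont; apply: df; rewrite modulus_polar// ltW.
have ck t : pcontat (fun t => (1 - z * (circ t)^*%C)^-1) t.
  by apply: (@pcont_cauchy_kernel z t t) => //; rewrite lexx.
have : cmean Q r = cavg (fun t => f (r%:C%C * circ t) * (1 - z * (circ t)^*%C)^-1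
     - f z0 * (1 - z * (circ t)^*%C)^-1).
  apply: eq_cavg => t; have c0 := circ_neq0 t.
  have wz : r%:C%C * circ t != z0 :> C.
    by apply: contraTneq z0r => <-; rewrite modulus_polar ?ltW// ltxx.
  rewrite /Q /q (negbTE wz) -mulrBl mulrCA; congr (_ * _).
  have D0 := circ_denom_neq0 t z1.
  have -> : r%:C%C * circ t - z0 = r%:C%C * circ t * (1 - z * (circ t)^*%C).
    by rewrite mulrBr mulr1 -mulrA (mulrCA (circ t)) (mulrC (circ t)) circ_conj mulr1.
  by rewrite invfM mulrA mulfV ?mul1r// mulf_neq0.
rewrite MQ cavgB.
- move=> /esym/eqP; rewrite subr_eq0 => /eqP ->.
  rewrite cavgZ ?cavg_cauchy_kernel ?mulr1//; by move=> t _; exact: ck.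
- by move=> t _; apply: pcontatM.
- by move=> t _; apply: pcontatM => //; exact: pcontat_cst.
Qed.

Definition poisson z t : R := (1 - modulus z ^+ 2) / modulus (1 - z * (circ t)^*%C) ^+ 2.

Lemma poisson_ge0 z t : modulus z < 1 -> 0 <= poisson z t.
Proof.
move=> z1; rewrite divr_ge0 ?sqr_ge0// subr_ge0 expr_le1 ?modulus_ge0// ltW//.
Qed.

Lemma poissonE z t : modulus z < 1 -> (poisson z t)%:C%C =
  (1 - z * (circ t)^*%C)^-1 + (z^*)%C * circ t / (1 - (z^*)%C * circ t).
Proof.
move=> z1; have D0 := circ_denom_neq0 t z1.
have D0' : 1 - (z^*)%C * circ t != 0.
  by apply: geom_neq0; rewrite ?modulusJ// modulus_circ.
have PE : (poisson z t)%:C%C = (1 - (modulus z ^+ 2)%:C%C) / (modulus (1 - z * (circ t)^*%C) ^+ 2)%:C%C.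
  by rewrite /poisson rmorphM fmorphV rmorphB rmorph1.
rewrite PE -!mulcJ conjB conjM conjc1 conjcK.
have cc : (circ t)^*%C * circ t = 1 :> C by exact: circ_conj.
have -> : z * z^*%C = z * (z^*)%C * ((circ t)^*%C * circ t) by rewrite cc mulr1.
by field; rewrite D0 D0'.
Qed.

(** With u = z conj(circ t), 2 / (1 - u) - 1 = (1 + u) / (1 - u) is the Herglotz kernel; in this
    form it inherits the estimates of the Cauchy kernel. *)
Lemma poisson_herglotz z t : modulus z < 1 ->
  poisson z t = complex.Re (2 * (1 - z * (circ t)^*%C)^-1 - 1).
Proof.
move=> z1; have D0 := circ_denom_neq0 t z1.
have D0' : 1 - (z^*)%C * circ t != 0.
  by apply: geom_neq0; rewrite ?modulusJ// modulus_circ.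
have E : (poisson z t)%:C%C = (1 - z * (circ t)^*%C)^-1 + ((1 - z * (circ t)^*%C)^-1)^*%C - 1.
  rewrite poissonE// -addrA; congr (_ + _).
  rewrite conj_cauchy conjcK.
  by field.
have := congr1 (@complex.Re _) E; rewrite [X in X = _]/= => ->.
by rewrite mulr_natl mulr2n !creD creJ.
Qed.

Lemma rcont_poisson z (a b : R) : modulus z < 1 -> rcont a b (poisson z).
Proof.
move=> z1 t _.
have -> : poisson z = fun t => complex.Re (2 * (1 - z * (circ t)^*%C)^-1 - 1).
  by apply/funext => s; exact: poisson_herglotz.
apply: pcontat_Re; apply: pcontatD; last exact: pcontat_cst.
apply: pcontatM; first exact: pcontat_cst.
by apply: (@pcont_cauchy_kernel z t t) => //; rewrite lexx.
Qed.

(** By [poissonE] the kernel is the Cauchy kernel plus a term which, times [f], is the restriction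
    to |w| = r of a holomorphic function vanishing at 0, so that its mean is 0. *)
Lemma poisson_formula f r z : 0 < r -> modulus z < 1 -> (forall w, modulus w <= r -> cder f w) ->
  cavg (fun t => f (r%:C%C * circ t) * (poisson z t)%:C%C) = f (r%:C%C * z).
Proof.
move=> r0 z1 df; have z1' : modulus (z^*)%C < 1 by rewrite modulusJ.
have rn0 : r%:C%C != 0 :> C by rewrite -modulus_gt0 modulus_ge0_real// ltW.
pose g w := f w * ((z^*)%C * (w / r%:C%C)) * (1 - (z^*)%C * (w / r%:C%C))^-1.
have dg w : modulus w <= r -> cder g w.
  move=> wr; have dw : cder (fun w : C => w / r%:C%C) w.
    by apply: cderM; [exact: cder_id|exact: cder_cst].
  apply: cderM; first apply: cderM; first exact: df.
    by apply: cderM => //; exact: cder_cst.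
  apply: (cder_comp (f := fun w => w / r%:C%C) (g := fun x => (1 - (z^*)%C * x)^-1)) => //.
  apply: cder_geom => //.
  by rewrite modulusM modulusV modulus_real (gtr0_norm r0) ler_pdivrMr// mul1r.
have Mg : cmean g r = 0 by rewrite mean_value// /g mul0r mulr0 mulr0 mul0r.
rewrite -(cauchy_formula r0 z1 df) -[RHS]addr0 -[in RHS]Mg /cmean -cavgD.
- apply: eq_cavg => t; rewrite poissonE// mulrDr; congr (_ + _).
  by rewrite /g [r%:C%C * _]mulrC mulfK// !mulrA.
- move=> t _; apply: pcontatM; first apply: pcontat_comp; first exact: pcontat_polar.
    by apply: cder_ccont; apply: df; rewrite modulus_polar// ltW.
  by apply: (@pcont_cauchy_kernel z t t) => //; rewrite lexx.
- apply: pcont_circle; first exact: ltW.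
  by move=> w wr; apply: cder_ccont; apply: dg; rewrite wr.
Qed.

Lemma poisson_Re f r z : 0 < r -> modulus z < 1 -> (forall w, modulus w <= r -> cder f w) ->
  ravg (fun t => poisson z t * complex.Re (f (r%:C%C * circ t))) = complex.Re (f (r%:C%C * z)).
Proof.
move=> r0 z1 df; rewrite -(poisson_formula r0 z1 df) Re_cavg; apply: eq_ravg => t.
by rewrite creM /= mulr0 subr0 mulrC.
Qed.

Lemma ravg_poisson z : modulus z < 1 -> ravg (poisson z) = 1.
Proof.
move=> z1; have := @poisson_Re (fun=> 1) 1 z ltr01 z1.
rewrite /= => <-; first by apply: eq_ravg => t; rewrite mulr1.
by move=> w _; exact: cder_cst.
Qed.

End circle_mean.

Arguments cavg : simpl never.


(** * Normal families and holomorphic majorants *)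

Section normal_families.
Variable R : realType.
Local Notation C := R[i].
Implicit Types (t r e : R) (z w : C) (f g : C -> C).

Definition hol f := forall z, disk z -> cder f z.

Lemma diskE z : disk z = (modulus z < 1). Proof. by []. Qed.

Lemma hol_circle f r : hol f -> 0 <= r -> r < 1 ->
  forall a b, pcont a b (fun t => f (r%:C%C * circ t)).
Proof.
move=> hf r0 r1; apply: pcont_circle => // z zr; apply/cder_ccont/hf.
by rewrite diskE zr.
Qed.

(** A second order Taylor bound uniform in n. Such a bound passes to pointwise limits, so it yields
    both the holomorphy of the limit and equicontinuity near z. *)
Definition equi_der (F : nat -> C -> C) := forall z, disk z -> exists2 A : R, 0 < A &
  forall n, exists L : C, [/\ modulus (F n z) <= A, modulus L <= A &
    forall h, modulus h <= (1 - modulus z) / 4 ->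
      modulus (F n (z + h) - F n z - L * h) <= A * modulus h ^+ 2].

Section ultra.
Variables (U : set_system nat) (UU : UltraFilter U).
Variable F : nat -> C -> C.
Hypothesis eF : equi_der F.

(** The values and the derivatives converge along [U] at each point, and the quadratic bound on the
    remainder survives in the limit. *)
Lemma normal_limit : exists G, hol G /\
  forall z, disk z -> forall e, 0 < e -> U [set n | modulus (F n z - G z) < e].
Proof.
have /choice[G HG] : forall z, exists l, disk z -> forall e, 0 < e -> U [set n | modulus (F n z - l) < e].
  move=> z; have [dz|ndz] := pselect (disk z); last by exists 0.
  have [A A0 HA] := eF dz.
  have [l Hl] := @ulim_complex _ U UU (fun n => F n z) A (fun n => let: ex_intro _ (And3 H _ _) := HA n in H).
  by exists l.
exists G; split => // z dz.
have [A A0 HA] := eF dz.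
have /choice[L HL] := HA.
have [l Hl] := @ulim_complex _ U UU L A (fun n => let: And3 _ H _ := HL n in H).
exists l => e e0.
have z1 : 0 < 1 - modulus z by rewrite subr_gt0.
exists (Num.min ((1 - modulus z) / 4) (e / A)); first by rewrite lt_min !divr_gt0.
move=> h; rewrite lt_min => /andP[h1 h2].
have dzh : disk (z + h).
  by rewrite diskE; apply: le_lt_trans (modulusD _ _) _; lra.
suff H : modulus (G (z + h) - G z - l * h) <= A * modulus h ^+ 2.
  apply: le_trans H _; rewrite expr2 mulrA ler_wpM2r ?modulus_ge0//.
  by rewrite mulrC -ler_pdivlMr// ltW.
apply/ler_addgt0Pl => e' e'0.
have m0 := modulus_ge0 h.
have e30 : 0 < e' / 3 by rewrite divr_gt0.
have [n [/= n1 [n2 n3]]] := ultra_ex UU (filterI (HG _ dzh _ e30) (filterI (HG _ dz _ e30) (Hl _ e30))).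
have [_ _ /(_ h (ltW h1)) Hn] := HL n.
have -> : G (z + h) - G z - l * h = (F n (z + h) - F n z - L n * h) +
  (((F n z - G z) - (F n (z + h) - G (z + h))) + (L n - l) * h) by ring.
apply: le_trans (modulusD _ _) _; rewrite addrC; apply: lerD => //.
apply: le_trans (modulusD _ _) _; rewrite modulusM.
have := modulusB (F n z - G z) (F n (z + h) - G (z + h)).
have : modulus (L n - l) * modulus h <= e' / 3 * 1.
  apply: ler_pM; rewrite ?modulus_ge0// ?(ltW n3)//.
  have := modulus_ge0 z; lra.
lra.
Qed.

(** Otherwise points violating the bound accumulate at some z along [U], and there equicontinuity
    contradicts pointwise convergence. *)
Lemma normal_unif G : hol G ->
  (forall z, disk z -> forall e, 0 < e -> U [set n | modulus (F n z - G z) < e]) ->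
  forall (eta : R) e, eta < 1 -> 0 < e ->
  U [set n | forall z, modulus z <= eta -> modulus (F n z - G z) < e].
Proof.
move=> hG FG eta e eta1 e0.
have [//|nU] := in_ultra_setVsetC [set n | forall z, modulus z <= eta -> modulus (F n z - G z) < e] UU.
exfalso.
(* For negative [eta] the closed disk is empty; the premise allows the choice before the disk is
   known to be inhabited. *)
have /choice[u Hu] : forall n, exists z, (exists w, modulus w <= eta) -> modulus z <= eta /\
    ((~ forall z, modulus z <= eta -> modulus (F n z - G z) < e) -> e <= modulus (F n z - G z)).
  move=> n; have [H|] := pselect (forall z, modulus z <= eta -> modulus (F n z - G z) < e).
    have [[w ww]|nw] := pselect (exists w : C, modulus w <= eta); first by exists w.
    by exists 0 => /nw.
  move=> /existsNP[z /not_implyP[zeta /negP]]; rewrite -leNgt => H.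
  by exists z => _; split.
have wex : exists w : C, modulus w <= eta.
  have [n Hn] := ultra_ex UU nU; apply: contrapT => nw; apply: Hn => z zeta.
  by exfalso; apply: nw; exists z.
have {}Hu n := Hu n wex.
have [z Hz] := @ulim_complex _ U UU u eta (fun n => proj1 (Hu n)).
have zeta : modulus z <= eta.
  apply/ler_addgt0Pl => d d0; have [n /= Hn] := ultra_ex UU (Hz _ d0).
  rewrite -[z](subrK (u n)).
  apply: le_trans (modulusD _ _) _; rewrite modulusC; apply: lerD; first exact: ltW.
  exact: (proj1 (Hu n)).
have dz : disk z by rewrite diskE (le_lt_trans zeta).
have [A A0 HA] := eF dz.
have e30 : 0 < e / 3 by rewrite divr_gt0.
have [d d0 Hd] := cder_ccont (hG _ dz) e30.
have z1 : 0 < 1 - modulus z by rewrite subr_gt0.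
pose d' := Num.min (Num.min d ((1 - modulus z) / 4)) (Num.min 1 (e / 3 / (A + A))).
have AA : 0 < A + A by rewrite addr_gt0.
have d'0 : 0 < d' by rewrite !lt_min d0 ltr01 !divr_gt0.
have [n [/= n1 [n2 n3]]] := ultra_ex UU (filterI nU (filterI (FG _ dz _ e30) (Hz _ d'0))).
have := proj2 (Hu n) n1; apply/negP; rewrite -ltNge.
move: n3; rewrite /d' !lt_min => /andP[/andP[ud uz] /andP[u1 uA]].
have [L [_ LA /(_ (u n - z) (ltW uz))]] := HA n; rewrite (addrC z) subrK => HL.
set k := u n - z in ud uz u1 uA HL *.
have k0 := modulus_ge0 k.
have -> : F n (u n) - G (u n) = (F n (u n) - F n z - L * k) + L * k + (F n z - G z) - (G (u n) - G z) by ring.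
have G1 : modulus (G (u n) - G z) < e / 3 by exact: Hd.
have H1 : modulus (F n (u n) - F n z - L * k) <= A * modulus k.
  by apply: le_trans HL _; rewrite ler_pM2l// expr2 ler_piMr// ltW.
have H2 : modulus (L * k) <= A * modulus k by rewrite modulusM ler_wpM2r.
have H3 : A * modulus k + A * modulus k < e / 3 by rewrite -mulrDl mulrC -ltr_pdivlMr.
apply: le_lt_trans (modulusB _ _) _.
apply: le_lt_trans (lerD (modulusD _ _) (lexx _)) _.
have := modulusD (F n (u n) - F n z - L * k) (L * k).
lra.
Qed.

End ultra.

Lemma norm_cauchy_kernel z t : modulus z < 1 ->
  modulus ((1 - z * (circ t)^*%C)^-1) <= (1 - modulus z)^-1.
Proof.
move=> z1; have z10 : 0 < 1 - modulus z by rewrite subr_gt0.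
have D0 := circ_denom_neq0 t z1.
rewrite modulusV lef_pV2 ?posrE ?modulus_gt0//.
have := modulus_lowerB 1 (z * (circ t)^*%C).
by rewrite modulus1 modulusM modulusJ modulus_circ mulr1.
Qed.

(** The kernel is expanded algebraically with an exact remainder of order h^2, so no differentiation
    under the integral is involved. The constants depend on [v] through its L^1 mean only, hence are
    uniform along a family. The factor 2 comes from 1 / (1 - |z + h|) <= 2 / (1 - |z|). *)
Lemma cauchy_transform_approx (v : R -> C) z : pcont 0 (2 * pi) v -> modulus z < 1 ->
  let T w := cavg (fun t => v t * (1 - w * (circ t)^*%C)^-1) in
  let a := ravg (fun t => modulus (v t)) in
  modulus (T z) <= a * (1 - modulus z)^-1 /\
  exists L, modulus L <= a * (1 - modulus z)^-1 ^+ 2 /\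
    forall h, modulus h <= (1 - modulus z) / 2 ->
    modulus (T (z + h) - T z - L * h) <= a * (2 * (1 - modulus z)^-1 ^+ 3) * modulus h ^+ 2.
Proof.
move=> cv z1 T a; have z10 : 0 < 1 - modulus z by rewrite subr_gt0.
have ck w : modulus w < 1 -> pcont 0 (2 * pi) (fun t => (1 - w * (circ t)^*%C)^-1).
  by move=> w1; exact: pcont_cauchy_kernel.
have cc : pcont 0 (2 * pi) (fun t => (circ t : C)^*%C).
  by move=> t _; apply/pcontatJ/pcontat_circ.
have bd (k : R -> C) (B : R) : pcont 0 (2 * pi) k -> (forall t, modulus (k t) <= B) ->
    modulus (cavg (fun t => v t * k t)) <= a * B.
  move=> ckk kB; apply: le_trans (modulus_cavg _) _; first exact: pcontM.
  rewrite /a mulrC -ravgZ; last exact: pcont_modulus.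
  apply: ravg_le => [||t _].
  - exact/pcont_modulus/pcontM.
  - by move=> t tt; apply: continuousM; [exact: cst_continuous|exact: (pcont_modulus cv)].
  - by rewrite modulusM mulrC ler_wpM2r ?modulus_ge0.
split.
  by apply: bd; [exact: ck|move=> t; exact: norm_cauchy_kernel].
pose k t := (circ t)^*%C * ((1 - z * (circ t)^*%C)^-1 * (1 - z * (circ t)^*%C)^-1).
have ckk : pcont 0 (2 * pi) k by apply: pcontM => //; apply: pcontM; exact: ck.
exists (cavg (fun t => v t * k t)); split.
  apply: bd => // t; rewrite /k !modulusM modulusJ modulus_circ mul1r expr2.
  by apply: ler_pM; rewrite ?modulus_ge0// norm_cauchy_kernel.
move=> h hz.
have zh1 : modulus (z + h) < 1 by apply: le_lt_trans (modulusD _ _) _; lra.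
have zh2 : (1 - modulus (z + h))^-1 <= 2 * (1 - modulus z)^-1.
  rewrite -[leRHS]invrK lef_pV2 ?posrE ?subr_gt0// ?invr_gt0 ?mulr_gt0 ?invr_gt0//.
  by rewrite invfM invrK; have := modulusD z h; lra.
pose q t := h ^+ 2 * ((1 - (z + h) * (circ t)^*%C)^-1 * ((circ t)^*%C * k t)).
have cq : pcont 0 (2 * pi) q by apply: pcontZ; apply: pcontM; [exact: ck|exact: pcontM].
have -> : T (z + h) - T z - cavg (fun t => v t * k t) * h = cavg (fun t => v t * q t).
  rewrite /T mulrC -cavgZ; last exact: pcontM.
  rewrite -!cavgB; first last.
  - by apply: pcontM => //; exact: ck.
  - by apply: pcontM => //; exact: ck.
  - exact/pcontZ/pcontM.
  - by apply: pcontB; apply: pcontM => //; exact: ck.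
  apply: eq_cavg => t; rewrite /q /k.
  by field; rewrite (circ_denom_neq0 t z1) (circ_denom_neq0 t zh1).
rewrite -mulrA; apply: bd => // t.
rewrite /q /k modulusM modulusX mulrC ler_wpM2r ?sqr_ge0// !modulusM !modulusJ !modulus_circ !mul1r.
rewrite [in leRHS]exprS [in leRHS]mulrA; apply: ler_pM; rewrite ?mulr_ge0 ?modulus_ge0//.
  by apply: le_trans zh2; exact: norm_cauchy_kernel.
by rewrite expr2; apply: ler_pM; rewrite ?modulus_ge0// norm_cauchy_kernel.
Qed.

Definition mean_bounded f (M : R) := forall r, 0 <= r -> r < 1 ->
  ravg (fun t => modulus (f (r%:C%C * circ t))) <= M.

(** Each function is the Cauchy transform of its values on one circle around z, and these have
    bounded L^1 means. *)
Lemma equi_der_mean_bounded (f : nat -> C -> C) (M : R) : (forall n, hol (f n)) ->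
  (forall n, mean_bounded (f n) M) -> equi_der f.
Proof.
move=> hf fM z dz.
have M0 : 0 <= M.
  apply: le_trans (fM 0%N 0 (lexx _) ltr01); apply: ravg_ge0 => t; exact: modulus_ge0.
(* Midway between |z| and 1: for z / r the condition of [cauchy_transform_approx] becomes |h| <= (1
   - |z|) / 4, the radius in [equi_der]. *)
pose r := (1 + modulus z) / 2.
have zm := modulus_ge0 z; have z1 : modulus z < 1 := dz.
have r0 : 0 < r by rewrite /r; lra.
have r1 : r < 1 by rewrite /r; lra.
have zr : modulus z < r by rewrite /r; lra.
pose ze := z / r%:C%C.
have rn0 : r%:C%C != 0 :> C by rewrite -modulus_gt0 modulus_ge0_real// ltW.
have zer : r%:C%C * ze = z by rewrite /ze mulrC divfK.
have mze : modulus ze = modulus z / r by rewrite modulusM modulusV (modulus_ge0_real (ltW r0)).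
have ze1 : modulus ze < 1 by rewrite mze ltr_pdivrMr// mul1r.
set q := (1 - modulus ze)^-1.
have q0 : 0 < q by rewrite invr_gt0 subr_gt0.
have ri : 1 <= r^-1 by rewrite invf_ge1// ltW.
pose A := M * q + M * q ^+ 2 / r + M * (2 * q ^+ 3) / r ^+ 2 + 1.
have T1 : 0 <= M * q by rewrite mulr_ge0// ltW.
have q2 : 0 <= q ^+ 2 by rewrite exprn_ge0// ltW.
have q3 : 0 <= 2 * q ^+ 3 by rewrite mulr_ge0// exprn_ge0// ltW.
have r2 : 0 <= r ^- 2 by rewrite invr_ge0 exprn_ge0// ltW.
have ri0 : 0 <= r^-1 by rewrite invr_ge0 ltW.
have T2 : 0 <= M * q ^+ 2 / r by exact: mulr_ge0 (mulr_ge0 M0 q2) ri0.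
have T3 : 0 <= M * (2 * q ^+ 3) / r ^+ 2 by exact: mulr_ge0 (mulr_ge0 M0 q3) r2.
exists A; first by rewrite /A; lra.
move=> n; pose v t := f n (r%:C%C * circ t).
have cv : pcont 0 (2 * pi) v by apply: hol_circle => //; exact: ltW.
have cau w : modulus w < 1 -> cavg (fun t => v t * (1 - w * (circ t)^*%C)^-1) = f n (r%:C%C * w).
  move=> w1; apply: cauchy_formula => // x xr; apply: hf.
  by rewrite diskE (le_lt_trans xr).
have [/=] := cauchy_transform_approx cv ze1; rewrite cau// zer -/q => H1 [L [H2 H3]].
have aM : ravg (fun t => modulus (v t)) <= M by apply: fM => //; exact: ltW.
exists (L / r%:C%C); split.
- apply: le_trans H1 _; apply: le_trans (ler_wpM2r (ltW q0) aM) _; rewrite /A; lra.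
- rewrite modulusM modulusV (modulus_ge0_real (ltW r0)).
  have : modulus L / r <= M * q ^+ 2 / r.
    rewrite ler_pM2r ?invr_gt0//; apply: le_trans H2 _; rewrite ler_wpM2r// exprn_ge0// ltW.
  rewrite /A; lra.
- move=> h hz.
  have hr : modulus (h / r%:C%C) = modulus h / r by rewrite modulusM modulusV (modulus_ge0_real (ltW r0)).
  have /H3 : modulus (h / r%:C%C) <= (1 - modulus ze) / 2.
    rewrite hr mze ler_pdivrMr//.
    have -> : (1 - modulus z / r) / 2 * r = (r - modulus z) / 2 by field; rewrite gt_eqF.
    by rewrite /r; lra.
  have zh : ze + h / r%:C%C = (z + h) / r%:C%C by rewrite mulrDl.
  have zh1 : modulus (ze + h / r%:C%C) < 1.
    rewrite zh modulusM modulusV (modulus_ge0_real (ltW r0)) ltr_pdivrMr// mul1r.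
    by apply: le_lt_trans (modulusD _ _) _; rewrite /r; lra.
  rewrite cau// zh mulrCA mulfV// mulr1 hr => H.
  have -> : L / r%:C%C * h = L * (h / r%:C%C) by rewrite mulrAC mulrA.
  apply: le_trans H _.
  have -> : ravg (fun t => modulus (v t)) * (2 * q ^+ 3) * (modulus h / r) ^+ 2 =
     ravg (fun t => modulus (v t)) * (2 * q ^+ 3) / r ^+ 2 * modulus h ^+ 2.
    by field; rewrite gt_eqF.
  rewrite ler_wpM2r ?sqr_ge0//.
  have : ravg (fun t => modulus (v t)) * (2 * q ^+ 3) / r ^+ 2 <= M * (2 * q ^+ 3) / r ^+ 2.
    by rewrite ler_wpM2r// ler_wpM2r.
  rewrite /A; lra.
Qed.

Lemma one_sub_invS n : 0 < 1 - n.+2%:R^-1 :> R /\ 1 - n.+2%:R^-1 < 1 :> R.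
Proof.
split; last by rewrite ltrBlDr ltrDl invr_gt0.
by rewrite subr_gt0 invf_lt1// ltr1n.
Qed.

(* The Herglotz transforms of |g| on circles of radius tending to 1 form a
   normal family. *)
Lemma holomorphic_majorant g (M : R) : hol g -> mean_bounded g M ->
  exists G, [/\ hol G, forall z, disk z -> modulus (g z) <= complex.Re (G z) &
    forall z, disk z -> modulus (G z) <= 3 * M / (1 - modulus z)].
Proof.
move=> hg gM.
have M0 : 0 <= M.
  by apply: le_trans (gM 0 (lexx _) ltr01); apply: ravg_ge0 => t; exact: modulus_ge0.
pose r n : R := 1 - n.+2%:R^-1.
have r0 n : 0 < r n by have [] := one_sub_invS n.
have r1 n : r n < 1 by have [] := one_sub_invS n.
pose v n t := modulus (g ((r n)%:C%C * circ t)).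
pose w n t : C := (v n t)%:C%C.
have cg n : pcont 0 (2 * pi) (fun t => g ((r n)%:C%C * circ t)) by apply: hol_circle => //; exact: ltW.
have cv n : rcont 0 (2 * pi) (v n) by exact: pcont_modulus.
have cw n : pcont 0 (2 * pi) (w n) by exact: pcont_real.
have aM n : ravg (fun t => modulus (w n t)) <= M.
  rewrite (@eq_ravg _ _ (v n)); last by move=> t; rewrite modulus_ge0_real// modulus_ge0.
  by apply: gM => //; exact: ltW.
have a0 n : 0 <= ravg (fun t => modulus (w n t)) by apply: ravg_ge0 => t; exact: modulus_ge0.
pose T n z := cavg (fun t => w n t * (1 - z * (circ t)^*%C)^-1).
(* The Herglotz transform: its real part is the Poisson integral of |g| over the circle of radius
   [r n], which dominates |g(r n z)| because the kernel is nonnegative. *)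
pose F n z := 2 * T n z - cavg (w n).
have FT n z : disk z -> modulus (F n z) <= 3 * M / (1 - modulus z).
  move=> dz; have z10 : 0 < 1 - modulus z by rewrite subr_gt0.
  have [/= H _] := cauchy_transform_approx (cw n) dz.
  apply: le_trans (modulusB _ _) _.
  have -> : 3 * M / (1 - modulus z) = 2 * (M / (1 - modulus z)) + M / (1 - modulus z) by ring.
  apply: lerD.
    rewrite mulr_natl mulr2n; apply: le_trans (modulusD _ _) _; rewrite mulr_natl mulr2n.
    have HM : modulus (T n z) <= M / (1 - modulus z).
      by apply: le_trans H _; rewrite ler_wpM2r// invr_ge0 ltW.
    exact: lerD.
  apply: le_trans (modulus_cavg (cw n)) _; apply: le_trans (aM n) _.
  by rewrite ler_pdivlMr// ler_piMr// lerBlDr lerDl modulus_ge0.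
have eF : equi_der F.
  move=> z dz; have z10 : 0 < 1 - modulus z by rewrite subr_gt0.
  set q := (1 - modulus z)^-1; have q0 : 0 < q by rewrite invr_gt0.
  have T1 : 0 <= 3 * M * q by rewrite mulr_ge0 ?mulr_ge0// ltW.
  have T2 : 0 <= M * q ^+ 2 by rewrite mulr_ge0// exprn_ge0// ltW.
  have q3 : 0 <= 2 * q ^+ 3 by rewrite mulr_ge0// exprn_ge0// ltW.
  have T3 : 0 <= M * (2 * q ^+ 3) by exact: mulr_ge0.
  exists (3 * M * q + 2 * (M * q ^+ 2) + 2 * (M * (2 * q ^+ 3)) + 1); first by lra.
  move=> n; have [/= H1 [L [H2 H3]]] := cauchy_transform_approx (cw n) dz.
  have m2 : modulus (2 : C) = 2 by rewrite -(rmorph_nat (real_complex R) 2) modulus_ge0_real.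
  exists (2 * L); split.
  - apply: le_trans (FT n z dz) _; rewrite -/q; lra.
  - have : modulus L <= M * q ^+ 2 by apply: le_trans H2 _; rewrite ler_wpM2r// exprn_ge0// ltW.
    rewrite modulusM m2; lra.
  - move=> h hz.
    have {}H3 := H3 h; have {H3}/H3 : modulus h <= (1 - modulus z) / 2 by lra.
    rewrite -/(T n (z + h)) -/(T n z) -/q => H3.
    have -> : F n (z + h) - F n z - 2 * L * h = 2 * (T n (z + h) - T n z - L * h) by rewrite /F; ring.
    rewrite modulusM m2.
    have H4 : ravg (fun t => modulus (w n t)) * (2 * q ^+ 3) * modulus h ^+ 2 <= M * (2 * q ^+ 3) * modulus h ^+ 2.
      by rewrite ler_wpM2r ?sqr_ge0// ler_wpM2r.
    have : 0 <= (3 * M * q + 2 * (M * q ^+ 2) + 1) * modulus h ^+ 2.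
      by rewrite mulr_ge0 ?sqr_ge0//; lra.
    rewrite !mulrDl; lra.
have [U [UU Uf]] := free_ultrafilter.
have [G [hG FG]] := normal_limit UU eF.
exists G; split => // z dz.
- apply/ler_addgt0Pl => e e0; have e20 : 0 < e / 2 by rewrite divr_gt0.
  have [d d0 Hd] := cder_ccont (hg _ dz) e20.
  have [N HN] := archi_lt d0.
  have [n [/= n1 n2]] := ultra_ex UU (filterI (FG _ dz _ e20) (ultra_ge Uf N)).
  have P : modulus (g ((r n)%:C%C * z)) <= complex.Re (F n z).
    rewrite -poisson_formula//; last first.
      by move=> x xr; apply: hg; rewrite diskE (le_lt_trans xr).
    have cP := pcont_real (@rcont_poisson _ z 0 (2 * pi) dz).
    apply: le_trans (modulus_cavg _) _; first exact: pcontM.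
    have -> : F n z = cavg (fun t => w n t * (2 * (1 - z * (circ t)^*%C)^-1 - 1)).
      rewrite /F /T -cavgZ; last by apply: pcontM => //; exact: pcont_cauchy_kernel.
      rewrite -cavgB//; last by apply: pcontZ; apply: pcontM => //; exact: pcont_cauchy_kernel.
      by apply: eq_cavg => t; ring.
    rewrite Re_cavg le_eqVlt; apply/orP; left; apply/eqP; apply: eq_ravg => t.
    rewrite creM /= mul0r subr0 -poisson_herglotz// modulusM modulus_ge0_real//.
    exact: poisson_ge0.
  have H1 : modulus (g z) <= modulus (g ((r n)%:C%C * z)) + e / 2.
    rewrite -{1}[g z](subrK (g ((r n)%:C%C * z))) [leRHS]addrC.
    apply: le_trans (modulusD _ _) _; rewrite lerD2r modulusC; apply/ltW/Hd.
    have -> : (r n)%:C%C * z - z = - ((n.+2%:R^-1)%:C%C * z).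
      by rewrite /r rmorphB rmorph1; ring.
    rewrite modulusN modulusM modulus_ge0_real ?invr_ge0//.
    apply: le_lt_trans (HN n.+1 _); last exact: leqW.
    by rewrite ler_piMr ?invr_ge0// ltW.
  have H2 : complex.Re (F n z) <= complex.Re (G z) + e / 2.
    rewrite -lerBlDl -creN -creD; apply: le_trans (ler_norm _) _.
    by apply: le_trans (Re_le_modulus _) _; exact: ltW.
  lra.
- apply/ler_addgt0Pl => e e0.
  have [n /= Hn] := ultra_ex UU (FG _ dz _ e0).
  rewrite -{1}[G z](subrK (F n z)).
  apply: le_trans (modulusD _ _) _; rewrite modulusC; apply: lerD; first exact: ltW.
  exact: FT.
Qed.

End normal_families.


(** * Radial limits *)

Section real_calculus.
Variable R : realType.
Implicit Types (a b t x : R) (u v w p : R -> R).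

(* [is_derive] hidden from type class resolution, which would otherwise try to
   solve hypotheses of this form *)
Definition rderiv (f : R -> R) x (l : R) : Prop := is_derive x 1 f l.

Lemma rderiv_continuous (f : R -> R) x (l : R) : rderiv f x l -> {for x, continuous f}.
Proof. by move=> [df _]; apply: differentiable_continuous; apply/derivable1_diffP. Qed.

Lemma ftc (F f : R -> R) a b : a <= b -> rcont a b f ->
  (forall x, a <= x <= b -> rderiv F x (f x)) -> rint a b f = F b - F a.
Proof.
rewrite le_eqVlt => /predU1P[<- _ _|ab cf dF].
  by rewrite /rint set_itv1 Rintegral_set1 subrr.
have cF x : a <= x <= b -> {for x, continuous F} by move=> /dF/rderiv_continuous.
rewrite /rint /Rintegral (@continuous_FTC2 _ f F)//.
- exact: rcont_within.
- split.
  + by move=> x; rewrite in_itv /= => /andP[ax xb]; have [] := dF x _ => //; rewrite !ltW.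
  + by apply: cvg_at_right_filter; apply: cF; rewrite lexx ltW.
  + by apply: cvg_at_left_filter; apply: cF; rewrite lexx ltW.
- move=> x; rewrite in_itv /= => /andP[ax xb]; rewrite derive1E.
  by have [] := dF x _ => //; rewrite !ltW.
Qed.

Lemma is_derive_rint v a : (forall t, {for t, continuous v}) -> forall x, a < x ->
  rderiv (fun y => rint a y v) x (v x).
Proof.
move=> cv x ax; have [] := @continuous_FTC1_closed R v a x (x + 1).
- by rewrite ltrDl.
- by apply: rcont_integrable => t _.
- by [].
- exact: cv.
by move=> H1; rewrite derive1E => H2; constructor.
Qed.

Lemma rint_by_parts (p p' W w : R -> R) a b : a <= b -> rcont a b p' -> rcont a b w ->
  (forall x, a <= x <= b -> rderiv p x (p' x)) ->
  (forall x, a <= x <= b -> rderiv W x (w x)) ->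
  rint a b (fun x => p x * w x) = p b * W b - p a * W a - rint a b (fun x => p' x * W x).
Proof.
move=> ab cp' cw dp dW.
have cp : rcont a b p by move=> x /dp/rderiv_continuous.
have cW : rcont a b W by move=> x /dW/rderiv_continuous.
have c1 : rcont a b (fun x => p x * w x).
  by move=> t tab; apply: continuousM; [exact: cp|exact: cw].
have c2 : rcont a b (fun x => p' x * W x).
  by move=> t tab; apply: continuousM; [exact: cp'|exact: cW].
apply/eqP; rewrite eq_sym subr_eq eq_sym; apply/eqP.
rewrite -rintD// (@ftc (fun x => p x * W x))//.
  by move=> t tab; apply: continuousD; [exact: c1|exact: c2].
move=> x xab; have ip : is_derive x 1 p (p' x) := dp _ xab; have iW : is_derive x 1 W (w x) := dW _ xab.
have := is_deriveM ip iW => /is_derive_eq; apply.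
by rewrite /GRing.scale /= addrC (mulrC (W x)) addrC.
Qed.

Lemma rint_shift v a b c : a <= b -> (forall t, {for t, continuous v}) ->
  rint (a + c) (b + c) v = rint a b (fun t => v (t + c)).
Proof.
move=> ab cv; pose A := a + c - 1; pose F y := rint A y v.
have dF x : a + c <= x -> rderiv F x (v x).
  by move=> xa; apply: is_derive_rint => //; rewrite /A; lra.
rewrite (@ftc F v); [|by rewrite lerD2r|by move=> t _; exact: cv|by move=> x /andP[/dF]].
rewrite (@ftc (fun t => F (t + c)) (fun t => v (t + c)))//.
- move=> t _; apply: (@continuous_comp _ _ _ (fun t => t + c) v); last exact: cv.
  by apply: continuousD; [exact: id|exact: cst_continuous].
- move=> x /andP[ax _].
  have d1 : is_derive x 1 (fun t => t + c) (1 : R).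
    by have := is_deriveD (is_derive_id x 1) (is_derive_cst c x (1 : R)) => /is_derive_eq; apply; rewrite addr0.
  have d2 : is_derive (x + c) 1 F (v (x + c)) by apply: (dF (x + c)); rewrite lerD2r.
  have := @is_derive1_comp _ F (fun t => t + c) x _ _ d2 d1 => /is_derive_eq; apply; exact: mulr1.
Qed.

End real_calculus.

(** * Poisson integrals and centered averages *)

Section maximal.
Variable R : realType.
Local Notation C := R[i].
Local Notation mu := (@lebesgue_measure R).
Implicit Types (r s t : R).

(** The Poisson kernel of the point -r. Its peak sits at the middle of [0, 2 pi], so it increases on
    [0, pi] and decreases on [pi, 2 pi], without wrapping around. *)
Definition opp_poisson r s : R := (1 - r ^+ 2) / (1 + 2 * r * cos s + r ^+ 2).

Lemma poisson_opp r s : 0 <= r -> poisson (r%:C%C * circ pi) s = opp_poisson r s.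
Proof.
move=> r0; rewrite /poisson modulus_polar// /opp_poisson; congr (_ / _).
have E := cos2Dsin2 s; rewrite modulusE /circ cospi sinpi /=.
transitivity (1 + 2 * r * cos s + r ^+ 2 * (cos s ^+ 2 + sin s ^+ 2)); first by ring.
by rewrite E mulr1.
Qed.

Lemma opp_poisson_denom r s : 0 <= r -> r < 1 -> 0 < 1 + 2 * r * cos s + r ^+ 2.
Proof.
move=> r0 r1; have c1 := cos_geN1 s.
have : 0 < (1 - r) ^+ 2 by rewrite exprn_gt0// subr_gt0.
have : 0 <= 2 * r * (1 + cos s) by rewrite mulr_ge0 ?mulr_ge0//; lra.
lra.
Qed.

Definition opp_poisson' r s : R :=
  (1 - r ^+ 2) * (2 * r * sin s) / (1 + 2 * r * cos s + r ^+ 2) ^+ 2.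

Lemma is_derive_opp_poisson r s : 0 <= r -> r < 1 ->
  rderiv (opp_poisson r) s (opp_poisson' r s).
Proof.
move=> r0 r1; have D0 := opp_poisson_denom s r0 r1.
pose D t := 1 + 2 * r * cos t + r ^+ 2.
have dD : is_derive s 1 D (- (2 * r * sin s)).
  have d1 := is_deriveZ (2 * r) (is_derive_cos s).
  have d2 := is_deriveD (is_deriveD (is_derive_cst (1 : R) s (1 : R)) d1) (is_derive_cst (r ^+ 2) s (1 : R)).
  by have := d2 => /is_derive_eq; apply; rewrite /GRing.scale /=; ring.
have Ds : D s != 0 by rewrite gt_eqF.
have := is_deriveZ (1 - r ^+ 2) (is_deriveV Ds dD) => /is_derive_eq; apply.
rewrite /GRing.scale /= /opp_poisson' /D in Ds *.
by field.
Qed.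

Lemma continuous_opp_poisson' r s : 0 <= r -> r < 1 -> {for s, continuous (opp_poisson' r)}.
Proof.
move=> r0 r1; have D0 := opp_poisson_denom s r0 r1.
have cst0 (k : R) : {for s, continuous (fun=> k : R)} by exact: cst_continuous.
have cs : {for s, continuous (@cos R)} by exact: continuous_cos.
have ss : {for s, continuous (@sin R)} by exact: continuous_sin.
have cD : {for s, continuous (fun t => 1 + 2 * r * cos t + r ^+ 2)}.
  by apply: continuousD => //; apply: continuousD => //; apply: continuousM.
apply: continuousM; first by apply: continuousM => //; apply: continuousM.
apply: (@continuousV _ _ (fun t => (1 + 2 * r * cos t + r ^+ 2) ^+ 2)).
  by rewrite gt_eqF// exprn_gt0.
have -> : (fun t => (1 + 2 * r * cos t + r ^+ 2) ^+ 2) =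
   (fun t => (1 + 2 * r * cos t + r ^+ 2) * (1 + 2 * r * cos t + r ^+ 2)).
  by apply/funext => t; rewrite expr2.
exact: continuousM.
Qed.

(* Layer-cake estimate: the Poisson kernel is even and decreasing away from
   its pole, so that it is dominated by averages over centered intervals. *)
Lemma poisson_avg_le r (V F : R -> R) (M : R) : 0 <= r -> r < 1 ->
  (forall t, {for t, continuous V}) -> (forall t, 0 <= t <= 2 * pi -> rderiv F t (V t)) ->
  (forall t, 0 <= t <= pi -> F pi - F (pi - t) <= 2 * M * t) ->
  (forall t, 0 <= t <= pi -> F (pi + t) - F pi <= 2 * M * t) ->
  ravg (fun s => opp_poisson r s * V s) <= 2 * M.
Proof.
move=> r0 r1 cV dF HL HR.
have pi0 : 0 < pi :> R by exact: pi_gt0.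
have p0 s : 0 <= opp_poisson r s.
  rewrite divr_ge0 ?(ltW (opp_poisson_denom _ _ _))// subr_ge0 expr_le1//.
  exact: ltW.
have dp s : rderiv (opp_poisson r) s (opp_poisson' r s) by exact: is_derive_opp_poisson.
have cp' s : {for s, continuous (opp_poisson' r)} by exact: continuous_opp_poisson'.
have cp s : {for s, continuous (opp_poisson r)} by exact: (rderiv_continuous (dp s)).
have cst0 (k s : R) : {for s, continuous (fun=> k : R)} by exact: cst_continuous.
(* The constant density 2 M is subtracted. The hypotheses on [F] make [W] nonnegative before pi and
   nonpositive after it; integrating by parts against the monotone halves of the kernel gives a
   nonpositive mean, and the kernel has mean 1. *)
pose W s := F s - F pi - 2 * M * (s - pi).
pose w s := V s - 2 * M.
have cw s : {for s, continuous w} by apply: continuousB.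
have dW t : 0 <= t <= 2 * pi -> rderiv W t (w t).
  move=> tp; have d1 : is_derive t 1 F (V t) := dF t tp.
  have d2 := is_deriveZ (2 * M) (is_deriveB (is_derive_id t 1) (is_derive_cst pi t (1 : R))).
  have := is_deriveB (is_deriveB d1 (is_derive_cst (F pi) t (1 : R))) d2 => /is_derive_eq; apply.
  by rewrite /GRing.scale /= /w; ring.
have Wpi : W pi = 0 by rewrite /W !subrr mulr0 subr0.
have cpw s : {for s, continuous (fun s => opp_poisson r s * w s)} by apply: continuousM.
have cW s : 0 <= s <= 2 * pi -> {for s, continuous W} by move=> /dW/rderiv_continuous.
have p'0 s : 0 <= s <= pi -> 0 <= opp_poisson' r s.
  move=> /andP[s0 s1]; apply: mulr_ge0; last by rewrite invr_ge0 sqr_ge0.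
  rewrite mulr_ge0 ?mulr_ge0 ?sin_ge0_pi ?s0 ?s1// subr_ge0 expr_le1// ltW//.
have p'1 s : pi <= s <= 2 * pi -> opp_poisson' r s <= 0.
  move=> /andP[s0 s1]; rewrite -oppr_ge0 /opp_poisson' -mulNr -mulrN; apply: mulr_ge0; last by rewrite invr_ge0 sqr_ge0.
  apply: mulr_ge0; first by rewrite subr_ge0 expr_le1// ltW.
  rewrite -mulrN; apply: mulr_ge0; first by rewrite mulr_ge0.
  have -> : - sin s = sin (s - pi) by rewrite -[in LHS](subrK pi s) sinDpi opprK.
  apply: sin_ge0_pi; apply/andP; split; lra.
have W_ge0 s : 0 <= s <= pi -> 0 <= W s.
  move=> /andP[s0 s1]; have := HL (pi - s); rewrite subKr /W => H.
  have : F pi - F s <= 2 * M * (pi - s) by apply: H; apply/andP; split; lra.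
  lra.
have W_le0 s : pi <= s <= 2 * pi -> W s <= 0.
  move=> /andP[s0 s1]; have := HR (s - pi); rewrite (addrC pi) subrK /W => H.
  have : F s - F pi <= 2 * M * (s - pi) by apply: H; apply/andP; split; lra.
  lra.
have I1 : rint 0 pi (fun s => opp_poisson r s * w s) <= 0.
  rewrite (@rint_by_parts _ _ (opp_poisson' r) W w) ?(ltW pi0)//; first last.
  - by move=> x /andP[x0 x1]; apply: dW; rewrite x0/=; lra.
  rewrite Wpi mulr0 add0r -opprD oppr_le0; apply: addr_ge0.
    by apply: mulr_ge0 => //; apply: W_ge0; rewrite lexx ltW.
  by apply: rint_ge0 => t tp; apply: mulr_ge0; [exact: p'0|exact: W_ge0].
have I2 : rint pi (2 * pi) (fun s => opp_poisson r s * w s) <= 0.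
  rewrite (@rint_by_parts _ _ (opp_poisson' r) W w)//; first last.
  - by move=> x /andP[x0 x1]; apply: dW; rewrite x1 andbT; lra.
  - lra.
  rewrite Wpi mulr0 subr0 subr_le0; apply: (@le_trans _ _ 0).
    by apply: mulr_ge0_le0 => //; apply: W_le0; rewrite lexx andbT; lra.
  by apply: rint_ge0 => t tp; apply: mulr_le0; [exact: p'1|exact: W_le0].
have I : ravg (fun s => opp_poisson r s * w s) <= 0.
  rewrite /ravg (@rint_split _ 0 (2 * pi) pi) ?(ltW pi0)//; last first.
  - lra.
  rewrite pmulr_rle0 ?invr_gt0 ?pi2_gt0//; lra.
have E : ravg (opp_poisson r) = 1.
  rewrite -[RHS](@ravg_poisson _ (r%:C%C * circ pi)) ?modulus_polar//.
  by apply: eq_ravg => t; rewrite poisson_opp.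
have -> : (fun s => opp_poisson r s * V s) = fun s => opp_poisson r s * w s + 2 * M * opp_poisson r s.
  by apply/funext => s; rewrite /w; ring.
rewrite ravgD.
- rewrite ravgZ; last by move=> t _; exact: cp.
  rewrite E; lra.
- by move=> t _; exact: cpw.
- by move=> t _; apply: continuousM.
Qed.

End maximal.


(** * Weak type estimates for radial suprema *)

Section weak_type.
Variable R : realType.
Local Notation C := R[i].
Local Notation mu := (@lebesgue_measure R).
Implicit Types (r s t : R) (h k f : C -> C).

Lemma rint_EFin a b (v : R -> R) : rcont a b v ->
  (rint a b v)%:E = (\int[mu]_(x in `[a, b]) (v x)%:E)%E.
Proof.
move=> cv; rewrite /rint /Rintegral fineK//.
by apply: integrable_fin_num => //; exact: rcont_integrable.
Qed.

(** Where the Hardy-Littlewood maximal function of |h| on the circle of radius p is at most l / 2,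
    [poisson_avg_le] bounds |h| by l on the whole radius. The exceptional set is thus a superlevel
    set of the maximal function. *)
Lemma weak_type_circle h (p d l : R) : hol h -> 0 < p -> p < 1 -> 0 < l ->
  ravg (fun t => modulus (h (p%:C%C * circ t))) <= d ->
  exists B : set R, [/\ measurable B, (mu B <= (36 * pi * d / l)%:E)%E &
    forall t, 0 <= t <= 2 * pi ->
      (exists r, [/\ 0 <= r, r < 1 & l < modulus (h ((r * p)%:C%C * circ t))]) -> B t].
Proof.
move=> hh p0 p1 l0 hd.
have pi0 : 0 < pi :> R by exact: pi_gt0.
pose v t := modulus (h (p%:C%C * circ t)).
have cv t : {for t, continuous v}.
  by apply: (pcont_modulus (hol_circle hh (ltW p0) p1 (a := t) (b := t))); rewrite lexx.
have v0 t : 0 <= v t by exact: modulus_ge0.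
(* Three periods, so that the intervals of radius at most pi around points of [0, 2 pi] see [v]
   before truncation. *)
pose D : set R := [set` `[- (2 * pi), 4 * pi]].
have cvD : rcont (- (2 * pi)) (4 * pi) v by move=> t _; exact: cv.
have iv : mu.-integrable D (EFin \o v) by exact: rcont_integrable.
pose w := v \_ D.
have lw : locally_integrable [set: R] w by apply: integrable_locally => //; exact: measurable_itv.
exists [set t | ((l / 2)%:E < HL_maximal w t)%E]; split.
- rewrite -[X in measurable X]setTI; apply: emeasurable_fun_o_infty => //.
  exact: measurable_HL_maximal.
- apply: le_trans (maximal_inequality lw _) _; first by rewrite divr_gt0.
  have -> : (\int[mu]_y `|(w y)%:E| = (rint (- (2 * pi)) (4 * pi) v)%:E)%E.
    rewrite rint_EFin// [RHS]integral_mkcond /=; apply: eq_integral => y _.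
    rewrite /w /= restrict_EFin /= ger0_norm// patchE; case: ifP => // _.
  have per a : rint (a + 2 * pi) (a + 2 * pi + 2 * pi) v = rint a (a + 2 * pi) v.
    rewrite rint_shift//; last by lra.
    by apply: eq_rint => t _; rewrite /v circD2pi.
  have -> : rint (- (2 * pi)) (4 * pi) v = 3 * rint 0 (2 * pi) v.
    have z1 : - (2 * pi) <= 0 :> R by lra.
    have z2 : 0 <= 4 * pi :> R by lra.
    have z3 : 0 <= 2 * pi :> R by lra.
    have z4 : 2 * pi <= 4 * pi :> R by lra.
    have cv' : rcont 0 (4 * pi) v by move=> t _.
    rewrite (rint_split z1 z2 cvD) (rint_split z3 z4 cv').
    have := per 0; have := per (- (2 * pi)); rewrite !add0r !addNr add0r.
    have -> : 2 * pi + 2 * pi = 4 * pi :> R by lra.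
    lra.
  rewrite -EFinM lee_fin.
  have -> : rint 0 (2 * pi) v = 2 * pi * ravg v by rewrite /ravg mulrA divff ?mul1r// gt_eqF// pi2_gt0.
  (* The factors: 3 from the maximal inequality, 2 from the level l / 2, 3 for the periods and 2 pi
     for the normalization. *)
  have -> : 3 / (l / 2) * (3 * (2 * pi * ravg v)) = (36 * pi / l) * ravg v.
    by field; rewrite gt_eqF.
  rewrite [leRHS]mulrAC ler_wpM2l// divr_ge0 ?(ltW l0)// mulr_ge0 ?(ltW pi0)//.
- move=> t /andP[t0 t1] [r [r0 r1 lh]]; rewrite /=; rewrite ltNge; apply/negP => HLM.
  move: lh; apply/negP; rewrite -leNgt.
  pose M := l / 2.
  have avg x : 0 <= x -> x <= pi -> rint (t - x) (t + x) v <= 2 * M * x.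
    rewrite le_eqVlt => /predU1P[<- _|x0 xpi].
      by rewrite subr0 addr0 mulr0 /rint set_itv1 Rintegral_set1.
    have H : (iavg w (ball t x) <= M%:E)%E.
      by apply: le_trans HLM; apply: ereal_sup_ubound; exists x => //=; rewrite in_itv /= x0.
    rewrite -lee_fin rint_EFin; last by move=> s _; exact: cv.
    have mx : mu (ball t x) = (x *+ 2)%:E by rewrite lebesgue_measure_ball// ltW.
    have -> : (\int[mu]_(x0 in `[(t - x)%R, (t + x)%R]) (v x0)%:E = \int[mu]_(y in ball t x) `|(w y)%:E|)%E.
      rewrite ball_itv (@integral_itv_bndoo _ (t - x) (t + x) _ true false); last first.
        apply/measurable_EFinP; apply: measurable_funTS.
        apply: continuous_measurable_fun => s; exact: cv.
      apply: eq_integral => y; rewrite inE /= in_itv /= => /andP[y0 y1].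
      have Dy : D y by rewrite /D /= in_itv /=; apply/andP; split; lra.
      by rewrite /w patchE mem_set//= ger0_norm.
    move: H; rewrite /iavg mx inver mulrn_eq0 /= gt_eqF//.
    rewrite muleC -lee_pdivlMr ?invr_gt0 ?mulrn_wgt0// => /le_trans; apply.
    by rewrite lee_fin invrK -mulr_natr; lra.
  pose F s := rint (- (2 * pi)) (s + (t - pi)) v.
  pose V s := v (s + (t - pi)).
  have cV s : {for s, continuous V}.
    apply: (@continuous_comp _ _ _ (fun s => s + (t - pi)) v); last exact: cv.
    by apply: continuousD; [exact: id|exact: cst_continuous].
  have dF s : 0 <= s <= 2 * pi -> rderiv F s (V s).
    move=> /andP[s0 _].
    have d1 : is_derive s 1 (fun s => s + (t - pi)) (1 : R).
      by have := is_deriveD (is_derive_id s 1) (is_derive_cst (t - pi) s (1 : R)) => /is_derive_eq; apply; rewrite addr0.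
    have d2 : is_derive (s + (t - pi)) 1 (fun y => rint (- (2 * pi)) y v) (v (s + (t - pi))).
      by apply: is_derive_rint => //; lra.
    have := @is_derive1_comp _ (fun y => rint (- (2 * pi)) y v) (fun s => s + (t - pi)) s _ _ d2 d1.
    by move=> /is_derive_eq; apply; exact: mulr1.
  have cva x y : rcont x y v by move=> s _; exact: cv.
  have sp a b c : a <= b -> b <= c -> rint a c v - rint a b v = rint b c v.
    by move=> ab bc; rewrite (rint_split ab bc (cva a c)) addrC addKr.
  have vle a b c d' : a <= b -> b <= c -> c <= d' -> rint b c v <= rint a d' v.
    move=> ab bc cd'; rewrite (rint_split ab (le_trans bc cd') (cva _ _)) (rint_split bc cd' (cva _ _)).
    have : 0 <= rint a b v by apply: rint_ge0 => s _.
    have : 0 <= rint c d' v by apply: rint_ge0 => s _.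
    lra.
  have PA := @poisson_avg_le _ r V F M r0 r1 cV dF _ _.
  have {PA} : ravg (fun s => opp_poisson r s * V s) <= 2 * M.
    apply: PA => x /andP[x0 x1]; rewrite /F.
      rewrite sp; [|lra..].
      have -> : pi - x + (t - pi) = t - x by ring.
      have -> : pi + (t - pi) = t by ring.
      apply: le_trans (avg x x0 x1); apply: vle; lra.
    rewrite sp; [|lra..].
    have -> : pi + x + (t - pi) = t + x by ring.
    have -> : pi + (t - pi) = t by ring.
    apply: le_trans (avg x x0 x1); apply: vle; lra.
  have -> : 2 * M = l by rewrite /M mulrC divfK.
  apply: le_trans.
  pose g z := h (z * circ (t - pi)).
  have dg z : modulus z <= p -> cder g z.
    move=> zp; apply: (cder_comp (f := fun z => z * circ (t - pi)) (g := h)).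
      by apply: cderM; [exact: cder_id|exact: cder_cst].
    by apply: hh; rewrite diskE modulusM modulus_circ mulr1 (le_lt_trans zp).
  have rp1 : modulus (r%:C%C * circ pi : C) < 1 by rewrite modulus_polar.
  have := poisson_formula p0 rp1 dg.
  have -> : g (p%:C%C * (r%:C%C * circ pi)) = h ((r * p)%:C%C * circ t).
    rewrite /g; congr h; rewrite -!mulrA -circD addrC subrK rmorphM /=.
    by rewrite mulrA (mulrC p%:C%C).
  move=> <-.
  have cg : pcont 0 (2 * pi) (fun s => g (p%:C%C * circ s)).
    by apply: pcont_circle => //; [exact: ltW|move=> z zp; apply/cder_ccont/dg; rewrite zp].
  have cP := @rcont_poisson _ _ 0 (2 * pi) rp1.
  apply: le_trans (modulus_cavg _) _; first by apply: pcontM => //; exact: pcont_real.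
  rewrite le_eqVlt; apply/orP; left; apply/eqP; apply: eq_ravg => s.
  rewrite modulusM modulus_ge0_real; last exact: poisson_ge0.
  by rewrite poisson_opp// mulrC /g /V /v -mulrA -circD.
Qed.

(** The exceptional sets for radii p n increasing to 1 form a nondecreasing sequence, and the bound,
    independent of n, passes to their union. They are open up to the intersection with [0, 2 pi],
    whence measurability. *)
Lemma weak_type_disk h (p0 d l : R) : hol h -> p0 < 1 -> 0 < l ->
  (forall p, p0 <= p -> 0 < p -> p < 1 -> ravg (fun t => modulus (h (p%:C%C * circ t))) <= d) ->
  exists B : set R, [/\ measurable B, (mu B <= (36 * pi * d / l)%:E)%E &
    forall t, 0 <= t <= 2 * pi ->
      (exists r, [/\ 0 <= r, r < 1 & l < modulus (h (r%:C%C * circ t))]) -> B t].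
Proof.
move=> hh p01 l0 hd.
pose q := Num.max p0 0.
have q1 : q < 1 by rewrite gt_max p01 ltr01.
have q0 : 0 <= q by rewrite le_max lexx orbT.
have qp : p0 <= q by rewrite le_max lexx.
pose p n : R := 1 - (1 - q) * n.+2%:R^-1.
have iv n : 0 < n.+2%:R^-1 :> R by rewrite invr_gt0.
have iv1 n : n.+2%:R^-1 < 1 :> R by rewrite invf_lt1// ltr1n.
have qn n : q < p n.
  have : (1 - q) * n.+2%:R^-1 < 1 - q by rewrite gtr_pMr// subr_gt0.
  by rewrite /p; set x := (1 - q) * _; lra.
have p_gt0 n : 0 < p n by exact: le_lt_trans (qn n).
have p_lt1 n : p n < 1 by rewrite /p ltrBlDr ltrDl mulr_gt0// subr_gt0.
have p_nd m n : (m <= n)%N -> p m <= p n.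
  move=> mn; rewrite /p lerD2l lerN2 ler_pM2l ?subr_gt0// lef_pV2 ?posrE//.
  by rewrite ler_nat !ltnS.
pose U n : set R := [set t | exists r, [/\ 0 <= r, r < 1 & l < modulus (h ((r * p n)%:C%C * circ t))]].
pose I : set R := [set` `[0, 2 * pi]].
have oU n : open (U n).
  rewrite openE => t [r [r0 r1 lr]]; rewrite /interior.
  have rp0 : 0 <= r * p n by rewrite mulr_ge0// ltW.
  have rp1 : r * p n < 1.
    apply: le_lt_trans (p_lt1 n); rewrite ler_piMl ?(ltW (p_gt0 n))// ltW//.
  have := pcont_modulus (hol_circle hh rp0 rp1 (a := t) (b := t)).
  move=> /(_ t); rewrite lexx => /(_ isT) /cvgr_gt /(_ l lr).
  by apply: filterS => s ls; exists r.
have mU n : measurable (U n `&` I).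
  by apply: measurableI; [exact: open_measurable|exact: measurable_itv].
have bU n : (mu (U n `&` I) <= (36 * pi * d / l)%:E)%E.
  have [|B [mB Bd UB]] := @weak_type_circle h (p n) d l hh (p_gt0 n) (p_lt1 n) l0.
    by apply: hd => //; apply: le_trans qp (ltW (qn n)).
  apply: le_trans Bd; apply: le_measure; rewrite ?inE//; first exact: mU.
  by move=> t [Ut]; rewrite /I /= in_itv /= => tI; exact: UB.
have ndU : nondecreasing_seq (fun n => U n `&` I).
  move=> m n mn; apply/subsetPset => t [[r [r0 r1 lr]] It]; split => //.
  exists (r * (p m / p n)); have pp : p m / p n <= 1 by rewrite ler_pdivrMr// mul1r p_nd.
  have pp0 : 0 <= p m / p n by rewrite divr_ge0// ltW.
  split; first by rewrite mulr_ge0.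
    by apply: le_lt_trans r1; rewrite ler_piMr.
  by rewrite -mulrA divfK// gt_eqF.
have mb : measurable (\bigcup_n (U n `&` I)) by exact: bigcupT_measurable.
have cvgU := @nondecreasing_cvg_mu _ _ _ mu _ mU mb ndU.
exists (\bigcup_n (U n `&` I)); split => //.
- rewrite -(cvg_lim _ cvgU)//; apply: lime_le.
    by apply/cvg_ex; eexists; exact: cvgU.
  by apply: nearW => n; exact: bU.
- move=> t tI [r [r0 r1 lr]].
  have e0 : 0 < (1 - r) / 2 by rewrite divr_gt0// subr_gt0.
  have [N HN] := archi_lt e0.
  have rpN : r < p N.
    have /ltW H : N.+2%:R^-1 < (1 - r) / 2 :> R by exact: HN.
    have : (1 - q) * N.+2%:R^-1 <= 1 * N.+2%:R^-1 by rewrite ler_wpM2r ?(ltW (iv N))//; lra.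
    by rewrite /p; move: H; set x := (1 - q) * _; set y := N.+2%:R^-1; lra.
  exists N => //; split; last by rewrite /I /= in_itv.
  exists (r / p N); split; [by rewrite divr_ge0// ltW|by rewrite ltr_pdivrMr// mul1r|].
  by rewrite divfK// gt_eqF.
Qed.

End weak_type.


(** * Square means without power series *)

Section square_means.
Variable R : realType.
Local Notation C := R[i].
Implicit Types (r s t : R) (h k f : C -> C).

Lemma real_complexV (x y : R) : (x / y)%:C%C = x%:C%C / y%:C%C :> C.
Proof. by rewrite rmorphM fmorphV. Qed.

Definition sqmean k r := ravg (fun t => modulus (k (r%:C%C * circ t)) ^+ 2).

Lemma rcont_sqr a b (u : R -> R) : rcont a b u -> rcont a b (fun t => u t ^+ 2).
Proof.
move=> cu t tab; have -> : (fun t => u t ^+ 2) = fun t => u t * u t by apply/funext => s; rewrite expr2.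
by apply: continuousM; exact: cu.
Qed.

(* The integrand is the restriction to |z| = p of the function
   k(z) conj(k(conj(s^2 p^2 / z))), holomorphic on s p <= |z| <= p. *)
Lemma sqmean_cross k (p s : R) : hol k -> 0 < p -> p < 1 -> 0 < s -> s <= 1 ->
  cavg (fun t => k (p%:C%C * circ t) * (k ((s ^+ 2 * p)%:C%C * circ t))^*%C)
  = (sqmean k (s * p))%:C%C.
Proof.
move=> hk p0 p1 s0 s1; have sp0 : 0 < s * p by rewrite mulr_gt0.
pose q := s ^+ 2 * p ^+ 2.
have q0 : 0 < q by rewrite mulr_gt0// exprn_gt0.
pose A (z : C) := k z * (k ((q%:C%C / z)^*%C))^*%C.
have dA z : s * p <= modulus z <= p -> cder A z.
  move=> /andP[z1 z2]; have z0 : 0 < modulus z by exact: lt_le_trans z1.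
  apply: cderM; first by apply: hk; rewrite diskE (le_lt_trans z2).
  apply: (cder_comp (f := fun z => q%:C%C / z) (g := fun w => (k (w^*)%C)^*%C)).
    apply: cderM; first exact: cder_cst.
    by apply: (cderV (f := id)); [rewrite -modulus_gt0|exact: cder_id].
  apply: cder_conj; apply: hk.
  rewrite diskE modulusJ modulusM modulusV (modulus_ge0_real (ltW q0)) ltr_pdivrMr// mul1r.
  have H : q < s * p.
    rewrite /q -exprMn expr2 gtr_pMl//.
    by apply: le_lt_trans p1; rewrite ler_piMl// ltW.
  exact: lt_le_trans z1.
have sp1 : s * p <= p by rewrite ler_piMl// ltW.
have H := cmean_ring sp0 sp1 dA.
transitivity (cmean A p).
  apply: eq_cavg => t; rewrite /A; congr (_ * (k _)^*%C).
  rewrite invfM mulrA circV conjM conjcK; congr (_ * _).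
  by rewrite -real_complexV conjc_real; congr (_%:C)%C; rewrite /q; field; rewrite gt_eqF.
rewrite -H /cmean.
transitivity (cavg (fun t => (modulus (k ((s * p)%:C%C * circ t)) ^+ 2)%:C%C)).
  apply: eq_cavg => t; rewrite /A -mulcJ; congr (_ * (k _)^*%C).
  rewrite invfM mulrA circV conjM conjcK; congr (_ * _).
  by rewrite -real_complexV conjc_real; congr (_%:C)%C; rewrite /q; field; rewrite !gt_eqF.
rewrite /cavg /sqmean /ravg; apply: complexP; rewrite ?creM ?cimM /=.
  by rewrite mul0r subr0.
by rewrite mul0r addr0 /rint /= /Rintegral integral0 mulr0.
Qed.

Lemma sqr_modulusB (z w : C) :
  modulus (z - w) ^+ 2 = modulus z ^+ 2 + modulus w ^+ 2 - 2 * complex.Re (z * w^*%C).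
Proof. by rewrite !modulusE; case: z => a b; case: w => c d /=; ring. Qed.

(** The radii p, s p, s^2 p are in geometric progression: the cross term of the expanded square is
    the square mean at the middle radius, by [sqmean_cross]. *)
Lemma sqmean_diff k (p s : R) : hol k -> 0 < p -> p < 1 -> 0 < s -> s <= 1 ->
  ravg (fun t => modulus (k (p%:C%C * circ t) - k ((s ^+ 2 * p)%:C%C * circ t)) ^+ 2)
  = sqmean k p + sqmean k (s ^+ 2 * p) - 2 * sqmean k (s * p).
Proof.
move=> hk p0 p1 s0 s1.
have s2p : s ^+ 2 * p < 1.
  by apply: le_lt_trans p1; rewrite ler_piMl ?(ltW p0)// expr_le1// ltW.
have c1 : pcont 0 (2 * pi) (fun t => k (p%:C%C * circ t)) by apply: hol_circle => //; exact: ltW.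
have c2 : pcont 0 (2 * pi) (fun t => k ((s ^+ 2 * p)%:C%C * circ t)).
  by apply: hol_circle => //; rewrite mulr_ge0 ?sqr_ge0// ltW.
have c3 := pcont_Re (pcontM c1 (pcontJ c2)).
have q1 := rcont_sqr (pcont_modulus c1); have q2 := rcont_sqr (pcont_modulus c2).
have E := congr1 (@complex.Re _) (sqmean_cross hk p0 p1 s0 s1).
rewrite Re_cavg [RHS]/= in E.
rewrite -E /sqmean -ravgD// -ravgZ// -ravgB; first last.
- by move=> t tt; apply: continuousM; [exact: cst_continuous|exact: c3].
- by move=> t tt; apply: continuousD; [exact: q1|exact: q2].
by apply: eq_ravg => t; rewrite sqr_modulusB.
Qed.

(** By [sqmean_diff] the square means along a geometric progression of radii form a convex sequence.
    A strict increase towards the centre would persist with increments at least as large and exceed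
    the bound [A]. *)
Lemma sqmean_nondecreasing k (A p q : R) : hol k -> (forall r, 0 < r -> r < 1 -> sqmean k r <= A) ->
  0 < p -> p <= q -> q < 1 -> sqmean k p <= sqmean k q.
Proof.
move=> hk kA p0 pq q1; have q0 : 0 < q by exact: lt_le_trans pq.
rewrite leNgt; apply/negP => lt_qp.
pose s := p / q.
have s0 : 0 < s by rewrite divr_gt0.
have s1 : s <= 1 by rewrite ler_pdivrMr// mul1r.
pose a n := sqmean k (s ^+ n * q).
have r0 n : 0 < s ^+ n * q by rewrite mulr_gt0// exprn_gt0.
have r1 n : s ^+ n * q < 1.
  by apply: le_lt_trans q1; rewrite ler_piMl ?(ltW q0)// exprn_ile1// ltW.
pose d := sqmean k p - sqmean k q.
have d0 : 0 < d by rewrite subr_gt0.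
have conv n : a n.+1 - a n <= a n.+2 - a n.+1.
  have := sqmean_diff hk (r0 n) (r1 n) s0 s1.
  have -> : s ^+ 2 * (s ^+ n * q) = s ^+ n.+2 * q by rewrite mulrA -exprD.
  have -> : s * (s ^+ n * q) = s ^+ n.+1 * q by rewrite mulrA -exprS.
  rewrite -/(a n) -/(a n.+1) -/(a n.+2) => H.
  have : 0 <= a n + a n.+2 - 2 * a n.+1 by rewrite -H; apply: ravg_ge0 => t; exact: sqr_ge0.
  lra.
have dn n : d <= a n.+1 - a n.
  elim: n => [|n IH]; last exact: le_trans IH (conv n).
  by rewrite /a expr0 mul1r expr1 /s divfK// gt_eqF.
have an n : n%:R * d <= a n.
  elim: n => [|n IH].
    by rewrite mul0r; apply: ravg_ge0 => t; exact: sqr_ge0.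
  have := dn n; rewrite -natr1 mulrDl mul1r; lra.
have [N HN] : exists n : nat, A / d < n%:R.
  exists (Num.trunc `|A / d|).+1; apply: le_lt_trans (ler_norm _) _; exact: truncnS_gt.
have := le_trans (an N) (kA _ (r0 N) (r1 N)).
by apply/negP; rewrite -ltNge -ltr_pdivrMr.
Qed.

(** Beyond some radius r all square means are within e / 2 of their supremum. With the fourth root
    of r as ratio and p at least the square root of r, the three radii of [sqmean_diff] stay beyond
    r, so the second difference is at most e. *)
Lemma sqmean_dilation k (A e : R) : hol k -> (forall r, 0 < r -> r < 1 -> sqmean k r <= A) -> 0 < e ->
  exists s q : R, [/\ 0 < s, s < 1, q < 1 & forall p, q <= p -> 0 < p -> p < 1 ->
    ravg (fun t => modulus (k (p%:C%C * circ t) - k ((s * p)%:C%C * circ t)) ^+ 2) <= e].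
Proof.
move=> hk kA e0.
pose S := [set sqmean k r | r in [set r | 0 < r /\ r < 1]].
have hS : has_sup S.
  split; first by exists (sqmean k (1 / 2)); exists (1 / 2) => //; split; lra.
  by exists A => _ [r [r0 r1] <-]; exact: kA.
have [_ [r [r0 r1] <-] Hr] := sup_adherent (divr_gt0 e0 (ltr0Sn R 1)) hS.
have up p : 0 < p -> p < 1 -> sqmean k p <= sup S.
  by move=> p0 p1; apply: sup_upper_bound => //; exists p.
pose s := Num.sqrt (Num.sqrt r).
have sr0 : 0 < Num.sqrt r by rewrite sqrtr_gt0.
have s0 : 0 < s by rewrite sqrtr_gt0.
have s2 : s ^+ 2 = Num.sqrt r by rewrite sqr_sqrtr// ltW.
have s4 : Num.sqrt r ^+ 2 = r by rewrite sqr_sqrtr// ltW.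
have sr1 : Num.sqrt r < 1 by rewrite -sqrtr1 ltr_sqrt.
have s1 : s < 1 by rewrite -sqrtr1 ltr_sqrt.
exists (s ^+ 2), (Num.sqrt r); rewrite s2; split => // p qp p0 p1.
have := sqmean_diff hk p0 p1 s0 (ltW s1); rewrite s2 => ->.
have H1 : r <= Num.sqrt r * p by rewrite -{1}s4 expr2 ler_pM2l.
have lo x : r <= x -> x < 1 -> sup S - e / 2 <= sqmean k x.
  by move=> rx x1; apply: le_trans (ltW Hr) _; exact: (sqmean_nondecreasing hk kA).
have H2 : Num.sqrt r * p <= s * p.
  by rewrite ler_pM2r// -s2 expr2 ler_piMr// ltW.
have H3 : s * p < 1.
  by apply: lt_trans p1; rewrite gtr_pMl.
have := up p p0 p1.
have H4 : Num.sqrt r * p < 1 by exact: le_lt_trans H3.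
have := up _ (lt_le_trans r0 H1) H4.
have := lo (s * p) (le_trans H1 H2) H3.
lra.
Qed.

End square_means.

Section radial_limits.
Variable R : realType.
Local Notation C := R[i].
Local Notation mu := (@lebesgue_measure R).
Implicit Types (r s t : R) (h k f : C -> C).

Definition radial_limit f t l := forall e : R, 0 < e -> exists2 d : R, 0 < d &
  forall r, 0 <= r -> 1 - d < r -> r < 1 -> modulus (f (r%:C%C * circ t) - l) < e.

Definition radial_cvg f t := exists l, radial_limit f t l.

Lemma radial_cauchy f t :
  (forall n : nat, exists2 d : R, 0 < d & forall r s, 0 <= r -> 0 <= s -> 1 - d < r -> r < 1 ->
     1 - d < s -> s < 1 -> modulus (f (r%:C%C * circ t) - f (s%:C%C * circ t)) <= n.+1%:R^-1) ->
  radial_cvg f t.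
Proof.
move=> H.
pose r n : R := 1 - n.+2%:R^-1.
have r0 n : 0 < r n by have [] := one_sub_invS R n.
have r1 n : r n < 1 by have [] := one_sub_invS R n.
have rd (d : R) : 0 < d -> exists N, forall n, (N <= n)%N -> 1 - d < r n.
  move=> d0; have [N HN] := archi_lt d0; exists N => n Nn.
  by rewrite /r ltrD2l ltrN2; apply: (HN n.+1); exact: leqW.
have [d0 d00 Hd0] := H 0%N.
have [N0 HN0] := rd _ d00.
have [U [UU Uf]] := free_ultrafilter.
pose u n := f ((r (N0 + n)%N)%:C%C * circ t).
have [l Hl] : exists l, forall e, 0 < e -> U [set n | modulus (u n - l) < e].
  apply: (@ulim_complex _ U UU u (modulus (u 0%N) + 1)) => n.
  rewrite -{1}[u n](subrK (u 0%N)) addrC; apply: le_trans (modulusD _ _) _; rewrite lerD2l.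
  apply: le_trans (Hd0 _ _ (ltW (r0 _)) (ltW (r0 _)) _ (r1 _) _ (r1 _)) _.
  - by apply: HN0; exact: leq_addr.
  - by apply: HN0; exact: leq_addr.
  - by rewrite invr1.
exists l => e e0; have e20 : 0 < e / 2 by rewrite divr_gt0.
have [m Hm] := archi_lt e20; have [d dd0 Hd] := H m.
have [N HN] := rd _ dd0.
exists d => // s s0 sd s1.
have [n [/= n1 n2]] := ultra_ex UU (filterI (Hl _ e20) (ultra_ge Uf N)).
rewrite -[f _](subrK (u n)) -addrA.
apply: le_lt_trans (modulusD _ _) _; rewrite [ltRHS](splitr e); apply: ler_ltD => //.
apply: le_trans (ltW (Hm m (leqnn _))); apply: Hd => //; first exact: ltW.
by apply: HN; rewrite (leq_trans n2)// leq_addl.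
Qed.

(** [k] differs from the dilate k(s z), continuous up to the circle, by a function [h] with small
    means. The oscillation of [k] near the circle then exceeds l only where |h| exceeds l / 3 on the
    radius, and the weak type bound makes this set as small as desired. *)
Lemma radial_limit_ae_sq k (A : R) : hol k -> (forall r, 0 < r -> r < 1 -> sqmean k r <= A) ->
  mu.-negligible [set t | 0 <= t <= 2 * pi /\ ~ radial_cvg k t].
Proof.
move=> hk kA.
have pi0 : 0 < pi :> R by exact: pi_gt0.
pose osc (l : R) := [set t | 0 <= t <= 2 * pi /\ ~ exists2 d : R, 0 < d &
  forall r s, 0 <= r -> 0 <= s -> 1 - d < r -> r < 1 ->
     1 - d < s -> s < 1 -> modulus (k (r%:C%C * circ t) - k (s%:C%C * circ t)) <= l].
have small (l e : R) : 0 < l -> 0 < e -> exists B : set R, [/\ measurable B, (mu B <= e%:E)%E & osc l `<=` B].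
  move=> l0 e0.
  have l30 : 0 < l / 3 by rewrite divr_gt0.
  (* Solves 36 pi e' / (l / 3) = e, the bound of [weak_type_disk] at level l / 3. *)
  pose e' := e * (l / 3) / (36 * pi).
  have c0 : 0 < 36 * pi :> R by rewrite mulr_gt0.
  have e'0 : 0 < e' by rewrite divr_gt0// mulr_gt0.
  have [s [q [s0 s1 q1 Hq]]] := sqmean_dilation hk kA (exprn_gt0 2 e'0).
  pose h z := k z - k (s%:C%C * z).
  have hs z : disk z -> disk (s%:C%C * z).
    rewrite !diskE modulusM (modulus_ge0_real (ltW s0)) => z1.
    by apply: le_lt_trans z1; rewrite ler_piMl ?modulus_ge0// ltW.
  have hh : hol h.
    move=> z dz; apply: cderB; first exact: hk.
    apply: (cder_comp (f := fun z => s%:C%C * z) (g := k)); last exact/hk/hs.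
    by apply: cderM; [exact: cder_cst|exact: cder_id].
  have [|B [mB Be HB]] := @weak_type_disk _ h q e' (l / 3) hh q1 l30.
    move=> p qp p0 p1.
    have ch : rcont 0 (2 * pi) (fun t => modulus (h (p%:C%C * circ t))).
      by apply: pcont_modulus; apply: hol_circle => //; exact: ltW.
    have H := Hq p qp p0 p1.
    (* 2 e' |h| <= |h|^2 + e'^2 turns the bound e'^2 on the square mean into the bound e' on the
       mean. *)
    have : ravg (fun t => (2 * e') * modulus (h (p%:C%C * circ t))) <= ravg (fun t => modulus (h (p%:C%C * circ t)) ^+ 2 + e' ^+ 2).
      apply: ravg_le => [||t _].
      - by move=> t tt; apply: continuousM; [exact: cst_continuous|exact: ch].
      - by move=> t tt; apply: continuousD; [exact: (rcont_sqr ch)|exact: cst_continuous].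
      - have := sqr_ge0 (modulus (h (p%:C%C * circ t)) - e'); rewrite sqrrB; lra.
    rewrite ravgZ// ravgD; [|exact: rcont_sqr|by move=> t _; exact: cst_continuous].
    rewrite ravg_cst.
    have -> : ravg (fun t => modulus (h (p%:C%C * circ t)) ^+ 2) =
      ravg (fun t => modulus (k (p%:C%C * circ t) - k ((s * p)%:C%C * circ t)) ^+ 2).
      by apply: eq_ravg => t; rewrite /h mulrA -rmorphM.
    move=> H2; have e'2 : 0 < 2 * e' by exact: mulr_gt0.
    rewrite -(ler_pM2l e'2).
    apply: le_trans H2 _; have -> : 2 * e' * e' = e' ^+ 2 + e' ^+ 2 by ring.
    by rewrite lerD2r.
  exists B; split => //.
    apply: le_trans Be _; rewrite lee_fin /e'.
    rewrite le_eqVlt; apply/orP; left; apply/eqP.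
    by rewrite (mulrC (36 * pi)) divfK ?gt_eqF// mulfK// gt_eqF.
  move=> t [tI nC]; apply: HB => //; apply: contrapT => nex; apply: nC.
  have hl r : 0 <= r -> r < 1 -> modulus (h (r%:C%C * circ t)) <= l / 3.
    by move=> r0 r1; rewrite leNgt; apply/negP => lr; apply: nex; exists r.
  have ds : disk (s%:C%C * circ t) by rewrite diskE modulus_polar// ltW.
  have l60 : 0 < l / 3 / 2 by rewrite divr_gt0.
  have [d d0 Hd] := cder_ccont (hk _ ds) l60.
  exists d => // r r' r0 r'0 rd r1 r'd r'1.
  have Hs x : 0 <= x -> 1 - d < x -> x < 1 -> modulus (k (s%:C%C * (x%:C%C * circ t)) - k (s%:C%C * circ t)) < l / 3 / 2.
    move=> x0 xd x1; apply: Hd; rewrite mulrA -mulrBl modulusM modulus_circ mulr1.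
    rewrite -rmorphM -rmorphB /= modulus_real distrC ger0_norm.
      by apply: (@le_lt_trans _ _ (1 - x)); [have : s * (1 - x) <= 1 * (1 - x) by rewrite ler_wpM2r ?subr_ge0 ?ltW|]; lra.
    by rewrite subr_ge0 ler_piMr// ltW.
  have -> : k (r%:C%C * circ t) - k (r'%:C%C * circ t) = h (r%:C%C * circ t) - h (r'%:C%C * circ t) +
    ((k (s%:C%C * (r%:C%C * circ t)) - k (s%:C%C * circ t)) - (k (s%:C%C * (r'%:C%C * circ t)) - k (s%:C%C * circ t))).
    by rewrite /h; ring.
  apply: le_trans (modulusD _ _) _.
  have := modulusB (h (r%:C%C * circ t)) (h (r'%:C%C * circ t)).
  have := modulusB (k (s%:C%C * (r%:C%C * circ t)) - k (s%:C%C * circ t)) (k (s%:C%C * (r'%:C%C * circ t)) - k (s%:C%C * circ t)).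
  have := hl _ r0 r1; have := hl _ r'0 r'1.
  have := Hs _ r0 rd r1; have := Hs _ r'0 r'd r'1.
  lra.
have nosc (l : R) : 0 < l -> mu.-negligible (osc l).
  move=> l0; have /choice[B HB] : forall n : nat, exists B : set R, [/\ measurable B, (mu B <= (n.+1%:R^-1)%:E)%E & osc l `<=` B].
    by move=> n; apply: small => //; rewrite invr_gt0.
  exists (\bigcap_n B n); split.
  - by apply: bigcapT_measurable => n; have [] := HB n.
  - apply/eqP; rewrite eq_le measure_ge0 andbT; apply/lee_addgt0Pr => e e0; rewrite add0e.
    have [N HN] := archi_lt e0; have [mB Be _] := HB N.
    apply: (@le_trans _ _ (mu (B N))).
      apply: le_measure; rewrite ?inE//; last exact: bigcap_inf.
      by apply: bigcapT_measurable => n; have [] := HB n.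
    by apply: le_trans Be _; rewrite lee_fin ltW// HN.
  - by move=> t Ht n _; have [_ _] := HB n; exact.
apply: (@negligibleS _ _ _ mu (\bigcup_n osc n.+1%:R^-1)).
  move=> t [tI nC]; apply: contrapT => nb; apply: nC; apply: radial_cauchy => n.
  by apply: contrapT => ne; apply: nb; exists n.
by apply: negligible_bigcup => n; apply: nosc; rewrite invr_gt0.
Qed.

End radial_limits.


Section square_root.
Variable R : realType.
Local Notation C := R[i].
Implicit Types (z h : C).

Lemma Re_sqrtc_gt0 z : 0 < complex.Re z -> 0 < complex.Re (sqrtc z).
Proof.
case: z => a b /= a0; rewrite sqrtr_gt0 divr_gt0//.
by rewrite ltr_wpDl// sqrtr_ge0.
Qed.

Lemma Im_sqrtc_le z : 0 < complex.Re z -> `|complex.Im (sqrtc z)| <= complex.Re (sqrtc z).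
Proof.
move=> z0; have s0 := Re_sqrtc_gt0 z0.
have := congr1 (@complex.Re _) (sqr_sqrtc z); rewrite expr2 creM => E.
rewrite -(@ler_pXn2r _ 2) ?nnegrE ?(ltW s0)// real_normK ?num_real// !expr2.
by move: z0; rewrite -E subr_gt0 => /ltW.
Qed.

(** The root stays in the right half-plane, so in h = (s' - s) (s' + s) the second factor is bounded
    below by Re s. *)
Lemma cder_sqrtc z : 0 < complex.Re z -> cder (@sqrtc R) z.
Proof.
move=> z0; have s0 := Re_sqrtc_gt0 z0; set s := sqrtc z in s0 *.
have sn : s != 0 by apply: contraTneq s0 => ->; rewrite ltxx.
have ms : 0 < modulus s by rewrite modulus_gt0.
exists (2 * s)^-1 => e e0.
pose K := complex.Re s ^+ 2 * modulus (2 * s).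
have m2s : 0 < modulus (2 * s) by rewrite modulus_gt0 mulf_neq0.
have K0 : 0 < K by rewrite mulr_gt0// exprn_gt0.
exists (Num.min (complex.Re z) (e * K)); first by rewrite lt_min z0 mulr_gt0.
move=> h; rewrite lt_min => /andP[h1 h2].
have zh : 0 < complex.Re (z + h).
  by rewrite creD; have := le_lt_trans (Re_le_modulus h) h1; rewrite ltr_norml => /andP[? _]; lra.
have s'0 := Re_sqrtc_gt0 zh; set s' := sqrtc (z + h) in s'0 *.
have E1 : s ^+ 2 = z by exact: sqr_sqrtc.
have E2 : s' ^+ 2 = z + h by exact: sqr_sqrtc.
have hE : h = (s' - s) * (s' + s) by rewrite -subr_sqr E1 E2 addrAC subrr add0r.
have ss : complex.Re s <= modulus (s' + s).
  apply: le_trans (Re_le_modulus _); apply: le_trans (ler_norm _); rewrite creD; lra.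
have D : complex.Re s * modulus (s' - s) <= modulus h.
  by rewrite hE modulusM mulrC ler_wpM2l ?modulus_ge0.
have -> : s' - s - (2 * s)^-1 * h = - ((s' - s) ^+ 2 / (2 * s)).
  by rewrite {1}hE; field.
rewrite modulusN modulusM modulusV modulusX ler_pdivrMr//.
have D2 : (complex.Re s * modulus (s' - s)) ^+ 2 <= modulus h ^+ 2.
  by rewrite ler_pXn2r// nnegrE ?modulus_ge0// mulr_ge0 ?modulus_ge0// ltW.
rewrite -(@ler_pM2l _ (complex.Re s ^+ 2)) ?exprn_gt0// -exprMn.
apply: le_trans D2 _; rewrite expr2.
have -> : complex.Re s ^+ 2 * (e * modulus h * modulus (2 * s)) = e * K * modulus h by rewrite /K; ring.
by rewrite ler_wpM2r ?modulus_ge0// ltW.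
Qed.

End square_root.

Section fatou_radial_limit.
Variable R : realType.
Local Notation C := R[i].
Local Notation mu := (@lebesgue_measure R).
Implicit Types (r s t : R) (h k f : C -> C).

Lemma radial_limitD f h t l m : radial_limit f t l -> radial_limit h t m ->
  radial_limit (fun z => f z + h z) t (l + m).
Proof.
move=> fl hm e e0; have e20 : 0 < e / 2 by rewrite divr_gt0.
have [d d0 Hd] := fl _ e20; have [d' d'0 Hd'] := hm _ e20.
exists (Num.min d d'); first by rewrite lt_min d0.
move=> r r0 rd r1; rewrite opprD addrACA; apply: le_lt_trans (modulusD _ _) _.
have m1 : Num.min d d' <= d by rewrite ge_min lexx.
have m2 : Num.min d d' <= d' by rewrite ge_min lexx orbT.
by rewrite [ltRHS](splitr e); apply: ltrD; [apply: Hd|apply: Hd'] => //; lra.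
Qed.

Lemma radial_limitM f h t l m : radial_limit f t l -> radial_limit h t m ->
  radial_limit (fun z => f z * h z) t (l * m).
Proof.
move=> fl hm e e0.
pose A := modulus l + 1; pose B := modulus m + 1.
have A0 : 0 < A by rewrite ltr_pwDr ?modulus_ge0.
have B0 : 0 < B by rewrite ltr_pwDr ?modulus_ge0.
have e20 : 0 < e / 2 by rewrite divr_gt0.
have [d d0 Hd] := fl _ (divr_gt0 e20 B0).
have [d' d'0 Hd'] := hm _ (divr_gt0 e20 A0).
have [d'' d''0 Hd''] := hm _ ltr01.
exists (Num.min d (Num.min d' d'')); first by rewrite !lt_min d0 d'0.
move=> r r0; rewrite ltrBlDr -ltrBlDl !lt_min => /andP[rd /andP[rd' rd'']] r1.
set x := f _; set y := h _.
have -> : x * y - l * m = (x - l) * y + l * (y - m) by ring.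
apply: le_lt_trans (modulusD _ _) _; rewrite !modulusM.
have yB : modulus y <= B.
  rewrite -[y](subrK m) addrC; apply: le_trans (modulusD _ _) _.
  by rewrite lerD2l; apply: ltW; apply: Hd'' => //; lra.
have H1 : modulus (x - l) < e / 2 / B by apply: Hd => //; lra.
have H2 : modulus (y - m) < e / 2 / A by apply: Hd' => //; lra.
rewrite [ltRHS](splitr e); apply: ltr_leD.
  apply: (@le_lt_trans _ _ (modulus (x - l) * B)); first by rewrite ler_wpM2l ?modulus_ge0.
  by rewrite -ltr_pdivlMr.
apply: (@le_trans _ _ (A * (e / 2 / A))); last by rewrite mulrC divfK// gt_eqF.
by apply: ler_pM; rewrite ?modulus_ge0 ?lerDl// ltW.
Qed.

Lemma radial_limit_cst c t : radial_limit (fun=> c) t c.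
Proof. by move=> e e0; exists 1 => // r *; rewrite subrr modulus0. Qed.

(* The square root of [G] has argument at most pi/4, so its modulus, the square
   of that of the fourth root [k], has bounded means. *)
Lemma radial_limit_ae_Re_gt0 G : hol G -> (forall z, disk z -> 0 < complex.Re (G z)) ->
  mu.-negligible [set t | 0 <= t <= 2 * pi /\ ~ radial_cvg G t].
Proof.
move=> hG G0.
pose s z := sqrtc (G z); pose k z := sqrtc (s z).
have s0 z : disk z -> 0 < complex.Re (s z) by move=> /G0/Re_sqrtc_gt0.
have hs : hol s.
  move=> z dz; apply: (cder_comp (f := G) (g := @sqrtc R)); first exact: hG.
  exact/cder_sqrtc/G0.
have hk : hol k.
  move=> z dz; apply: (cder_comp (f := s) (g := @sqrtc R)); first exact: hs.
  exact/cder_sqrtc/s0.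
have kA r : 0 < r -> r < 1 -> sqmean k r <= 2 * complex.Re (s 0).
  move=> r0 r1.
  have cs : pcont 0 (2 * pi) (fun t => s (r%:C%C * circ t)) by apply: hol_circle => //; exact: ltW.
  have ck : pcont 0 (2 * pi) (fun t => k (r%:C%C * circ t)) by apply: hol_circle => //; exact: ltW.
  have <- : cmean s r = s 0.
    by apply: mean_value => // z zr; apply: hs; rewrite diskE (le_lt_trans zr).
  rewrite /cmean Re_cavg -ravgZ; last exact: pcont_Re.
  apply: ravg_le => [||t _].
  - exact/rcont_sqr/pcont_modulus.
  - by move=> t tt; apply: continuousM; [exact: cst_continuous|exact: (pcont_Re cs)].
  - have dz : disk (r%:C%C * circ t) by rewrite diskE modulus_polar// ltW.
    rewrite -modulusX sqr_sqrtc; apply: le_trans (modulus_le _) _.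
    have := Im_sqrtc_le (G0 _ dz); rewrite -/(s _) => H.
    by rewrite (ger0_norm (ltW (s0 _ dz))); lra.
apply: negligibleS (radial_limit_ae_sq hk kA) => t [tI nG]; split => // -[l kl].
apply: nG; exists (l * l * (l * l)) => e e0.
have kk := radial_limitM (radial_limitM kl kl) (radial_limitM kl kl).
have [d d0 Hd] := kk e e0; exists d => // r r0 rd r1.
have := Hd r r0 rd r1.
have -> : k (r%:C%C * circ t) * k (r%:C%C * circ t) = s (r%:C%C * circ t) by rewrite -expr2 sqr_sqrtc.
by rewrite -expr2 sqr_sqrtc.
Qed.

Lemma fatou_radial_limit f (M : R) : hol f -> mean_bounded f M ->
  mu.-negligible [set t | 0 <= t <= 2 * pi /\ ~ radial_cvg f t].
Proof.
move=> hf fM; have [G [hG Gf _]] := holomorphic_majorant hf fM.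
pose P z := 1 + G z; pose Q z := 1 + G z + f z.
have hP : hol P by move=> z dz; apply: cderD; [exact: cder_cst|exact: hG].
have hQ : hol Q by move=> z dz; apply: cderD; [exact: hP|exact: hf].
have P0 z : disk z -> 0 < complex.Re (P z).
  by move=> dz; rewrite creD /=; have := Gf z dz; have := modulus_ge0 (f z); lra.
have Q0 z : disk z -> 0 < complex.Re (Q z).
  move=> dz; rewrite !creD /=; have := Gf z dz.
  have := Re_le_modulus (f z); rewrite ler_norml => /andP[? _]; lra.
apply: negligibleS (negligibleU (radial_limit_ae_Re_gt0 hP P0) (radial_limit_ae_Re_gt0 hQ Q0)).
move=> t [tI nf]; apply: contrapT => /not_orP[nP nQ]; apply: nf.
have [p Hp] : radial_cvg P t by apply: contrapT => H; apply: nP.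
have [q Hq] : radial_cvg Q t by apply: contrapT => H; apply: nQ.
exists (q + -1 * p) => e e0.
have [d d0 Hd] := radial_limitD Hq (radial_limitM (radial_limit_cst (-1) t) Hp) e0.
exists d => // r r0 rd r1; have := Hd r r0 rd r1.
by rewrite /P /Q; set a := G _; set b := f _; have -> : 1 + a + b + -1 * (1 + a) = b by ring.
Qed.

End fatou_radial_limit.


(** * The symbol *)

Section trigonometry.
Variable R : realType.
Local Notation C := R[i].
Implicit Types (a b t x y : R).

Lemma lipschitz1_is_derive (f df : R -> R) : (forall x, is_derive x 1 f (df x)) ->
  (forall x, `|df x| <= 1) -> forall a b, `|f a - f b| <= `|a - b|.
Proof.
move=> Df df1 a b.
wlog ab : a b / a <= b => [H|].
  by case: (leP a b) => [/H//|/ltW /H]; rewrite distrC (distrC b).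
move: ab; rewrite le_eqVlt => /predU1P[->|ab]; first by rewrite !subrr.
have [|c _ E] := MVT ab (fun x _ => Df x).
  apply: continuous_subspaceT => x; apply: differentiable_continuous.
  by apply/derivable1_diffP; case: (Df x).
rewrite distrC E normrM (distrC a b) ler_piMl//.
Qed.

Lemma circ_lipschitz a b : modulus (circ a - circ b : C) <= 2 * `|a - b|.
Proof.
have H1 := @lipschitz1_is_derive cos (fun x => - sin x) (fun x => is_derive_cos x).
have H2 := @lipschitz1_is_derive sin cos (fun x => is_derive_sin x).
apply: le_trans (modulus_le _) _.
rewrite creD cimD creN cimN /circ /= mulr2n mulrDl mul1r lerD//.
  by apply: H1 => x; rewrite normrN sin_max.
by apply: H2 => x; exact: cos_max.
Qed.

Lemma circ_pi : circ pi = -1 :> C.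
Proof. by apply: complexP; rewrite /circ /= ?cospi ?sinpi ?oppr0. Qed.

Lemma circ_muln a n : circ (a * n%:R) = circ a ^+ n :> C.
Proof. by elim: n => [|n IH]; rewrite ?mulr0 ?circ0// exprS -IH -circD -(@natr1 R n) mulrDr mulr1 addrC. Qed.

Lemma circ_mulz_2pi (k : int) : circ (2 * pi * k%:~R) = 1 :> C.
Proof.
by case: k => n; rewrite ?NegzE ?mulrNz ?mulrN ?circN pmulrn circ_muln circ2pi expr1n ?conjc1.
Qed.

Lemma cos_lt1 t : 0 < t -> t < 2 * pi -> cos t < 1.
Proof.
move=> t0 t1; have : 0 < sin (t / 2) by apply: sin_gt0_pi; apply/andP; split; lra.
have := cos_mulr2n (t / 2); rewrite -[_ *+ 2](mulr_natr (t / 2)) divfK ?pnatr_eq0// cos2sin2 => -> s0.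
have : 0 < sin (t / 2) ^+ 2 by rewrite exprn_gt0.
by lra.
Qed.

Lemma cos_eq1 y : cos y = 1 -> exists k : int, y = 2 * pi * k%:~R.
Proof.
move=> cy; pose k := Num.floor (y / (2 * pi)); exists k.
have p0 := pi2_gt0 R.
have /andP[k1 k2] := floor_itv (y / (2 * pi)).
pose z := y - 2 * pi * k%:~R.
have z0 : 0 <= z by rewrite /z subr_ge0 mulrC -ler_pdivlMr.
have z1 : z < 2 * pi.
  by move: k2; rewrite intrD ltr_pdivrMr// mulrDl mul1r /z ltrBlDl (mulrC _ (k%:~R)).
have cz : circ z = circ y :> C by rewrite /z circD circN circ_mulz_2pi conjc1 mulr1.
have cosz : cos z = 1 by have := congr1 (@complex.Re _) cz; rewrite /circ /= cy.
apply/eqP; rewrite -subr_eq0 -/z eq_le z0 andbT leNgt; apply/negP => z0'.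
by have := cos_lt1 z0' z1; rewrite cosz ltxx.
Qed.

End trigonometry.

(** * A Liouville number with odd denominators *)

Section liouville.
Variables (R : realType) (E : nat -> nat).

(** An odd factor keeps the denominators odd; its size gives 2 / F D <= 1 / (E D + 1) for the
    approximation and 2 D < F D for the irrationality. *)
Let F D := ((E D + D).*2.+3)%N.

(* Numerators and denominators of the partial sums of sum_n 1 / D_n. *)
Fixpoint liouville_convergent n : nat * nat :=
  if n is n'.+1 then
    let PD := liouville_convergent n' in ((PD.1 * F PD.2).+1, PD.2 * F PD.2)%N
  else (1, 3)%N.

(** The number is the sum of the 1 / D_n. The upper bounds S_n + 1 / D_n decrease, so the tail after
    S_n is at most 2 / D_(n+1), and b D_n - P_n lies between 0 and 2 / F(D_n). If b were p / q,
    multiplying by q would give an integer strictly between 0 and 1. *)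
Lemma liouville : exists b : R, [/\ 0 < b, b <= 1,
  forall p q : int, q != 0 -> b * q%:~R != p%:~R &
  forall N, exists q p : nat, [/\ (N <= q)%N, odd q & `|b * q%:R - p%:R| <= (E q).+1%:R^-1]].
Proof.
pose P n := (liouville_convergent n).1; pose D n := (liouville_convergent n).2.
have D_odd n : odd (D n).
  by elim: n => // n IH; rewrite /D /= oddM IH /= odd_double.
have D_ge n : (n.+3 <= D n)%N.
  elim: n => // n IH; rewrite /D /= -/(D n) /F.
  apply: (@leq_trans (D n * 3)%N); last by rewrite leq_mul2l !ltnS orbT.
  by move: IH; set d := D n; lia.
have D0 n : 0 < (D n)%:R :> R by rewrite ltr0n; apply: leq_trans (D_ge n).
have F3 n : (3 <= F (D n))%N by [].
have F0 n : 0 < (F (D n))%:R :> R by rewrite ltr0n.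
pose S n : R := (P n)%:R / (D n)%:R.
have Srec n : S n.+1 = S n + (D n.+1)%:R^-1.
  rewrite /S /P /D /= -/(P n) -/(D n) -natr1 !natrM; field.
  by rewrite !pnatr_eq0 -!lt0n -!(ltr0n R) D0 F0.
have Drec n : (D n.+1)%:R = (D n)%:R * (F (D n))%:R :> R by rewrite /D /= natrM.
have Tdec n : S n.+1 + (D n.+1)%:R^-1 <= S n + (D n)%:R^-1.
  rewrite Srec -addrA lerD2l Drec invfM -mulr2n -mulrnAr ler_piMr ?invr_ge0 ?(ltW (D0 n))//.
  by rewrite -[_ *+ 2](mulr_natr _ 2) mulrC ler_pdivrMr// mul1r ler_nat; exact: leq_trans (F3 n).
have Tmono n m : (n <= m)%N -> S m + (D m)%:R^-1 <= S n + (D n)%:R^-1.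
  elim: m => [|m IH]; first by rewrite leqn0 => /eqP ->.
  rewrite leq_eqVlt => /predU1P[->//|]; rewrite ltnS => /IH; apply: le_trans; exact: Tdec.
have Smono n m : (n <= m)%N -> S n <= S m.
  elim: m => [|m IH]; first by rewrite leqn0 => /eqP ->.
  rewrite leq_eqVlt => /predU1P[->//|]; rewrite ltnS => /IH /le_trans; apply.
  by rewrite Srec lerDl invr_ge0 ltW.
have ST n m : S n <= S m + (D m)%:R^-1.
  have [nm|/ltnW mn] := leqP n m.
    by apply: le_trans (Smono _ _ nm) _; rewrite lerDl invr_ge0 ltW.
  by apply: le_trans (Tmono _ _ mn); rewrite lerDl invr_ge0 ltW.
pose b := sup (range S).
have hS : has_sup (range S).
  by split; [exists (S 0%N), 0%N|exists (S 0%N + (D 0%N)%:R^-1) => _ [n _ <-]; exact: ST].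
have Sb n : S n <= b by apply: sup_upper_bound => //; exists n.
have bT n : b <= S n + (D n)%:R^-1.
  by apply: ge_sup; [exists (S 0%N), 0%N|move=> _ [m _ <-]; exact: ST].
have gap n : 0 < b * (D n)%:R - (P n)%:R <= 2 / (F (D n))%:R.
  have := bT n.+1; rewrite Srec -addrA => H1.
  have H0 : S n < b by apply: lt_le_trans (Sb n.+1); rewrite Srec ltrDl invr_gt0.
  have PE : (P n)%:R = S n * (D n)%:R by rewrite /S divfK// gt_eqF.
  rewrite PE -mulrBl mulr_gt0 ?subr_gt0//= -ler_pdivlMr//.
  rewrite lerBlDl; apply: le_trans H1 _; rewrite lerD2l Drec invfM.
  by rewrite -mulr2n -[_ *+ 2](mulr_natl _ 2) mulrA mulrAC.
exists b; split.
- by apply: lt_le_trans (Sb 0%N); rewrite /S /P /D /= divr_gt0.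
- apply: le_trans (bT 0%N) _; rewrite /S /P /D /=; lra.
- move=> p q q0; wlog qpos : p q q0 / 0 < q => [H|].
    have [|q0'] := ltP 0 q; first exact: H.
    have := H (- p) (- q); rewrite oppr_eq0 oppr_gt0 lt_neqAle q0 q0' => /(_ erefl erefl).
    by rewrite !intrN mulrN eqr_opp.
  (* The index n = |q| is large enough, since D_n >= n + 3 gives F(D_n) > 2 q. *)
  apply/eqP => bq; pose n := `|q|%N.
  have qn : q = n%:Z by rewrite /n gez0_abs// ltW.
  have /andP[g1 g2] := gap n.
  pose k : int := p * (D n)%:Z - q * (P n)%:Z.
  have kE : k%:~R = q%:~R * (b * (D n)%:R - (P n)%:R) :> R.
    by rewrite /k intrB !intrM -bq -!pmulrn; ring.
  have q0R : 0 < q%:~R :> R by rewrite ltr0z.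
  have k0 : 0 < k by rewrite -(ltr0z R) kE mulr_gt0.
  have : k%:~R < 1%:~R :> R.
    rewrite kE; apply: le_lt_trans (ler_wpM2l (ltW q0R) g2) _.
    rewrite mulrA ltr_pdivrMr// qn -pmulrn -natrM mul1r ltr_nat.
    have := D_ge n; rewrite /F; lia.
  by rewrite ltr_int; lia.
- move=> N; exists (D N), (P N); split=> //; first by have := D_ge N; lia.
  have /andP[g1 g2] := gap N; rewrite gtr0_norm//; apply: le_trans g2 _.
  rewrite ler_pdivrMr// mulrC ler_pdivlMr ?ltr0Sn// -natrM ler_nat /F; lia.
Qed.

End liouville.

Section symbol.
Variable R : realType.
Local Notation C := R[i].
Implicit Types (b t y : R) (x z w : C).

(** For Re x >= 0 the difference in parentheses has modulus at most 3, with equality only if e^(-x)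
    = -1 and e^(-2bx) = 1. The leading factor turns this extremal value -3 into 3, so 1 is the only
    possible point of contact, and it also gives |W(x)| <= e^(-Re x). *)
Definition wave b x : C := cexp (- x) * (cexp (- x) - 1 - cexp (- ((2 * b)%:C%C * x))) / 3.

Definition cayley z : C := (1 + z) / (1 - z).

Definition symbol b z : C := wave b (cayley z).

Lemma modulus_nat n : modulus (n%:R : C) = n%:R.
Proof. by rewrite -(rmorph_nat (real_complex R)) modulus_ge0_real. Qed.

Lemma cder_cayley z : z != 1 -> cder cayley z.
Proof.
move=> z1; apply: cderM; first by apply: cderD; [exact: cder_cst|exact: cder_id].
apply: cderV; first by rewrite subr_eq0 eq_sym.
by apply: cderB; [exact: cder_cst|exact: cder_id].
Qed.

Lemma cder_wave b x : cder (wave b) x.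
Proof.
have cid : cder (fun x : C => - x) x by apply: cderN; exact: cder_id.
have cE : cder (fun x : C => cexp (- x)) x by apply: (cder_comp (g := @cexp R)) cid _; exact: cder_cexp.
apply: cderM; last exact: cder_cst.
apply: cderM => //; apply: cderB.
  by apply: cderB => //; exact: cder_cst.
apply: (cder_comp (g := @cexp R)); last exact: cder_cexp.
by apply: cderN; apply: cderM; [exact: cder_cst|exact: cder_id].
Qed.

Lemma cder_symbol b z : z != 1 -> cder (symbol b) z.
Proof. by move=> z1; apply: cder_comp; [exact: cder_cayley|exact: cder_wave]. Qed.

Lemma Re_cayley z : z != 1 ->
  complex.Re (cayley z) = (1 - modulus z ^+ 2) / modulus (1 - z) ^+ 2.
Proof.
move=> z1; have D0 : 1 - z != 0 by rewrite subr_eq0 eq_sym.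
have m0 : 0 < modulus (1 - z) ^+ 2 by rewrite exprn_gt0// modulus_gt0.
have E : cayley z * (modulus (1 - z) ^+ 2)%:C%C = (1 + z) * (1 - z)^*%C.
  by rewrite -mulcJ /cayley mulrA divfK.
have := congr1 (@complex.Re _) E; rewrite creM /= mulr0 subr0 => E1.
apply/(mulIf (lt0r_neq0 m0)); rewrite divfK ?gt_eqF// E1 modulusE.
by case: (z) => a c /=; ring.
Qed.

Lemma Re_cayley_ge0 z : modulus z <= 1 -> z != 1 -> 0 <= complex.Re (cayley z).
Proof.
by move=> z1 /Re_cayley ->; rewrite divr_ge0 ?sqr_ge0// subr_ge0 expr_le1 ?modulus_ge0.
Qed.

Lemma modulus_wave_le b x : 0 < b -> 0 <= complex.Re x ->
  modulus (wave b x) <= expR (- complex.Re x).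
Proof.
move=> b0 x0; rewrite /wave modulusM modulusV modulus_nat modulusM modulus_cexp creN.
rewrite -mulrA ler_piMr ?expR_ge0// ler_pdivrMr// mul1r.
have H (y : C) : 0 <= complex.Re y -> modulus (cexp (- y)) <= 1.
  by move=> y0; rewrite modulus_cexp creN -expR0 ler_expR oppr_le0.
apply: le_trans (modulusB _ _) _; apply: le_trans (lerD (modulusB _ _) (lexx _)) _.
rewrite modulus1; have := H _ x0; have := H ((2 * b)%:C%C * x).
rewrite creM /= mul0r subr0 => /(_ (mulr_ge0 (mulr_ge0 (ler0n _ 2) (ltW b0)) x0)).
by lra.
Qed.

Lemma wave_imag b y :
  wave b (0 +i* y)%C = circ (- y) * (circ (- y) - 1 - circ (- (2 * b * y))) / 3.
Proof.
have E a : cexp (- (0 +i* a)%C) = circ (- a) :> C by rewrite /cexp /= oppr0 expR0 mul1r.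
rewrite /wave E; congr (_ * (_ - _) / _); rewrite -E; congr cexp; congr (- _).
by apply: complexP => /=; ring.
Qed.

Lemma modulus_wave_imag_lt1 b y : (forall p q : int, q != 0 -> b * q%:~R != p%:~R) ->
  modulus (wave b (0 +i* y)%C) < 1.
Proof.
move=> irr; rewrite ltNge; apply/negP.
rewrite wave_imag.
rewrite !modulusM modulusV modulus_nat modulus_circ mul1r ler_pdivlMr// mul1r.
rewrite -(@ler_pXn2r _ 2) ?nnegrE ?modulus_ge0// modulusE.
rewrite !circN /circ /= !oppr0 !addr0 ?subr0.
have := cos2Dsin2 y; have := cos2Dsin2 (2 * b * y).
have := cos_max y; have := cos_max (2 * b * y).
set c := cos y; set s := sin y; set c' := cos _; set s' := sin _.
rewrite !ler_norml => /andP[l1 l2] /andP[l3 l4] e1 e2 H.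
have H' : 9 <= (c - 1 - c') ^+ 2 + (s' - s) ^+ 2.
  by lra.
(* Expanded, [H'] reads - c + c' - (c c' + s s') >= 3. Each of the three terms is at most 1, so each
   equals 1; then y is an odd multiple of pi and b y a multiple of pi. *)
have sq : 0 <= (c * c' + s * s' + 1).
  have := sqr_ge0 (c + c'); have := sqr_ge0 (s + s'); lra.
have [c1 c'1] : - c = 1 /\ c' = 1 by split; lra.
have [k yk] : exists k : int, y + pi = 2 * pi * k%:~R by apply: cos_eq1; rewrite cosDpi.
have [m ym] := cos_eq1 c'1.
have := irr m (2 * k - 1); have -> : 2 * k - 1 != 0 by lia.
move=> /(_ isT) /eqP; apply.
have p2 : 2 * pi != 0 :> R by rewrite gt_eqF// pi2_gt0.
apply: (mulfI p2); rewrite -ym; have -> : y = 2 * pi * k%:~R - pi by lra.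
by rewrite intrB intrM; ring.
Qed.

Lemma modulus_symbol_lt1 b z : 0 < b -> (forall p q : int, q != 0 -> b * q%:~R != p%:~R) ->
  modulus z <= 1 -> z != 1 -> modulus (symbol b z) < 1.
Proof.
move=> b0 irr z1 zn1; have := Re_cayley_ge0 z1 zn1; rewrite /symbol.
case: (cayley z) => x y /=; rewrite le_eqVlt => /predU1P[<-|x0].
  exact: modulus_wave_imag_lt1.
apply: le_lt_trans (modulus_wave_le b0 _) _; first exact: ltW.
by rewrite /= -expR0 ltr_expR oppr_lt0.
Qed.

(** The Cayley transform of r is at least 1, and e^c >= 1 + c >= 2 there. *)
Lemma modulus_symbol_real b r : 0 < b -> 0 <= r -> r < 1 -> modulus (symbol b r%:C%C) <= 1 / 2.
Proof.
move=> b0 r0 r1; have c0 : 0 < 1 - r by lra.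
have -> : symbol b r%:C%C = wave b ((1 + r) / (1 - r))%:C%C.
  by rewrite /symbol /cayley real_complexV rmorphD rmorphB rmorph1.
have c1 : 1 <= (1 + r) / (1 - r) by rewrite ler_pdivlMr//; lra.
apply: le_trans (modulus_wave_le b0 _) _; first by rewrite /=; lra.
rewrite /= -(@ler_pV2 R) ?inE ?unitfE ?expR_eq0 ?expR_gt0 ?andbT//; last by lra.
rewrite expRN invrK.
by have := expR_ge1Dx ((1 + r) / (1 - r)); lra.
Qed.

(* The angle of the point with Cayley transform [i pi q]. *)
Definition touch_angle (q : nat) : R :=
  acos (((pi * q%:R) ^+ 2 - 1) / ((pi * q%:R) ^+ 2 + 1)).

(** This is |1 - circ t|^2 / 64 at t = [touch_angle q]. Over an arc of length [touch_rate q] h from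
    t, the Cayley transform moves by at most h / 8. *)
Definition touch_rate (q : nat) : R := (16 * (1 + (pi * q%:R) ^+ 2))^-1.

Lemma touch_rate_gt0 q : 0 < touch_rate q.
Proof. by rewrite invr_gt0 mulr_gt0// ltr_pwDl// sqr_ge0. Qed.

Lemma touch_rate_le q : touch_rate q <= 16^-1.
Proof.
rewrite lef_pV2 ?posrE//; last by rewrite mulr_gt0// ltr_pwDl// sqr_ge0.
by rewrite ler_peMr// lerDl sqr_ge0.
Qed.

Lemma touch_angle_itv q : (0 < q)%N -> 0 < touch_angle q < pi.
Proof.
move=> q0; have y0 : 0 < (pi * q%:R) ^+ 2 :> R by rewrite exprn_gt0// mulr_gt0 ?pi_gt0 ?ltr0n.
by rewrite acos_gt0 ?acos_ltpi// ?ler_pdivlMr ?ltr_pdivlMr ?ler_pdivrMr ?ltr_pdivrMr; try lra;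
  apply/andP; split; rewrite ?ler_pdivlMr ?ltr_pdivlMr ?ler_pdivrMr ?ltr_pdivrMr; lra.
Qed.

Lemma cayley_touch_angle q : (0 < q)%N ->
  (0 +i* (pi * q%:R))%C * (1 - circ (touch_angle q)) = 1 + circ (touch_angle q) :> C.
Proof.
move=> q0; set y := pi * q%:R.
have y0 : 0 < y by rewrite mulr_gt0 ?pi_gt0 ?ltr0n.
have y20 : 0 < y ^+ 2 by rewrite exprn_gt0.
have d0 : y ^+ 2 + 1 != 0 by rewrite gt_eqF//; lra.
have cE : cos (touch_angle q) = (y ^+ 2 - 1) / (y ^+ 2 + 1).
  by rewrite /touch_angle -/y acosK// in_itv /=; apply/andP; split; rewrite ?ler_pdivlMr ?ler_pdivrMr; lra.
have sE : sin (touch_angle q) = 2 * y / (y ^+ 2 + 1).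
  rewrite /touch_angle -/y sin_acos; last by apply/andP; split; rewrite ?ler_pdivlMr ?ler_pdivrMr; lra.
  have -> : 1 - ((y ^+ 2 - 1) / (y ^+ 2 + 1)) ^+ 2 = (2 * y / (y ^+ 2 + 1)) ^+ 2 by field.
  by rewrite sqrtr_sqr ger0_norm// divr_ge0; lra.
by apply: complexP; rewrite /circ /= cE sE; field.
Qed.

(** With |u - u'| <= 2 |y - y'| and |v - v'| <= 4 |y - y'|, the constant is (2 x 4 + 4) / 3. *)
Lemma wave_imag_lipschitz b y y' : 0 < b -> b <= 1 ->
  modulus (wave b (0 +i* y)%C - wave b (0 +i* y')%C) <= 4 * `|y - y'|.
Proof.
move=> b0 b1; rewrite !wave_imag.
set u := circ (- y); set u' := circ (- y'); set v := circ (- _); set v' := circ (- _).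
have -> : u * (u - 1 - v) / 3 - u' * (u' - 1 - v') / 3
  = ((u - u') * (u + u' - 1 - v) - u' * (v - v')) / 3 by ring.
have uB : modulus (u - u') <= 2 * `|y - y'|.
  by apply: le_trans (circ_lipschitz _ _) _; rewrite opprK addrC distrC.
have vB : modulus (v - v') <= 4 * `|y - y'|.
  apply: le_trans (circ_lipschitz _ _) _.
  rewrite opprK addrC -mulrBr normrM ger0_norm; last by lra.
  rewrite (distrC y' y) mulrA ler_wpM2r//; lra.
rewrite modulusM modulusV modulus_nat ler_pdivrMr//.
apply: le_trans (modulusB _ _) _; rewrite !modulusM {2}/u' modulus_circ mul1r.
have B4 : modulus (u + u' - 1 - v) <= 4.
  apply: le_trans (modulusB _ _) _; apply: le_trans (lerD (modulusB _ _) (lexx _)) _.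
  apply: le_trans (lerD (lerD (modulusD _ _) (lexx _)) (lexx _)) _.
  by rewrite modulus1 /u /u' /v !modulus_circ; lra.
have := ler_pM (modulus_ge0 _) (modulus_ge0 _) uB B4.
by lra.
Qed.

(** For odd q, e^(-i pi q) = -1, and W - 1 reduces to (conj(v) - 1) / 3, where v is the exponential
    of 2 pi i (b q - p). As pi <= 4, |v - 1| <= 2 x 8 x h / 16 = h. *)
Lemma wave_touch b q p (h : R) : odd q -> `|b * q%:R - p%:R| <= h / 16 ->
  modulus (wave b (0 +i* (pi * q%:R))%C - 1) <= h / 3.
Proof.
move=> oq bq; rewrite wave_imag !circN circ_muln circ_pi -signr_odd oq expr1.
have -> : (-1)^*%C = -1 :> C by apply: complexP; rewrite /= ?oppr0.
pose v : C := circ (2 * pi * (b * q%:R - p%:R)).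
have -> : circ (2 * b * (pi * q%:R)) = v :> C.
  have -> : 2 * b * (pi * q%:R) = 2 * pi * (b * q%:R - p%:R) + 2 * pi * p%:R by ring.
  by rewrite circD circ_muln circ2pi expr1n mulr1.
have -> : -1 * (-1 - 1 - v^*%C) / 3 - 1 = (v^*%C - 1) / 3 by field.
rewrite modulusM modulusV modulus_nat ler_pM2r ?invr_gt0//.
rewrite -conjc1 -conjB modulusJ -circ0; apply: le_trans (circ_lipschitz _ _) _.
rewrite subr0 normrM (ger0_norm (pi2_ge0 R)).
have pi4 : pi <= 4 :> R by have := @pihalf_lt2 R; lra.
have p0 : 0 < pi :> R := pi_gt0 R.
have := ler_pM (pi2_ge0 R) (normr_ge0 (b * q%:R - p%:R)) (_ : 2 * pi <= 8) bq; lra.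
Qed.

Lemma cayley_circ t : circ t != 1 :> C -> exists y, cayley (circ t) = (0 +i* y)%C.
Proof.
move=> t1; exists (complex.Im (cayley (circ t))); apply: complexP; last by [].
by rewrite Re_cayley// modulus_circ expr1n subrr mul0r.
Qed.

(** The error is h / 3 at the angle itself by [wave_touch], plus 4 (h / 8) for the motion along the
    arc by [wave_imag_lipschitz]. *)
Lemma symbol_touch b q p (h : R) : 0 < b -> b <= 1 -> odd q -> 0 < h -> h <= 1 ->
  `|b * q%:R - p%:R| <= h / 16 ->
  forall s, touch_angle q <= s <= touch_angle q + touch_rate q * h ->
  modulus (symbol b (circ s) - 1) <= h.
Proof.
move=> b0 b1 oq h0 h1 bq s /andP[s1 s2].
have q0 : (0 < q)%N by case: (q) oq.
pose y : R := pi * q%:R; set t := touch_angle q in s1 s2; set k := touch_rate q in s2.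
have k0 : 0 < k by exact: touch_rate_gt0.
have yk : 16 * (1 + y ^+ 2) * k = 1 by rewrite /k /touch_rate mulfV// gt_eqF// mulr_gt0// ltr_pwDl// sqr_ge0.
have cz := cayley_touch_angle q0; rewrite -/y -/t in cz.
pose d : C := 1 - circ t.
have dE : d * (1 + (0 +i* y)%C) = 2 by rewrite /d mulrC mulrDl mul1r cz; ring.
have m2 : modulus d ^+ 2 * (1 + y ^+ 2) = 4.
  have m1 : modulus (1 + (0 +i* y)%C) ^+ 2 = 1 + y ^+ 2 by rewrite modulusE /=; ring.
  by rewrite -m1 -exprMn -modulusM dE modulus_nat; ring.
set D := modulus d in m2.
have y1 : 1 <= 1 + y ^+ 2 by rewrite lerDl sqr_ge0.
have D0 : 0 <= D by exact: modulus_ge0.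
have D2 : D <= 2.
  by rewrite -(@ler_pXn2r _ 2) ?nnegrE// (_ : 2 ^+ 2 = 4); [rewrite -m2 ler_peMr// sqr_ge0|ring].
have Dpos : 0 < D.
  rewrite lt_def D0 andbT; apply: contra_eqN m2 => /eqP ->.
  by rewrite expr0n mul0r eq_sym pnatr_eq0.
have kD : k = D ^+ 2 / 64.
  have : (D ^+ 2 * (1 + y ^+ 2)) * k = 4 * k by rewrite m2.
  by move: yk; set A := 1 + _ => yk; have -> : D ^+ 2 * A * k = D ^+ 2 * (16 * A * k) / 16; [field|rewrite yk; lra].
pose e : C := circ s - circ t; pose d' : C := 1 - circ s.
have eB : modulus e <= D ^+ 2 * h / 32.
  apply: le_trans (circ_lipschitz _ _) _; rewrite ger0_norm ?subr_ge0//.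
  by move: s2; rewrite kD; lra.
have D2h : D ^+ 2 * h <= 2 * D.
  rewrite expr2 -mulrA -[leRHS]mulrC ler_wpM2l//; apply: le_trans D2.
  by rewrite ler_piMr.
have d'B : D / 2 <= modulus d'.
  have -> : d' = d - e by rewrite /d' /d /e; ring.
  by apply: le_trans (modulus_lowerB _ _); rewrite -/D; lra.
have dn : d != 0 by rewrite -modulus_gt0.
have d'n : d' != 0 by rewrite -modulus_gt0; lra.
have [ys Es] : exists y, cayley (circ s) = (0 +i* y)%C.
  by apply: cayley_circ; apply: contraNneq d'n => st; rewrite /d' st subrr.
have Et : cayley (circ t) = (0 +i* y)%C by rewrite /cayley -cz mulfK.
have yB : `|ys - y| <= h / 8.
  have -> : `|ys - y| = modulus (cayley (circ s) - cayley (circ t)).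
    by rewrite Es Et -sqrtr_sqr /Normc.normc /= subrr expr0n add0r.
  have -> : cayley (circ s) - cayley (circ t) = 2 * e / (d * d').
    by rewrite /cayley -/d -/d' /e /d' /d; field; apply/andP; split.
  rewrite modulusM modulusV !modulusM -/D.
  rewrite modulus_nat ler_pdivrMr ?mulr_gt0//; last by lra.
  have := ler_wpM2l (mulr_ge0 (ltW h0) D0) d'B; lra.
have W := wave_touch oq bq; have L := wave_imag_lipschitz ys y b0 b1.
have -> : symbol b (circ s) - 1 = (wave b (0 +i* ys)%C - wave b (0 +i* y)%C) + (wave b (0 +i* y)%C - 1).
  by rewrite /symbol Es; ring.
apply: le_trans (modulusD _ _) _; rewrite -/y in W; lra.
Qed.

End symbol.


(** * Compactness on the Hardy space *)

Section hardy_norm.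
Variable R : realType.
Local Notation C := R[i].
Local Notation cm := (circle_measure R).
Implicit Types (t r M : R) (f g h : C -> C) (u : R -> R).

Lemma holP f : holomorphic_on_disk f <-> hol f.
Proof. by split=> hf z dz; apply/derivable_cder; exact: hf. Qed.

Lemma circle_integral u : (forall t, {for t, continuous u}) -> (forall t, 0 <= u t) ->
  (\int[cm]_t (u t)%:E)%E = (ravg u)%:E.
Proof.
move=> cu u0; rewrite /circle_measure integral_uniform//.
- by rewrite subr0 -rint_EFin// => t _; exact: cu.
- apply/measurable_EFinP; exact: continuous_measurable_fun.
Qed.

(** The exponent n + 1 covers H^1 and H^2 together, with ordinary powers in place of real ones. *)
Lemma Lnorm_circle n u M : (forall t, {for t, continuous u}) -> (forall t, 0 <= u t) -> 0 <= M ->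
  ('N[cm]_(n.+1%:R%:E)[(fun t => (u t)%:E)] <= M%:E)%E = (ravg (fun t => u t ^+ n.+1) <= M ^+ n.+1).
Proof.
move=> cu u0 M0.
have cuX t : {for t, continuous (fun t => u t ^+ n.+1)}.
  elim: n => [|n IH]; first exact: cu.
  have -> : (fun t => u t ^+ n.+2) = (fun t => u t * u t ^+ n.+1) by apply/funext => s; rewrite exprS.
  by apply: continuousM; [exact: cu|exact: IH].
have := @poweR_Lnorm _ _ R cm (fun t => (u t)%:E) n.+1%:R.
rewrite pnatr_eq0 => /(_ isT).
have -> : (\int[cm]_t `|(u t)%:E| `^ n.+1%:R)%E = (ravg (fun t => u t ^+ n.+1))%:E.
  rewrite -circle_integral//; last by move=> t; rewrite exprn_ge0.
  by apply: eq_integral => t _; rewrite abse_EFin poweR_EFin ger0_norm// powR_mulrn.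
have := Lnorm_ge0 cm n.+1%:R%:E (fun t => (u t)%:E).
case: ('N[_]__[_])%E => [x| |] //.
- rewrite !lee_fin => x0; rewrite poweR_EFin powR_mulrn// => -[<-].
  by rewrite ler_pXn2r ?nnegrE.
- by move=> _; rewrite poweRE pnatr_eq0 eqxx.
Qed.

Lemma hol_circle_continuous f r : hol f -> 0 <= r -> r < 1 ->
  forall t, {for t, continuous (fun t => modulus (f (r%:C%C * circ t)))}.
Proof.
move=> hf r0 r1 t; apply: pcontat_modulus.
by apply: (hol_circle hf r0 r1 (a := t) (b := t)); rewrite lexx.
Qed.

Lemma Hp_norm_le n f M : hol f -> 0 <= M ->
  (Hp_norm n.+1%:R f <= M%:E)%E <->
  (forall r, 0 <= r -> r < 1 -> ravg (fun t => modulus (f (r%:C%C * circ t)) ^+ n.+1) <= M ^+ n.+1).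
Proof.
move=> hf M0; split=> [H r r0 r1|H].
  rewrite -(Lnorm_circle n (hol_circle_continuous hf r0 r1) (fun t => modulus_ge0 _) M0).
  by apply: le_trans H; apply: ereal_sup_ubound; exists r => //=; rewrite in_itv /= r0.
apply: ge_ereal_sup => _ [r + <-]; rewrite /= in_itv /= => /andP[r0 r1].
by rewrite (Lnorm_circle n (hol_circle_continuous hf r0 r1) (fun t => modulus_ge0 _) M0); exact: H.
Qed.

Lemma Hp_norm_ge0 (p : R) f : (0 <= Hp_norm p f)%E.
Proof.
apply: (@le_trans _ _ ('N[cm]_(p%:E) [(fun t : R => (modulus (f (0%:C%C * circ t)))%:E)])%E).
  exact: Lnorm_ge0.
by apply: ereal_sup_ubound; exists 0 => //=; rewrite in_itv /= lexx ltr01.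
Qed.

Lemma Hp2_norm_le f M : hol f -> 0 <= M -> (Hp_norm 2 f <= M%:E)%E <->
  (forall r, 0 <= r -> r < 1 -> sqmean f r <= M ^+ 2).
Proof. by move=> hf M0; exact: (@Hp_norm_le 1). Qed.

Lemma Hp1_norm_le f M : hol f -> 0 <= M -> (Hp_norm 1 f <= M%:E)%E <-> mean_bounded f M.
Proof. by move=> hf M0; exact: (@Hp_norm_le 0). Qed.

Lemma Hp_fin (p : R) f : Hp p f -> exists2 M, 0 <= M & (Hp_norm p f <= M%:E)%E.
Proof.
move=> [_]; have := Hp_norm_ge0 p f; case: (Hp_norm p f) => // x x0 _.
by exists x => //; rewrite lee_fin in x0.
Qed.

End hardy_norm.

Section montel.
Variable R : realType.
Local Notation C := R[i].
Implicit Types (t r M : R) (z w : C).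

(** Uniform closeness on a smaller disk holds on a set of [U], which meets every tail: this yields
    arbitrarily late indices, hence a genuine subsequence. *)
Lemma montel (f : nat -> C -> C) M : (forall n, hol (f n)) -> (forall n, mean_bounded (f n) M) ->
  exists s : nat -> nat, {homo s : m n / (m < n)%N} /\ exists2 g, hol g &
  forall eta e : R, eta < 1 -> 0 < e -> exists N, forall n, (N <= n)%N ->
    forall z, modulus z <= eta -> modulus (f (s n) z - g z) < e.
Proof.
move=> hf fM; have fE := equi_der_mean_bounded hf fM.
have [U [UU Uf]] := free_ultrafilter.
have [g [hg Hg]] := normal_limit UU fE.
have Hu := normal_unif UU fE hg Hg.
have /choice[k Hk] : forall nN : nat * nat, exists k, (nN.2 <= k)%N /\
    forall z, modulus z <= 1 - nN.1.+2%:R^-1 -> modulus (f k z - g z) < nN.1.+1%:R^-1.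
  move=> [n N] /=; have [_ e1] := one_sub_invS R n.
  have e0 : 0 < n.+1%:R^-1 :> R by rewrite invr_gt0.
  by have [k [k1 k2]] := ultra_ex UU (filterI (ultra_ge Uf N) (Hu _ _ e1 e0)); exists k.
(* The first component sets the disk and the tolerance of stage n, the second forces the new index
   beyond the previous one. *)
pose s := fix s n := if n is n'.+1 then k (n, (s n').+1) else k (0, 0)%N.
exists s; split; first by apply: homo_ltn => [a b c|n /=]; [exact: ltn_trans|have [] := Hk (n.+1, (s n).+1)].
exists g => // eta e eta1 e0.
have [N1 H1] := archi_lt e0.
have [|N2 H2] := @archi_lt R (1 - eta); first by rewrite subr_gt0.
exists (maxn N1 N2) => n; rewrite geq_max => /andP[n1 n2] z zeta.
apply: lt_trans (H1 _ n1).
have -> : s n = k (n, (if n is n'.+1 then (s n').+1 else 0)%N) by case: (n).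
have [_] := Hk (n, (if n is n'.+1 then (s n').+1 else 0)%N); apply => /=.
by have := H2 n.+1 (leq_trans n2 (leqnSn _)); set k' := n.+2%:R^-1; lra.
Qed.

End montel.

(** * Compactness on H^2 from three properties of the symbol *)

Section compactness.
Variable R : realType.
Local Notation C := R[i].
Implicit Types (t r M : R) (z w : C) (f g h : C -> C).
Variables (phi : C -> C).
Hypotheses (phi_der : forall z, z != 1 -> cder phi z)
  (phi_lt1 : forall z, modulus z <= 1 -> z != 1 -> modulus (phi z) < 1)
  (phi_real : forall r, 0 <= r -> r < 1 -> modulus (phi r%:C%C) <= 1 / 2).

Lemma disk_neq1 z : disk z -> z != 1.
Proof. by move=> dz; apply/eqP => z1; move: dz; rewrite z1 diskE modulus1 ltxx. Qed.

Lemma symbol_self_map : analytic_self_map phi.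
Proof.
split=> [|z dz]; last by apply: phi_lt1; [exact: ltW|exact: disk_neq1].
by apply/holP => z /disk_neq1/phi_der.
Qed.

Lemma hol_comp f : hol f -> hol (f \o phi).
Proof.
move=> hf z dz; have [_ /(_ _ dz)] := symbol_self_map => dphi.
by apply: cder_comp; [exact/phi_der/disk_neq1|exact: hf].
Qed.

Lemma phi_away (d : R) : 0 < d -> exists2 eta : R, eta < 1 &
  forall z, modulus z <= 1 -> d <= modulus (1 - z) -> modulus (phi z) <= eta.
Proof.
move=> d0.
have [|||e e0 He] := @compact_unif R [set z | modulus z <= 1 /\ d <= modulus (1 - z)] 1
  (fun w e => modulus (phi w) <= 1 - e).
- by move=> z [].
- move=> z Hz; split; apply/ler_addgt0Pl => e e0.
    have [w [w1 _] wz] := Hz _ e0; have := modulus_lowerB z w; rewrite modulusC in wz.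
    by move=> /= ?; lra.
  have [w [_ w1] wz] := Hz _ e0.
  have := modulusD (1 - z) (z - w); rewrite modulusC in wz.
  have -> : 1 - z + (z - w) = 1 - w by ring.
  by move=> /= ?; lra.
- move=> z [z1 dz]; have zn1 : z != 1.
    by apply: contraTneq dz => ->; rewrite subrr modulus0 -ltNge.
  pose e := (1 - modulus (phi z)) / 2.
  have e0 : 0 < e by rewrite divr_gt0// subr_gt0 phi_lt1.
  have [d' d'0 Hd'] := cder_ccont (phi_der zn1) e0.
  exists (Num.min d' e); first by rewrite lt_min d'0.
  move=> w _; rewrite lt_min => /andP[/Hd' wz _] k /andP[k0]; rewrite lt_min => /andP[_ ke].
  by have := modulus_lowerB (phi w) (phi z); rewrite /e in wz ke *; lra.
exists (1 - e / 2); first by lra.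
move=> z z1 dz; apply: He => //; lra.
Qed.

(** The denominator is at most d + (1 - d) d <= 2 d in modulus and the numerator is 1 - (1 - d)^2 >=
    d, so the kernel is at least d / (2 d)^2. *)
Lemma poisson_near1 t (d : R) : 0 < d -> d <= 1 -> modulus (1 - circ t : C) <= d ->
  1 <= 4 * d * poisson (1 - d)%:C%C t.
Proof.
move=> d0 d1 td; rewrite /poisson modulus_ge0_real; last by lra.
set D := modulus (1 - _).
have D2 : D <= 2 * d.
  have -> : D = modulus (d%:C%C + (1 - d)%:C%C * (1 - (circ t)^*%C)).
    by rewrite /D rmorphB rmorph1; congr modulus; ring.
  apply: le_trans (modulusD _ _) _; rewrite modulusM !modulus_ge0_real; try lra.
  rewrite -conjc1 -conjB modulusJ; have := ler_wpM2l (_ : 0 <= 1 - d) td; nra.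
have D0 : 0 < D.
  rewrite modulus_gt0; apply: circ_denom_neq0; rewrite modulus_ge0_real; lra.
rewrite mulrA ler_pdivlMr ?exprn_gt0// mul1r.
have : D ^+ 2 <= (2 * d) ^+ 2 by rewrite ler_pXn2r ?nnegrE//; lra.
nra.
Qed.

(* Where [1 - circ t] is at most [d], the Poisson kernel of [1 - d] is at least
   [1 / (4 d)]; elsewhere [eta] bounds the integrand. *)
Lemma sqmean_comp_le h (A d eta r : R) : hol h ->
  (forall r, 0 <= r -> r < 1 -> sqmean h r <= A) -> 0 < d -> d <= 1 -> 0 <= eta ->
  (forall z, modulus z <= 1 -> d / 2 <= modulus (1 - z) -> modulus (h (phi z)) ^+ 2 <= eta) ->
  0 <= r -> r < 1 -> sqmean (h \o phi) r <= 24 * d * A + eta.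
Proof.
move=> hh hA d0 d1 eta0 Heta r0 r1.
have hh2 : hol (fun z => h z ^+ 2) by move=> z dz; apply: cderX; exact: hh.
have hA2 : mean_bounded (fun z => h z ^+ 2) A.
  move=> q q0 q1; apply: le_trans (hA _ q0 q1); rewrite le_eqVlt; apply/predU1P; left.
  by apply: eq_ravg => t; rewrite modulusX.
have [G [hG Gh GA]] := holomorphic_majorant hh2 hA2.
have hGphi := hol_comp hG; have hhphi := hol_comp hh.
have dr : modulus (1 - d)%:C%C < 1 :> R by rewrite modulus_ge0_real; lra.
have A0 : 0 <= A by apply: le_trans (hA _ (lexx 0) ltr01); apply: ravg_ge0 => t; rewrite sqr_ge0.
have [r00|rn0] := eqVneq r 0.
  have -> : sqmean (h \o phi) r = modulus (h (phi 0)) ^+ 2.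
    by rewrite /sqmean -[RHS]ravg_cst; apply: eq_ravg => t; rewrite r00 mul0r.
  apply: le_trans (Heta _ _ _) _; rewrite ?modulus0 ?subr0 ?modulus1; try lra.
  by rewrite lerDr mulr_ge0// mulr_ge0// ltW.
have rpos : 0 < r by rewrite lt_def rn0.
have dGr w : modulus w <= r -> cder (fun z => G (phi z)) w by move=> wr; apply: hGphi; exact: le_lt_trans r1.
have PR := poisson_Re rpos dr dGr.
have cG : rcont 0 (2 * pi) (fun t => complex.Re (G (phi (r%:C%C * circ t)))).
  by apply: pcont_Re; exact: (hol_circle hGphi).
have cP := @rcont_poisson R _ 0 (2 * pi) dr.
have cPG : rcont 0 (2 * pi) (fun t => poisson (1 - d)%:C%C t * complex.Re (G (phi (r%:C%C * circ t)))).
  by move=> t tab; apply: continuousM; [exact: cP|exact: cG].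
have dphi z : disk z -> disk (phi z) by have [_ H] := symbol_self_map; exact: H.
have dpol t : disk (r%:C%C * circ t) by rewrite diskE modulus_polar.
have GRe t : 0 <= complex.Re (G (phi (r%:C%C * circ t))).
  by apply: le_trans (Gh _ _); [exact: modulus_ge0|exact/dphi/dpol].
have ptw t : modulus (h (phi (r%:C%C * circ t))) ^+ 2 <=
    4 * d * (poisson (1 - d)%:C%C t * complex.Re (G (phi (r%:C%C * circ t)))) + eta.
  have P0 := poisson_ge0 t dr.
  have [td|td] := leP (modulus (1 - circ t : C)) d.
    rewrite -modulusX; apply: le_trans (Gh _ (dphi _ (dpol _))) _.
    have := ler_wpM2r (GRe t) (poisson_near1 d0 d1 td); rewrite mul1r => H.
    by apply: le_trans H _; rewrite -!mulrA lerDl.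
  apply: le_trans (Heta _ _ _) _; first by rewrite modulus_polar// ltW.
    (* The point r circ t is inside the disk: since 1 - r <= |1 - r circ t|, one has |1 - circ t| <=
       2 |1 - r circ t|, whence d / 2 in the hypothesis on [eta]. *)
    have := modulus_lowerB 1 (r%:C%C * circ t : C); rewrite modulus1 modulus_polar// => H1.
    have : modulus (1 - circ t : C) <= modulus (1 - r%:C%C * circ t : C) + (1 - r).
      have -> : 1 - circ t = (1 - r%:C%C * circ t) + - ((1 - r)%:C%C * circ t) :> C.
        by rewrite rmorphB rmorph1; ring.
      apply: le_trans (modulusD _ _) _; rewrite modulusN [X in _ + X]modulus_polar//; lra.
    lra.
  by rewrite lerDr; apply: mulr_ge0; [lra|exact: mulr_ge0].
have cc (k : R) : rcont 0 (2 * pi) (fun=> k) by move=> t _; exact: cst_continuous.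
have cK : rcont 0 (2 * pi) (fun t => 4 * d * (poisson (1 - d)%:C%C t * complex.Re (G (phi (r%:C%C * circ t))))).
  by move=> t tab; apply: continuousM; [exact: cst_continuous|exact: cPG].
apply: le_trans (ravg_le _ _ (fun t _ => ptw t)) _.
- by apply/rcont_sqr/pcont_modulus; exact: (hol_circle hhphi).
- by move=> t tab; apply: continuousD; [exact: cK|exact: cst_continuous].
rewrite ravgD// ravg_cst ravgZ// PR lerD2r.
have rd0 : 0 <= r * (1 - d) by rewrite mulr_ge0//; lra.
have rd1 : r * (1 - d) < 1 by nra.
have B := phi_real rd0 rd1.
rewrite -rmorphM.
have phid : disk (phi (r * (1 - d))%:C%C) by rewrite diskE; lra.
(* 6 A = 3 A / (1 - 1/2), as phi is at most 1/2 in modulus there; the factor 4 d then gives 24 d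
   A. *)
have : modulus (G (phi (r * (1 - d))%:C%C)) <= 6 * A.
  apply: le_trans (GA _ phid) _; rewrite ler_pdivrMr; last by lra.
  nra.
have := Re_le_modulus (G (phi (r * (1 - d))%:C%C)); rewrite ler_norml => /andP[_] a b.
have := ler_wpM2l (_ : 0 <= 4 * d) (le_trans a b); nra.
Qed.

Lemma hol_bounded h (A eta : R) : hol h ->
  (forall r, 0 <= r -> r < 1 -> sqmean h r <= A) -> eta < 1 ->
  exists2 B, 0 <= B & forall z, modulus z <= eta -> modulus (h z) ^+ 2 <= B.
Proof.
move=> hh hA eta1.
have hh2 : hol (fun z => h z ^+ 2) by move=> z dz; apply: cderX; exact: hh.
have hA2 : mean_bounded (fun z => h z ^+ 2) A.
  move=> q q0 q1; apply: le_trans (hA _ q0 q1); rewrite le_eqVlt; apply/predU1P; left.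
  by apply: eq_ravg => t; rewrite modulusX.
have A0 : 0 <= A by apply: le_trans (hA _ (lexx 0) ltr01); apply: ravg_ge0 => t; rewrite sqr_ge0.
have [G [hG Gh GA]] := holomorphic_majorant hh2 hA2.
exists (3 * A / (1 - eta)); first by rewrite divr_ge0 ?subr_ge0 ?(ltW eta1)// mulr_ge0.
move=> z zeta; have dz : disk z by rewrite diskE (le_lt_trans zeta).
rewrite -modulusX; apply: le_trans (Gh _ dz) _.
apply: le_trans (le_trans (ler_norm _) (Re_le_modulus _)) _; apply: le_trans (GA _ dz) _.
rewrite ler_wpM2l ?mulr_ge0// lef_pV2 ?posrE ?subr_gt0//; first by rewrite lerB.
Qed.

Lemma rcont_sqmean f r : hol f -> 0 <= r -> r < 1 ->
  rcont 0 (2 * pi) (fun t => modulus (f (r%:C%C * circ t)) ^+ 2).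
Proof. by move=> hf r0 r1; apply/rcont_sqr/pcont_modulus; exact: hol_circle. Qed.

Lemma sqmean_le f g h r : hol f -> hol g -> hol h -> 0 <= r -> r < 1 ->
  (forall z, modulus z = r -> modulus (f z) <= modulus (g z) + modulus (h z)) ->
  sqmean f r <= 2 * sqmean g r + 2 * sqmean h r.
Proof.
move=> hf hg hh r0 r1 fgh.
have cf := rcont_sqmean hf r0 r1; have cg := rcont_sqmean hg r0 r1.
have ch := rcont_sqmean hh r0 r1.
have Z (u : R -> R) : rcont 0 (2 * pi) u -> rcont 0 (2 * pi) (fun t => 2 * u t).
  by move=> cu t tab; apply: continuousM; [exact: cst_continuous|exact: cu].
have cg2 := Z _ cg; have ch2 := Z _ ch.
rewrite /sqmean -!ravgZ// -ravgD//; apply: ravg_le => //.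
  by move=> t tab; apply: continuousD; [exact: cg2|exact: ch2].
move=> t _; have := fgh _ (modulus_polar t r0).
have := modulus_ge0 (f (r%:C%C * circ t)).
set a := modulus _; set b := modulus _; set c := modulus _ => a0 abc.
have : a ^+ 2 <= (b + c) ^+ 2 by rewrite ler_pXn2r ?nnegrE//; lra.
have := sqr_ge0 (b - c); lra.
Qed.

(** From |f| <= (1 + |f|^2) / 2; it brings bounded sequences of H^2 within reach of [montel]. *)
Lemma sqmean_bounded_mean_bounded f (A : R) : hol f ->
  (forall r, 0 <= r -> r < 1 -> sqmean f r <= A) -> mean_bounded f ((1 + A) / 2).
Proof.
move=> hf fA r r0 r1.
have cf := rcont_sqmean hf r0 r1.
have c1 : rcont 0 (2 * pi) (fun t => 1 + modulus (f (r%:C%C * circ t)) ^+ 2).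
  by move=> t tab; apply: continuousD; [exact: cst_continuous|exact: cf].
apply: (@le_trans _ _ (ravg (fun t => 2^-1 * (1 + modulus (f (r%:C%C * circ t)) ^+ 2)))).
  apply: ravg_le => [||t _].
  - by apply: pcont_modulus; exact: hol_circle.
  - by move=> t tab; apply: continuousM; [exact: cst_continuous|exact: c1].
  - by have := sqr_ge0 (modulus (f (r%:C%C * circ t)) - 1); lra.
rewrite ravgZ// ravgD ?ravg_cst//; last by move=> t _; exact: cst_continuous.
by have := fA _ r0 r1; rewrite /sqmean; lra.
Qed.

Lemma cvg_ereal0 (x : nat -> \bar R) : (forall n, (0 <= x n)%E) ->
  (forall e : R, 0 < e -> exists N, forall n, (N <= n)%N -> (x n <= e%:E)%E) ->
  x n @[n --> \oo] --> 0%E.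
Proof.
move=> x0 Hx; have xfin (e : R) n : (x n <= e%:E)%E -> x n \is a fin_num.
  by move=> xe; rewrite ge0_fin_numE//; apply: le_lt_trans xe _; rewrite ltry.
apply/fine_cvgP; split.
  by have [N HN] := Hx _ ltr01; exists N => // n /HN; exact: xfin.
apply/cvgrPdist_le => e /Hx[N HN]; exists N => // n /HN xe.
rewrite sub0r normrN ger0_norm ?fine_ge0//= -lee_fin fineK//; exact: xfin xe.
Qed.

Lemma compact_H2 : compact_operator (Hp 2) (Hp_norm 2) (composition_operator phi).
Proof.
move=> f Hf [M0 HM0]; pose M := Num.max M0 0.
have M_ge0 : 0 <= M by rewrite le_max lexx orbT.
have hf n : hol (f n) by apply/holP; case: (Hf n).
have fM n r : 0 <= r -> r < 1 -> sqmean (f n) r <= M ^+ 2.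
  move: r; apply/Hp2_norm_le => //; apply: le_trans (HM0 n) _.
  by rewrite lee_fin le_max lexx.
have [s [s_mono [g hg fg]]] := montel hf (fun n => sqmean_bounded_mean_bounded (hf n) (fM n)).
exists s; split => //.
have h1 : hol (fun=> 1 : C) by move=> z _; exact: cder_cst.
(* On each circle [g] is within 1 of some member of the subsequence, so |g| <= |f| + 1 there. *)
have gA r : 0 <= r -> r < 1 -> sqmean g r <= 2 * M ^+ 2 + 2.
  move=> r0 r1; have [N HN] := fg _ _ r1 ltr01.
  apply: (@le_trans _ _ (2 * sqmean (f (s N)) r + 2 * sqmean (fun=> 1 : C) r)).
    apply: sqmean_le => // z zr; rewrite modulus1.
    have := HN _ (leqnn _) z; rewrite zr lexx modulusC => /(_ isT).
    by have := modulus_lowerB (g z) (f (s N) z); lra.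
  have -> : sqmean (fun=> 1 : C) r = 1 by rewrite /sqmean modulus1 expr1n ravg_cst.
  by have := fM (s N) _ r0 r1; lra.
pose h n z := f (s n) z - g z.
have hh n : hol (h n) by move=> z dz; apply: cderB; [exact: hf|exact: hg].
(* 2 M^2 + 2 (2 M^2 + 2), from the bounds on the two terms of [h n]. *)
pose A := 6 * M ^+ 2 + 4.
have A_gt0 : 0 < A by rewrite /A; have := sqr_ge0 M; lra.
have hA n r : 0 <= r -> r < 1 -> sqmean (h n) r <= A.
  move=> r0 r1.
  apply: (@le_trans _ _ (2 * sqmean (f (s n)) r + 2 * sqmean g r)).
    by apply: sqmean_le => // z _; exact: modulusB.
  by have := fM (s n) _ r0 r1; have := gA _ r0 r1; rewrite /A; lra.
have sub1 (d : R) : 0 < d -> 0 < d / 2 by move=> d0; rewrite divr_gt0.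
exists (g \o phi).
  split; first by apply/holP; exact: hol_comp.
  have [eta eta1 He] := phi_away (sub1 _ ltr01).
  have [B B0 HB] := hol_bounded hg gA eta1.
  (* [sqmean_comp_le] with d = 1; the norm is then bounded by 1 + X because X <= (1 + X)^2. *)
  pose X := 24 * 1 * (2 * M ^+ 2 + 2) + B.
  have X0 : 0 <= X by rewrite /X; have := sqr_ge0 M; lra.
  apply: (@le_lt_trans _ _ (1 + X)%:E); last exact: ltry.
  apply/Hp2_norm_le; [exact: hol_comp|lra|move=> r r0 r1].
  apply: (@le_trans _ _ X); last by nra.
  apply: sqmean_comp_le => // z z1 dz; apply: HB; exact: He.
apply: cvg_ereal0 => [n|e e0]; first exact: Hp_norm_ge0.
(* Near 1 the contribution is then at most e^2 / 2; away from 1, uniform convergence to within e / 2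
   adds e^2 / 4. *)
pose d := Num.min 1 (e ^+ 2 / (48 * A)).
have e20 : 0 < e ^+ 2 by rewrite exprn_gt0.
have d0 : 0 < d by rewrite lt_min ltr01 divr_gt0// mulr_gt0.
have d1 : d <= 1 by rewrite ge_min lexx.
have dA : 24 * d * A <= e ^+ 2 / 2.
  have : d <= e ^+ 2 / (48 * A) by rewrite ge_min lexx orbT.
  by rewrite ler_pdivlMr ?mulr_gt0//; lra.
have [eta eta1 He] := phi_away (sub1 _ d0).
have [N HN] := fg _ _ eta1 (sub1 _ e0).
exists N => n nN.
have -> : composition_operator phi (f (s n)) - (g \o phi) = h n \o phi by apply/funext.
apply/Hp2_norm_le; [exact: hol_comp|exact: ltW|move=> r r0 r1].
apply: (@le_trans _ _ (24 * d * A + (e / 2) ^+ 2)); last by lra.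
apply: (sqmean_comp_le (hh n) (hA n) d0 d1 (sqr_ge0 _) _ r0 r1).
move=> z z1 dz; rewrite ler_pXn2r ?nnegrE ?modulus_ge0 ?(ltW (sub1 _ e0))//.
by apply/ltW/HN => //; exact: He.
Qed.

End compactness.


(** * Failure of compactness on the Hardy-Orlicz space *)

(** Monotonicity straight from the supremum over simple functions: it applies to [Psi] composed with
    boundary values without a discussion of measurability. *)
Lemma le_integral_setT d (T : measurableType d) (R : realType) (mu : measure T R)
  (f g : T -> \bar R) : (forall x, (0 <= f x)%E) -> (forall x, (f x <= g x)%E) ->
  (\int[mu]_x f x <= \int[mu]_x g x)%E.
Proof.
move=> f0 fg; have g0 x : (0 <= g x)%E by exact: le_trans (fg x).
rewrite !ge0_integralTE//; apply: le_ereal_sup => _ [h hf <-]; exists h => // x.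
exact: le_trans (fg x).
Qed.

Lemma le_measure_setD_null d (T : measurableType d) (R : realType)
  (mu : {measure set T -> \bar R}) (A Z : set T) :
  measurable A -> measurable Z -> mu Z = 0%E -> (mu A <= mu (A `\` Z))%E.
Proof.
move=> mA mZ Z0; have mD := measurableD mA mZ.
apply: (@le_trans _ _ (mu ((A `\` Z) `|` Z))).
  apply: le_measure; rewrite ?inE//; first exact: measurableU.
  by move=> t At; have [Zt|Zt] := pselect (Z t); [right|left].
have H : (mu ((A `\` Z) `|` Z) <= mu (A `\` Z) + mu Z)%E by exact: measureU2.
by apply: le_trans H _; move: Z0 => /= ->; rewrite adde0.
Qed.

Lemma le_measure_cover2 d (T : measurableType d) (R : realType)
  (mu : {measure set T -> \bar R}) (A B D : set T) :
  measurable A -> measurable B -> measurable D -> A `<=` B `|` D -> (mu A <= mu B + mu D)%E.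
Proof.
move=> mA mB mD AB; apply: (@le_trans _ _ (mu (B `|` D))); last exact: measureU2.
by apply: le_measure; rewrite ?inE//; exact: measurableU.
Qed.

(** * Orlicz functions on the real half-line *)

Section orlicz_function.
Variables (R : realType) (Psi : \bar R -> \bar R).
Hypothesis hPsi : orlicz Psi.
Implicit Types x y u : R.

Definition psi x : R := fine (Psi x%:E).

(** Finiteness comes from strict convexity: x is the midpoint of 0 and 2 x, and a strict inequality
    bounds [Psi] there. *)
Lemma psiE x : 0 <= x -> Psi x%:E = (psi x)%:E.
Proof.
move=> x0; rewrite /psi fineK// ge0_fin_numE; last by apply: (orlicz_ge0 hPsi); rewrite lee_fin.
move: x0; rewrite le_eqVlt => /predU1P[<-|x0]; first by rewrite (orlicz_0 hPsi) ltry.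
have h2 : 0 < (2^-1 : R) < 1 by lra.
have x2 : 0 <= x * 2 by lra.
have x2n : x * 2 != 0 by rewrite gt_eqF//; lra.
have := orlicz_strictly_convex hPsi x2 (lexx 0) x2n h2.
rewrite mulr0 addr0 => /lt_le_trans/(_ (leey _)).
by rewrite mulrC mulfK// pnatr_eq0.
Qed.

Lemma psi_ge0 x : 0 <= x -> 0 <= psi x.
Proof. by move=> x0; rewrite -lee_fin -psiE//; apply: (orlicz_ge0 hPsi); rewrite lee_fin. Qed.

Lemma psi_le x y : 0 <= x -> x <= y -> psi x <= psi y.
Proof.
move=> x0 xy; rewrite -lee_fin -!psiE//; last exact: le_trans xy.
by apply: (orlicz_nondecreasing hPsi); rewrite lee_fin.
Qed.

Lemma psi_convex0 x u : 0 <= x -> 0 <= u <= 1 -> psi (u * x) <= u * psi x.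
Proof.
move=> x0 u01; have /andP[u0 u1] := u01.
have := orlicz_convex hPsi (_ : (0 <= x%:E)%E) (lexx 0%E) u01.
rewrite lee_fin => /(_ x0); rewrite mule0 adde0 (orlicz_0 hPsi) mule0 adde0.
by rewrite -EFinM !psiE ?mulr_ge0// -EFinM lee_fin.
Qed.

Lemma psi_superlinear L : exists2 X : R, 0 < X & forall x, X <= x -> L * x <= psi x.
Proof.
have /cvgeyPge/(_ L)[X0 [_ HX]] := orlicz_superlinear hPsi.
exists (Num.max 1 (X0 + 1)); first by rewrite lt_max ltr01.
move=> x; rewrite ge_max => /andP[x1 xX].
have x0 : 0 < x by lra.
have := HX x (_ : X0 < x); rewrite psiE ?(ltW x0)// -EFinM lee_fin.
by rewrite ler_pdivlMr//; apply; lra.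
Qed.

Lemma not_Delta2_growth K X : ~ Delta2 Psi -> 0 < K ->
  exists x, [/\ 0 <= x, X <= x & K * psi x < psi (2 * x)].
Proof.
move=> nD K0; apply: contrapT => H; apply: nD; exists K => //.
exists (Num.max 0 X); split; first exact: num_real.
move=> x; rewrite gt_max => /andP[x0 xX].
rewrite !psiE ?(ltW x0) ?mulr_ge0 ?(ltW x0)// -EFinM lee_fin leNgt; apply/negP => Hx.
by apply: H; exists x; split=> //; exact: ltW.
Qed.

End orlicz_function.

Section boundary_values.
Variable R : realType.
Local Notation C := R[i].
Local Notation mu := (@lebesgue_measure R).
Implicit Types (t r : R) (z : C) (f g : C -> C).

Lemma boundary_radial_limit f t l : radial_limit f t l -> boundary f (circ t) = l.
Proof.
move=> fl; rewrite /boundary; apply: (@cvg_lim C^o); first exact: norm_hausdorff.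
apply/cvgrPdist_le => /= -[e ei].
rewrite ltcE /= => /andP[/eqP ei0 e0].
have [d d0 Hd] := fl _ e0.
near=> r.
rewrite -[`|_|]/((modulus _)%:C%C) lecE /= ei0 eqxx /= modulusC.
by apply/ltW/Hd; near: r; [apply: nbhs_left_ge|apply: nbhs_left_gt; lra|exact: nbhs_left_lt].
Unshelve. all: by end_near.
Qed.

Lemma radial_limit_ccont f t : ccont f (circ t) -> radial_limit f t (f (circ t)).
Proof.
move=> cf e e0; have [d d0 Hd] := cf _ e0; exists d => // r r0 rd r1; apply: Hd.
have -> : r%:C%C * circ t - circ t = - ((1 - r)%:C%C * circ t) :> C.
  by rewrite rmorphB rmorph1; ring.
by rewrite modulusN modulus_polar; lra.
Qed.

Lemma circle_negligible (A : set R) : mu.-negligible A ->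
  exists Z, [/\ measurable Z, circle_measure R Z = 0%E & A `<=` Z].
Proof.
move=> [Z [mZ Z0 AZ]]; exists Z; split => //.
have /null_content_dominatesP H := @dominates_uniform_prob R _ _ (two_pi_gt0 R).
exact: H.
Qed.

Lemma circle_measure_itv (a b : R) : 0 <= a -> a <= b -> b <= 2 * pi ->
  circle_measure R `[a, b]%classic = ((b - a) / (2 * pi))%:E.
Proof.
move=> a0 ab b2; have mab : measurable (`[a, b]%classic : set R) by exact: measurable_itv.
have L : lebesgue_measure (`[a, b]%classic : set R) = (b - a)%:E.
  rewrite lebesgue_measure_itv /= lte_fin -EFinD; move: ab; rewrite le_eqVlt => /predU1P[->|->//].
  by rewrite ltxx subrr.
have := integral_indic (circle_measure R) measurableT mab; rewrite setIT => <-.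
rewrite /circle_measure integral_uniform => [| |t]; last by rewrite lee_fin indicE ler0n.
  rewrite integral_indic// subr0 setIidl; last first.
    by move=> t; rewrite /= !in_itv /= => /andP[t1 t2]; rewrite (le_trans a0)//= (le_trans t2).
  transitivity (((2 * pi)^-1)%:E * (b - a)%:E)%E; last by rewrite -EFinM mulrC.
  by congr (_ * _)%E; exact: L.
by apply/measurable_EFinP; exact: measurable_indic.
Qed.

End boundary_values.

(** * Peak functions and lower bounds on the modular *)

Section not_compact.
Variables (R : realType) (Psi : \bar R -> \bar R).
Hypothesis hPsi : orlicz Psi.
Local Notation C := R[i].
Local Notation cm := (circle_measure R).
Local Notation psi := (psi Psi).
Implicit Types (t r h : R) (z w : C) (f g : C -> C).

Definition peak (x h : R) w : C := x%:C%C * (h%:C%C / (1 + h%:C%C - w)) ^+ 2.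

Lemma peak_denom h w : 0 < h -> modulus w <= 1 -> h <= modulus (1 + h%:C%C - w).
Proof.
move=> h0 w1; have := modulus_lowerB (1 + h%:C%C) w.
have -> : 1 + h%:C%C = (1 + h)%:C%C :> C by rewrite rmorphD rmorph1.
by rewrite modulus_ge0_real; lra.
Qed.

Lemma cder_peak x h w : 0 < h -> modulus w <= 1 -> cder (peak x h) w.
Proof.
move=> h0 w1; have D0 : 1 + h%:C%C - w != 0.
  by rewrite -modulus_gt0; apply: lt_le_trans (peak_denom h0 w1).
apply: cderM; first exact: cder_cst.
apply: (cderX (f := fun w => _)); apply: cderM; first exact: cder_cst.
by apply: cderV => //; apply: cderB; [exact: cder_cst|exact: cder_id].
Qed.

Lemma modulus_peak x h w : 0 <= x -> 0 <= h ->
  modulus (peak x h w) = x * (h / modulus (1 + h%:C%C - w)) ^+ 2.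
Proof. by move=> x0 h0; rewrite modulusM modulusX modulusM modulusV !modulus_ge0_real. Qed.

Lemma modulus_peak_le x h w : 0 <= x -> 0 < h -> modulus w <= 1 -> modulus (peak x h w) <= x.
Proof.
move=> x0 h0 w1; rewrite modulus_peak ?(ltW h0)// ler_piMr//.
have D := peak_denom h0 w1.
rewrite expr_le1 ?divr_ge0 ?modulus_ge0 ?(ltW h0)// ler_pdivrMr ?mul1r//.
exact: lt_le_trans D.
Qed.

Lemma modulus_peak_ge x h w : 0 <= x -> 0 < h -> modulus w <= 1 -> modulus (w - 1) <= h ->
  x / 4 <= modulus (peak x h w).
Proof.
move=> x0 h0 w1 wh; rewrite modulus_peak ?(ltW h0)// ler_wpM2l//.
have D := peak_denom h0 w1; have D0 : 0 < modulus (1 + h%:C%C - w) by exact: lt_le_trans D.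
have D2 : modulus (1 + h%:C%C - w) <= 2 * h.
  have -> : 1 + h%:C%C - w = h%:C%C - (w - 1) by ring.
  by apply: le_trans (modulusB _ _) _; rewrite modulus_ge0_real ?(ltW h0)//; lra.
have -> : 4^-1 = (2^-1) ^+ 2 :> R by field.
rewrite ler_pXn2r ?nnegrE ?divr_ge0 ?(ltW D0) ?(ltW h0)// ler_pdivlMr//; lra.
Qed.

Lemma modulus_peak_far x h w (c : R) : 0 <= x -> 0 < h -> 0 < c -> modulus w <= 1 - c ->
  modulus (peak x h w) <= x * h ^+ 2 / c ^+ 2.
Proof.
move=> x0 h0 c0 wc; rewrite modulus_peak ?(ltW h0)// -mulrA -expr_div_n ler_wpM2l//.
have D : c <= modulus (1 + h%:C%C - w).
  have := modulus_lowerB (1 + h%:C%C) w.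
  have -> : 1 + h%:C%C = (1 + h)%:C%C :> C by rewrite rmorphD rmorph1.
  by rewrite modulus_ge0_real; lra.
have D0 : 0 < modulus (1 + h%:C%C - w) by exact: lt_le_trans D.
by rewrite ler_pXn2r ?nnegrE ?divr_ge0 ?(ltW D0) ?(ltW h0) ?(ltW c0)// ler_pM2l// lef_pV2.
Qed.

(** The integrand is h / (h + 2) times the Poisson kernel of the point 1 / (1 + h), which has mean
    1. *)
Lemma peak_mean h : 0 < h ->
  ravg (fun t => (h / modulus (1 + h%:C%C - circ t)) ^+ 2) = h / (h + 2).
Proof.
move=> h0; pose z : C := (1 + h)^-1%:C%C.
have hi : 0 < (1 + h)^-1 < 1 by rewrite invr_gt0 invf_lt1; lra.
have z1 : modulus z < 1 by rewrite modulus_ge0_real; lra.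
have P1 := ravg_poisson z1.
have cP := @rcont_poisson R z 0 (2 * pi) z1.
transitivity (ravg (fun t => h / (h + 2) * poisson z t)); last by rewrite ravgZ// P1 mulr1.
apply: eq_ravg => t; rewrite /poisson modulus_ge0_real; last by lra.
have -> : modulus (1 + h%:C%C - circ t) = (1 + h) * modulus (1 - z * (circ t)^*%C).
  have -> : modulus (1 - z * (circ t)^*%C) = modulus (1 - z * circ t).
    by rewrite -modulusJ conjB conjM conjcK conjc1 conjc_real.
  rewrite -[X in X * _]modulus_ge0_real -?modulusM; last by lra.
  have zE : (1 + h)%:C%C * z = 1.
    by rewrite /z -(rmorphM (real_complex R)) mulfV ?rmorph1//; lra.
  by rewrite mulrBr mulrA zE mul1r mulr1 rmorphD rmorph1.
have D0 : modulus (1 - z * (circ t)^*%C) != 0 by rewrite modulus_eq0 circ_denom_neq0.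
field; rewrite D0 /=; lra.
Qed.

(** On the circle the modulus is x u with 0 <= u <= 1, and convexity gives Psi(x u) <= u Psi(x). By
    [peak_mean] the modular is at most Psi(x) h / (h + 2) <= 1. *)
Lemma peak_HPsi x h : 0 <= x -> 0 < h -> psi x * h <= 1 ->
  HPsi Psi (peak x h) /\ (HPsi_norm Psi (peak x h) <= 1)%E.
Proof.
move=> x0 h0 xh.
have hp : hol (peak x h) by move=> z dz; apply: cder_peak => //; exact: ltW.
have bp t : boundary (peak x h) (circ t) = peak x h (circ t).
  by apply/boundary_radial_limit/radial_limit_ccont/cder_ccont/cder_peak; rewrite ?modulus_circ.
have cp y t : pcontat (fun t => peak y h (circ t)) t.
  by apply: pcontat_comp; [exact: pcontat_circ|apply/cder_ccont/cder_peak; rewrite ?modulus_circ].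
have M1 : (modular Psi 1 (boundary (peak x h)) <= 1)%E.
  pose u t := modulus (peak 1 h (circ t)).
  have u01 t : 0 <= u t <= 1 by rewrite modulus_ge0 modulus_peak_le ?modulus_circ.
  have cu t : {for t, continuous u} by exact: pcontat_modulus.
  apply: (@le_trans _ _ (\int[cm]_t (psi x * u t)%:E)%E).
    apply: le_integral_setT => t.
      by apply: (orlicz_ge0 hPsi); rewrite lee_fin divr1 modulus_ge0.
    rewrite divr1 bp; have -> : modulus (peak x h (circ t)) = u t * x.
      by rewrite /u !modulus_peak ?(ltW h0)// mul1r mulrC.
    have /andP[ut0 ut1] := u01 t.
    by rewrite psiE// ?mulr_ge0// lee_fin mulrC; rewrite mulrC (mulrC (psi x)); exact: psi_convex0.
  rewrite circle_integral => [|t|t]; last 2 first.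
  - by apply: continuousM; [exact: cst_continuous|exact: cu].
  - by apply: mulr_ge0; [exact: psi_ge0|case/andP: (u01 t)].
  rewrite lee_fin ravgZ => [|t _]; last exact: cu.
  have -> : ravg u = h / (h + 2).
    rewrite -peak_mean//; apply: eq_ravg => t.
    by rewrite /u modulus_peak ?(ltW h0)// mul1r.
  rewrite mulrA ler_pdivrMr; lra.
split; last by apply: ereal_inf_lbound; exists 1.
split.
  split; first exact/holP.
  apply: (@le_lt_trans _ _ x%:E); last exact: ltry.
  apply/Hp1_norm_le => // r r0 r1; rewrite -[leRHS](ravg_cst x).
  apply: ravg_le => [||t _].
  - by apply: pcont_modulus; exact: hol_circle.
  - by move=> t _; exact: cst_continuous.
  - by apply: modulus_peak_le => //; rewrite modulus_polar// ltW.
split; last by exists 1 => //; apply: le_lt_trans M1 _; exact: ltry.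
split; apply: continuous_measurable_fun => t.
- have -> : (fun t => complex.Re (boundary (peak x h) (circ t))) = (fun t => complex.Re (peak x h (circ t))).
    by apply/funext => s; rewrite bp.
  exact: pcontat_Re.
- have -> : (fun t => complex.Im (boundary (peak x h) (circ t))) = (fun t => complex.Im (peak x h (circ t))).
    by apply/funext => s; rewrite bp.
  exact: pcontat_Im.
Qed.

(** Chebyshev's inequality for the modular. *)
Lemma modular_ge (F : C -> C) (K y : R) (B : set R) : 0 < K -> 0 <= y -> measurable B ->
  (forall t, B t -> y * K <= modulus (F (circ t))) ->
  ((psi y)%:E * cm B <= modular Psi K F)%E.
Proof.
move=> K0 y0 mB HB.
have <- : (\int[cm]_t (psi y * \1_B t)%:E)%E = ((psi y)%:E * cm B)%E.
  under eq_integral do rewrite EFinM.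
  rewrite ge0_integralZl//; last 2 first.
  - by apply/measurable_EFinP; exact: measurable_indic.
  - by rewrite lee_fin psi_ge0.
  by rewrite integral_indic// setIT.
apply: le_integral_setT => t; first by rewrite lee_fin mulr_ge0 ?psi_ge0.
have F0 : 0 <= modulus (F (circ t)) / K by rewrite divr_ge0 ?modulus_ge0 ?ltW.
rewrite psiE// lee_fin indicE; have [tB|tB] := boolP (t \in B).
  by rewrite mulr1; apply: psi_le => //; rewrite ler_pdivlMr//; apply: HB; rewrite inE in tB.
by rewrite mulr0 psi_ge0.
Qed.

Lemma cvg_ereal0_lt (v : nat -> \bar R) : v n @[n --> \oo] --> 0%E ->
  forall e : R, 0 < e -> exists N, forall n, (N <= n)%N -> (v n < e%:E)%E.
Proof.
move=> /fine_cvgP[[N1 _ H1] /cvgrPdist_lt H2] e /H2[N2 _ H3].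
exists (maxn N1 N2) => n; rewrite geq_max => /andP[/H1 n1 /H3].
by rewrite sub0r normrN /= => /(le_lt_trans (ler_norm _)); rewrite -lte_fin fineK.
Qed.

Lemma measurable_lower_set (A : set R) (F : R -> C) (c : R) : measurable A ->
  measurable_fun A (fun t => complex.Re (F t)) -> measurable_fun A (fun t => complex.Im (F t)) ->
  0 <= c -> measurable (A `&` [set t | c <= modulus (F t)]).
Proof.
move=> mA mR mI c0.
have -> : [set t | c <= modulus (F t)] =
    (fun t => complex.Re (F t) ^+ 2 + complex.Im (F t) ^+ 2) @^-1` `[c ^+ 2, +oo[%classic.
  apply/seteqP; split => t /=; rewrite in_itv /= andbT -modulusE ler_pXn2r ?nnegrE ?modulus_ge0//.
suff : measurable_fun A (fun t => complex.Re (F t) ^+ 2 + complex.Im (F t) ^+ 2).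
  by move=> /(_ mA); apply; exact: measurable_itv.
by apply: measurable_funD; apply: measurable_funX.
Qed.

End not_compact.

Section not_compact_operator.
Variables (R : realType) (Psi : \bar R -> \bar R).
Hypothesis hPsi : orlicz Psi.
Local Notation C := R[i].
Local Notation cm := (circle_measure R).
Local Notation psi := (psi Psi).
Implicit Types (t r h : R) (z w : C) (f g : C -> C).
Variable phi : C -> C.
Hypotheses (phi_der : forall z, z != 1 -> cder phi z)
  (phi_lt1 : forall z, modulus z <= 1 -> z != 1 -> modulus (phi z) < 1).

Lemma circ_neq1 t : 0 < t -> t < 2 * pi -> circ t != 1 :> C.
Proof.
move=> t0 t1; apply/eqP => /(congr1 (@complex.Re _)); rewrite /circ /= => E.
by have := cos_lt1 t0 t1; rewrite E ltxx.
Qed.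

(** On the arc, |1 - circ t| is at least 1 minus the maximum of the cosine, which is positive, and
    [phi_away] applies. *)
Lemma phi_arc_away (a b : R) : 0 < a -> a <= b -> b < 2 * pi ->
  exists2 c : R, 0 < c & forall t, a <= t <= b -> modulus (phi (circ t)) <= 1 - c.
Proof.
move=> a0 ab b2.
have [|m /[!in_itv]/= /andP[am mb] Hm] := @EVT_max R cos a b ab.
  by apply: rcont_within => t _; exact: continuous_cos.
have cm1 : cos m < 1 by apply: cos_lt1; lra.
have [|eta eta1 He] := phi_away phi_der phi_lt1 (_ : 0 < 1 - cos m); first by rewrite subr_gt0.
exists (1 - eta); first by rewrite subr_gt0.
move=> t tab; rewrite subKr; apply: He; first by rewrite modulus_circ.
have := Hm t; rewrite in_itv /= tab => /(_ isT) H.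
by have := le_trans (ler_norm _) (Re_le_modulus (1 - circ t)); rewrite /circ /=; lra.
Qed.

Lemma boundary_comp_sub f g t : 0 < t -> t < 2 * pi -> (forall w, modulus w <= 1 -> cder f w) ->
  radial_cvg g t ->
  boundary (composition_operator phi f - g) (circ t) = f (phi (circ t)) - boundary g (circ t).
Proof.
move=> t0 t1 df [l gl]; rewrite (boundary_radial_limit gl); apply: boundary_radial_limit.
have t1' := circ_neq1 t0 t1.
apply: radial_limitD.
  apply/radial_limit_ccont/cder_ccont; apply: cder_comp; first exact: phi_der.
  by apply/df/ltW/phi_lt1; rewrite ?modulus_circ.
move=> e /gl[d d0 Hd]; exists d => // r r0 r1 r2.
by have := Hd _ r0 r1 r2; rewrite -modulusN opprB addrC opprK addrC.
Qed.

(** What the symbol has to supply. In [arc_long], 4 pi = 2 x 2 pi: the normalized measure of the arc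
    exceeds 2 / Psi(2 x), while each of the two pieces covering it in the proof has measure at most
    1 / Psi(2 x). *)
Variables (x a b : nat -> R).
Hypotheses (x_ge : forall n, n.+1%:R <= x n) (psi_ge1 : forall n, 1 <= psi (x n))
  (arc : forall n, [/\ 0 < a n, a n <= b n & b n < 2 * pi])
  (phi_arc : forall n t, a n <= t <= b n -> modulus (phi (circ t) - 1) <= (psi (x n))^-1)
  (arc_long : forall n, 4 * pi < (b n - a n) * psi (2 * x n)).

Lemma not_compact_HPsi :
  ~ compact_operator (HPsi Psi) (HPsi_norm Psi) (composition_operator phi).
Proof.
have x_gt0 n : 0 < x n by apply: lt_le_trans (x_ge n).
pose h n := (psi (x n))^-1; pose f n := peak (x n) (h n).
have psi_gt0 n : 0 < psi (x n) by apply: lt_le_trans (psi_ge1 n).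
have h0 n : 0 < h n by rewrite invr_gt0.
have h1 n : h n <= 1 by rewrite invf_le1.
have fP n : HPsi Psi (f n) /\ (HPsi_norm Psi (f n) <= 1)%E.
  by apply: peak_HPsi => //; [exact: ltW|rewrite /h mulfV// gt_eqF].
move=> /(_ f (fun n => (fP n).1)) [|s [s_mono [g [Hg [[mgR mgI] _]] cvg0]]].
  by exists 1 => n; case: (fP n).
have s_ge n : (n <= s n)%N.
  by elim: n => // n IH; apply: leq_ltn_trans IH (s_mono _ _ (ltnSn n)).
(* For K < 1/32, a difference of at least X / 16 divided by K is at least 2 X, the argument at which
   [Psi] is large. *)
have [|N HN] := cvg_ereal0_lt cvg0 (_ : 0 < 32^-1); first by rewrite invr_gt0.
have {}HN n : (N <= n)%N -> exists K, [/\ 0 < K, K < 32^-1 &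
    (modular Psi K (boundary (composition_operator phi (f (s n)) - g)%R) <= 1)%E].
  by move=> /HN/ereal_inf_lt[_ [K [K0 MK] <-]]; rewrite lte_fin => K32; exists K.
have hg : hol g by apply/holP; case: Hg.
have [Z [mZ Z0 HZ]] : exists Z, [/\ measurable Z, cm Z = 0%E &
    forall t, 0 <= t <= 2 * pi -> ~ Z t -> radial_cvg g t].
  have [M M0 HM] := Hp_fin Hg.
  have /(Hp1_norm_le hg M0) gM := HM.
  have [Z [mZ Z0 AZ]] := circle_negligible (fatou_radial_limit hg gM).
  by exists Z; split=> // t t2 nZ; apply: contrapT => nr; apply/nZ/AZ.
have [a0 ab b2] := arc (s N).
pose X := x (s N); have X0 : 0 < X by exact: x_gt0.
pose A := `[a (s N), b (s N)]%classic : set R.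
have mA : measurable A by exact: measurable_itv.
have A2pi t : A t -> 0 < t /\ t < 2 * pi.
  by rewrite /A /= in_itv /= => /andP[at_ tb]; split; lra.
have [c c0 Hc] := phi_arc_away a0 ab b2.
(* Far from 1 the peak is at most x h^2 / c^2 <= x / (Psi(x) c^2), as h = 1 / Psi(x) <= 1;
   superlinearity with this constant brings it below X / 8. *)
have [X1 X10 HX1] := psi_superlinear hPsi (8 / (c ^+ 2 * X)).
pose m := maxn N (Num.trunc X1).
have farm t : A t -> modulus (f (s m) (phi (circ t))) <= X / 8.
  rewrite /A /= in_itv /= => tA.
  apply: le_trans (modulus_peak_far (ltW (x_gt0 _)) (h0 _) c0 (Hc _ tA)) _.
  have xX1 : X1 <= x (s m).
    apply: le_trans (x_ge _); apply: (le_trans (ltW (truncnS_gt X1))).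
    by rewrite ler_nat ltnS (leq_trans _ (s_ge m))// leq_maxr.
  have := HX1 _ xX1; rewrite mulrAC ler_pdivrMr ?mulr_gt0 ?exprn_gt0// => H.
  rewrite ler_pdivrMr ?exprn_gt0// expr2.
  apply: (@le_trans _ _ (x (s m) * h (s m))).
    by rewrite mulrA ler_piMr// mulr_ge0// ltW.
  by rewrite /h ler_pdivrMr//; lra.
have near t : A t -> X / 4 <= modulus (f (s N) (phi (circ t))).
  move=> At; have [t0 t1] := A2pi _ At.
  apply: modulus_peak_ge => //; first exact: ltW.
    by apply/ltW/phi_lt1; rewrite ?modulus_circ ?circ_neq1.
  by apply: phi_arc; move: At; rewrite /A /= in_itv.
pose G k t := f (s k) (phi (circ t)) - boundary g (circ t).
pose B k := A `&` [set t | X / 16 <= modulus (G k t)].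
have fder k w : modulus w <= 1 -> cder (f k) w by move=> w1; exact: cder_peak.
have cG k : pcont (a (s N)) (b (s N)) (fun t => f (s k) (phi (circ t))).
  move=> t tA; have [t0 t1] : 0 < t /\ t < 2 * pi by apply: A2pi; rewrite /A /= in_itv.
  have t1' := circ_neq1 t0 t1.
  apply: (pcontat_comp (F := fun z => f (s k) (phi z))); first exact: pcontat_circ.
  apply/cder_ccont; apply: cder_comp; first exact: phi_der.
  by apply/fder/ltW/phi_lt1; rewrite ?modulus_circ.
have mcont (u : R -> R) : rcont (a (s N)) (b (s N)) u -> measurable_fun A u.
  by move=> /rcont_within cu; exact: subspace_continuous_measurable_fun.
have mB k : measurable (B k).
  apply: (measurable_lower_set mA); last by rewrite divr_ge0// ltW.
  - have -> : (fun t => complex.Re (G k t)) = (fun t => complex.Re (f (s k) (phi (circ t)))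
        - complex.Re (boundary g (circ t))) by apply/funext => t; rewrite /G creD creN.
    by apply: measurable_funB; [apply: mcont; exact: pcont_Re|exact: measurable_funTS mgR].
  - have -> : (fun t => complex.Im (G k t)) = (fun t => complex.Im (f (s k) (phi (circ t)))
        - complex.Im (boundary g (circ t))) by apply/funext => t; rewrite /G cimD cimN.
    by apply: measurable_funB; [apply: mcont; exact: pcont_Im|exact: measurable_funTS mgI].
have small k : (N <= k)%N -> ((psi (2 * X))%:E * cm (B k) <= 1)%E.
  move=> Nk; have [K [K0 K32 MK]] := HN k Nk.
  have p0 : (0 <= (psi (2 * X))%:E)%E by rewrite lee_fin psi_ge0// mulr_ge0// ltW.
  (* Off the null set [Z] the radial limits of [g] exist, so the boundary function of the difference
     is [G k] there. *)
  apply: le_trans MK; apply: (@le_trans _ _ ((psi (2 * X))%:E * cm (B k `\` Z))%E).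
    apply: lee_wpmul2l => //.
    exact: (@le_measure_setD_null _ (measurableTypeR R) R cm _ _ (mB k) mZ Z0).
  apply: modular_ge => //; [by rewrite mulr_ge0// ltW|exact: measurableD|].
  move=> t [[At Xt] nZ]; have [t0 t1] := A2pi _ At.
  rewrite boundary_comp_sub//; last 2 first.
  - exact: fder.
  - by apply: HZ => //; rewrite !ltW.
  apply: le_trans Xt; nra.
(* If both differences were below X / 16, the peak of index N, at least X / 4 on the arc, would be
   less than X / 8 + 2 (X / 16) = X / 4. *)
have cover : A `<=` B N `|` B m.
  move=> t At; have [BN|BN] := leP (X / 16) (modulus (G N t)); first by left.
  right; split=> //=; have := near _ At; have := farm _ At.
  have -> : f (s N) (phi (circ t)) = f (s m) (phi (circ t)) + (G N t - G m t) by rewrite /G; ring.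
  have := modulusD (f (s m) (phi (circ t))) (G N t - G m t).
  by have := modulusB (G N t) (G m t); lra.
have cmA : cm A = ((b (s N) - a (s N)) / (2 * pi))%:E.
  by apply: circle_measure_itv => //; exact: ltW.
have : ((psi (2 * X))%:E * cm A <= 2%:E)%E.
  have p0 : (0 <= (psi (2 * X))%:E)%E by rewrite lee_fin psi_ge0// mulr_ge0// ltW.
  apply: (@le_trans _ _ ((psi (2 * X))%:E * (cm (B N) + cm (B m)))%E).
    apply: lee_wpmul2l => //.
    exact: (@le_measure_cover2 _ (measurableTypeR R) R cm _ _ _ mA (mB N) (mB m) cover).
  rewrite ge0_muleDr//; have := leeD (small N (leqnn _)) (small m (leq_maxl _ _)).
  by [].
rewrite cmA -EFinM lee_fin mulrA ler_pdivrMr ?pi2_gt0//.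
by have := arc_long (s N); rewrite -/X; lra.
Qed.

End not_compact_operator.


Theorem theorem3p1 (R : realType) (Psi : \bar R -> \bar R)
    (hPsi : orlicz Psi) (hDelta2 : ~ Delta2 Psi) :
  exists phi : R[i] -> R[i],
    analytic_self_map phi /\
    compact_operator (Hp 2%R) (Hp_norm 2%R) (composition_operator phi) /\
    ~ compact_operator (HPsi Psi) (HPsi_norm Psi) (composition_operator phi).
Proof.
have K0 q : 0 < 4 * pi / touch_rate R q.
  by rewrite divr_gt0 ?touch_rate_gt0// mulr_gt0 ?pi_gt0.
have [X1 _ HX1] := psi_superlinear hPsi 1.
(* The growth factor is dictated by the rate at q. The lower bound q + 1 makes the x q unbounded,
   and [X1] ensures Psi(x q) >= x q >= 1. *)
have /choice[x Hx] : forall q : nat, exists x : R, [/\ q.+1%:R <= x, 1 <= psi Psi x &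
    4 * pi / touch_rate R q * psi Psi x < psi Psi (2 * x)].
  move=> q; have [x [x0 + xK]] := not_Delta2_growth hPsi (Num.max q.+1%:R X1) hDelta2 (K0 q).
  rewrite ge_max => /andP[xq xX]; exists x; split=> //.
  by apply: le_trans (HX1 _ xX); rewrite mul1r; apply: le_trans xq; rewrite ler1n.
(* With this precision the distance from b q to an integer is at most h / 16 for h = 1 / Psi(x q),
   as [symbol_touch] requires. *)
have [b [b0 b1 irr lio]] := liouville R (fun q => Num.trunc (16 * psi Psi (x q))).
have /choice[u Hu] : forall N, exists qp : nat * nat, [/\ (N <= qp.1)%N, odd qp.1 &
    `|b * qp.1%:R - qp.2%:R| <= (psi Psi (x qp.1))^-1 / 16].
  move=> N; have [q [p [Nq oq qp]]] := lio N; exists (q, p); split => //.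
  have [_ psi1 _] := Hx q.
  apply: le_trans qp _; rewrite -invfM mulrC lef_pV2 ?posrE ?ltr0Sn//; last by lra.
  by apply: ltW; exact: truncnS_gt.
have der := @cder_symbol R b; have lt1 := modulus_symbol_lt1 b0 irr.
have real r := @modulus_symbol_real R b r b0.
exists (symbol b); split; first exact: symbol_self_map der lt1.
split; first exact: compact_H2 der lt1 real.
have q0 n : (0 < (u n).1)%N by have [_ + _] := Hu n; case: (u n).1.
have h01 n : 0 < (psi Psi (x (u n).1))^-1 <= 1.
  have [_ psi1 _] := Hx (u n).1; rewrite invr_gt0 invf_le1; [apply/andP; split|]; lra.
apply: (not_compact_HPsi hPsi der lt1 (x := fun n => x (u n).1)
  (a := fun n => touch_angle R (u n).1)
  (b := fun n => touch_angle R (u n).1 + touch_rate R (u n).1 * (psi Psi (x (u n).1))^-1)) => [n|n|n|n t tab|n].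
- have [xq _ _] := Hx (u n).1; have [nq _ _] := Hu n.
  by apply: le_trans xq; rewrite ler_nat.
- by have [] := Hx (u n).1.
- have /andP[t0 t1] := touch_angle_itv R (q0 n); have /andP[h0 h1] := h01 n.
  have k0 := touch_rate_gt0 R (u n).1; have k1 := touch_rate_le R (u n).1.
  have kh := mulr_gt0 k0 h0; have kh1 := ler_piMr (ltW k0) h1; have := pi_ge2 R.
  by split; lra.
- have /andP[h0 h1] := h01 n; have [_ oq bq] := Hu n.
  exact: symbol_touch b0 b1 oq h0 h1 bq t tab.
- have [_ psi1 Kx] := Hx (u n).1; have k0 := touch_rate_gt0 R (u n).1.
  have p0 : 0 < psi Psi (x (u n).1) by lra.
  rewrite addrC addKr.
  by rewrite mulrAC ltr_pdivlMr// [ltRHS]mulrC -ltr_pdivrMr// mulrAC.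
Qed.
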